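(* Let $\lambda$ be an infinite cardinal with $\lambda=\lambda^{<\lambda}$, and assume $\diamondsuit_S$ where $S=\{\delta<\lambda^+:\mathrm{cf}(\delta)=\lambda\}$. Then for any model $M$ of PA there is a $\lambda$-saturated model $N$ of $\mathrm{Th}(M)$ of cardinality $\lambda^+$ such that $E^5_N\subseteq E^4_N$.
   Context: Models of PA are in the vocabulary $\{0,1,<,+,\times\}$ and ordinary, i.e. $\mathbb N$ is an initial segment. On $N\setminus\mathbb N$: $a\,E^4_N\,b$ iff there is $n\in\mathbb N$ with $a<_N b^n$ and $b<_N a^n$; $a\,E^5_N\,b$ iff some automorphism of the linear order $(N,<_N)$ maps $a$ to $b$. *)

(* Defs.v *)
From mathcomp Require Import all_boot all_order.
From mathcomp Require Import boolp classical_sets functions cardinality wochoice.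

Set Implicit Arguments.
Unset Strict Implicit.
Unset Printing Implicit Defensive.

Local Open Scope classical_set_scope.
Local Open Scope card_scope.
Local Open Scope order_scope.

(** * First-order logic in the vocabulary {0, 1, <, +, *} *)

(* Free variables are indexed by an arbitrary type V; a quantifier binds [None].
   Hence [form void] is the type of sentences, and [form (option A)] is the type
   of formulas in one free variable [None] with parameters from A. *)

Inductive term (V : Type) : Type :=
| Var of V
| Zero
| One
| Add of term V & term V
| Mul of term V & term V.

Arguments Zero {V}.
Arguments One {V}.

Inductive form (V : Type) : Type :=
| Equal of term V & term V
| Less of term V & term V
| Bot
| Imp of form V & form V
| All of form (option V).

Arguments Bot {V}.

Definition Neg (V : Type) (p : form V) : form V := Imp p Bot.
Definition And (V : Type) (p q : form V) : form V := Neg (Imp p (Neg q)).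
Definition Iff (V : Type) (p q : form V) : form V := And (Imp p q) (Imp q p).
Definition Ex (V : Type) (p : form (option V)) : form V := Neg (All (Neg p)).

Fixpoint tsubst (V W : Type) (s : V -> term W) (t : term V) : term W :=
  match t with
  | Var v => s v
  | Zero => Zero
  | One => One
  | Add t1 t2 => Add (tsubst s t1) (tsubst s t2)
  | Mul t1 t2 => Mul (tsubst s t1) (tsubst s t2)
  end.

Definition up_subst (V W : Type) (s : V -> term W) (v : option V) : term (option W) :=
  if v is Some w then tsubst (fun u => Var (Some u)) (s w) else Var None.

Fixpoint fsubst (V : Type) (p : form V) :
    forall W : Type, (V -> term W) -> form W :=
  match p with
  | Equal t1 t2 => fun W s => Equal (tsubst s t1) (tsubst s t2)
  | Less t1 t2 => fun W s => Less (tsubst s t1) (tsubst s t2)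
  | Bot => fun W s => Bot
  | Imp p1 p2 => fun W s => Imp (fsubst p1 s) (fsubst p2 s)
  | All p1 => fun W s => All (fsubst p1 (up_subst s))
  end.

Record structure := Structure {
  carrier :> Type;
  zero : carrier;
  one : carrier;
  add : carrier -> carrier -> carrier;
  mul : carrier -> carrier -> carrier;
  less : carrier -> carrier -> Prop
}.

Arguments zero {s}.
Arguments one {s}.

Fixpoint teval (M : structure) (V : Type) (v : V -> M) (t : term V) : M :=
  match t with
  | Var x => v x
  | Zero => zero
  | One => one
  | Add t1 t2 => add (teval v t1) (teval v t2)
  | Mul t1 t2 => mul (teval v t1) (teval v t2)
  end.

Definition extend (T V : Type) (v : V -> T) (a : T) (x : option V) : T :=
  if x is Some y then v y else a.

Fixpoint holds (M : structure) (V : Type) (p : form V) : (V -> M) -> Prop :=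
  match p with
  | Equal t1 t2 => fun v => teval v t1 = teval v t2
  | Less t1 t2 => fun v => less (teval v t1) (teval v t2)
  | Bot => fun v => False
  | Imp p1 p2 => fun v => holds p1 v -> holds p2 v
  | All p1 => fun v => forall a : M, holds p1 (extend v a)
  end.

Definition Th (M : structure) : set (form void) :=
  [set p | holds p (@of_void M)].

(** * Peano arithmetic *)

(* The axioms are the universal closures of the following formulas. *)
Inductive PA : set (form nat) :=
| PA_succ_neq0 : PA (Neg (Equal (Add (Var 0) One) Zero))
| PA_succ_inj :
    PA (Imp (Equal (Add (Var 0) One) (Add (Var 1) One)) (Equal (Var 0) (Var 1)))
| PA_add0 : PA (Equal (Add (Var 0) Zero) (Var 0))
| PA_addS :
    PA (Equal (Add (Var 0) (Add (Var 1) One)) (Add (Add (Var 0) (Var 1)) One))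
| PA_mul0 : PA (Equal (Mul (Var 0) Zero) Zero)
| PA_mulS :
    PA (Equal (Mul (Var 0) (Add (Var 1) One)) (Add (Mul (Var 0) (Var 1)) (Var 0)))
| PA_lt :
    PA (Iff (Less (Var 0) (Var 1))
            (Ex (Equal (Add (Var (Some 0)) (Add (Var None) One)) (Var (Some 1)))))
| PA_induction (p : form (option nat)) :
    PA (Imp (fsubst p (fun x => if x is Some y then Var y else Zero))
         (Imp (All (Imp p (fsubst p (fun x => if x is Some y then Var (Some y)
                                              else Add (Var None) One))))
              (All p))).

Definition model_of_PA (M : structure) : Prop :=
  forall p, PA p -> forall v : nat -> M, holds p v.

Fixpoint numeral (M : structure) (n : nat) : M :=
  if n is m.+1 then add (numeral M m) one else zero.

(* The standard part of M: the copy of the natural numbers inside M. *)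
Definition standard (M : structure) : set M := range (numeral M).

Fixpoint power (M : structure) (a : M) (n : nat) : M :=
  if n is m.+1 then mul (power a m) a else one.

Definition E4 (N : structure) (a b : N) : Prop :=
  [/\ ~ standard a, ~ standard b &
      exists n : nat, less a (power b n) /\ less b (power a n)].

Definition order_automorphism (N : structure) (f : N -> N) : Prop :=
  bijective f /\ forall x y : N, less x y <-> less (f x) (f y).

Definition E5 (N : structure) (a b : N) : Prop :=
  [/\ ~ standard a, ~ standard b &
      exists2 f : N -> N, order_automorphism f & f a = b].

(** * Cardinals, cofinality and the diamond principle *)

Definition card_lt (T U : Type) (A : set T) (B : set U) : Prop :=
  (A #<= B) /\ ~ (B #<= A).

(* Ordinals are represented by well-ordered types; the elements of such a type
   are the ordinals below it, [below a] being the ordinal a itself. *)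
Definition below d (T : orderType d) (a : T) : set T := [set x | x < a].

Definition is_cardinal d (T : orderType d) : Prop :=
  well_order (<=%O : rel T) /\ forall a : T, card_lt (below a) [set: T].

Definition is_infinite_cardinal d (T : orderType d) : Prop :=
  is_cardinal T /\ infinite_set [set: T].

(* K is the least cardinal greater than L. *)
Definition is_succ_cardinal d (L : orderType d) d' (K : orderType d') : Prop :=
  [/\ is_cardinal K, card_lt [set: L] [set: K] &
      forall a : K, below a #<= [set: L]].

(* The sequences of elements of L whose length is an ordinal below L; their
   number is the cardinal L to the power < L. *)
Definition short_seq d (L : orderType d) : Type :=
  {a : L & {x : L | x < a} -> L}.

Definition cofinal_in d (K : orderType d) (a : K) (C : set K) : Prop :=
  C `<=` below a /\ forall x, x < a -> exists2 c, C c & x <= c.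

(* cf(a) = L, the cofinality being the least cardinality of a cofinal subset. *)
Definition has_cofinality d (K : orderType d) d' (L : orderType d') (a : K) :
    Prop :=
  (exists2 C : set K, cofinal_in a C & C #= [set: L]) /\
  (forall C : set K, cofinal_in a C -> [set: L] #<= C).

Definition club d (K : orderType d) (C : set K) : Prop :=
  (forall x, exists2 c, C c & x < c) /\
  (forall a, below a !=set0 ->
     (forall x, x < a -> exists2 c, C c & x < c < a) -> C a).

Definition stationary d (K : orderType d) (S : set K) : Prop :=
  forall C : set K, club C -> S `&` C !=set0.

Definition diamond d (K : orderType d) (S : set K) : Prop :=
  exists A : K -> set K,
    (forall a, S a -> A a `<=` below a) /\
    forall X : set K, stationary [set a | S a /\ X `&` below a = A a].

(** * Saturation *)

Definition satisfies (N : structure) (A : set N)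
    (p : form (option {x : N | A x})) (b : N) : Prop :=
  holds p (extend (fun a : {x : N | A x} => sval a) b).

(* Sets of formulas in one variable over fewer than L parameters which are
   finitely satisfiable in N are realized in N. *)
Definition saturated d (L : orderType d) (N : structure) : Prop :=
  forall A : set N, card_lt A [set: L] ->
  forall p : set (form (option {x : N | A x})),
    (forall q, q `<=` p -> finite_set q ->
       exists b : N, forall f, q f -> satisfies f b) ->
    exists b : N, forall f, p f -> satisfies f b.

(* Main.v *)
(* Call a cut (A, B) good if for every set d of fewer than lambda elements some
   interval [u, v] with u in A and v in B contains no element definable from d. N is
   the union of an elementary chain of models of cardinality lambda indexed by
   lambda^+, whose steps are ultrapowers restricted to definable functions. Each step
   may add one good cut to a list, and all later steps keep the listed cuts good, so
   that these are filled nowhere in N. The steps realize the types guessed by the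
   diamond, which makes N saturated; the realizations are chosen new, so that the
   interval [0, a) has lambda^+ elements for every nonstandard a.

   If an order automorphism f of N maps b to a and a^n <= b for all n, the diamond
   guesses f restricted to a closed stage c of cofinality lambda. Step c then adds an
   element x inside [0, b), approximated by coded sets that no a^n bounds in size.
   Since f maps [0, b) onto [0, a), the pigeonhole principle makes every relevant
   definable function constant, or at least a, on a smaller such set, and the size of
   [0, a) leaves room to shrink to an interval whose image under f avoids any given
   earlier stage. Hence the image under f of the cut filled by x is good; it is put on
   the list and is never filled, contradicting that f is an automorphism. If a and b
   are not E4-equivalent, this applies to an automorphism or to its inverse. *)

From Stdlib Require List.
From Stdlib Require Import Ring.
From mathcomp Require Import all_boot all_order.
From mathcomp Require Import boolp classical_sets functions cardinality wochoice filter.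
Require Import Defs.

Set Implicit Arguments.
Unset Strict Implicit.
Unset Printing Implicit Defensive.

Local Open Scope classical_set_scope.
Local Open Scope card_scope.

(** * Choice, lists and well-orders *)

Lemma choice_on (X Y : Type) (y0 : Y) (D : set X) (R : X -> Y -> Prop) :
  (forall x, D x -> exists y, R x y) -> exists f, forall x, D x -> R x (f x).
Proof.
move=> ex; have /choice [f fP] x : exists y, D x -> R x y.
  by have [/ex [y]|nDx] := pselect (D x); [exists y|exists y0].
by exists f.
Qed.

Definition elems (T : Type) (l : seq T) : set T := fun x => List.In x l.

Lemma elemsP (T : eqType) (l : seq T) x : elems l x <-> x \in l.
Proof.
elim: l => //= y l IH; rewrite in_cons -(rwP orP) -(rwP eqP) -IH.
by split=> -[->|xl]; [left|right|left|right].
Qed.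

Lemma elems_cons (T : Type) (x : T) l : elems (x :: l) = x |` elems l.
Proof.
by apply/seteqP; split=> y [->|yl]; [left|right|left|right].
Qed.

Lemma elems_cat (T : Type) (s t : seq T) : elems (s ++ t) = elems s `|` elems t.
Proof. by apply/seteqP; split=> x /(List.in_app_iff s t x). Qed.

Lemma elems_map (T U : Type) (f : T -> U) l : elems (map f l) = f @` elems l.
Proof.
apply/seteqP; split=> [y /List.in_map_iff [x [<- xl]]|_ [x xl <-]].
  by exists x.
exact: List.in_map.
Qed.

Lemma finite_elems (T : Type) (l : seq T) : finite_set (elems l).
Proof.
elim: l => [|x l IH]; last by rewrite elems_cons finite_setU.
by rewrite (_ : elems _ = set0) //; apply/seteqP; split.
Qed.

Lemma finite_set_elems (T : Type) (A : set T) : finite_set A ->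
  exists l : seq T, A `<=` elems l.
Proof.
move=> /(@finite_seqP {classic T}) [l ->]; exists l => x.
by move=> /(@elemsP {classic T}).
Qed.

Lemma elems_image (T U : Type) (f : T -> U) (D : set T) (l : seq U) :
  elems l `<=` f @` D -> exists2 l', elems l' `<=` D & l = map f l'.
Proof.
elim: l => [|y l IH] lD; first by exists [::].
have [|l' l'D ->] := IH; first by move=> z zl; apply: lD; right.
have [x Dx <-] := lD y (or_introl erefl).
by exists (x :: l') => // z [<-|/l'D].
Qed.

Lemma elems_setU (T : Type) (A B : set T) (l : seq T) : elems l `<=` A `|` B ->
  exists s t, [/\ elems s `<=` A, elems t `<=` B & elems l = elems s `|` elems t].
Proof.
elim: l => [|x l IH] lAB.
  by exists [::], [::]; split=> //; apply/seteqP; split=> // y [].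
have [|s [t [sA tB lst]]] := IH; first by move=> y yl; apply: lAB; right.
case: (lAB x (or_introl erefl)) => [Ax|Bx].
  exists (x :: s), t; split=> // [y [<-|/sA]//|].
  by rewrite !elems_cons lst setUA.
exists s, (x :: t); split=> // [y [<-|/tB]//|].
by rewrite !elems_cons lst setUCA.
Qed.

Lemma elems_bounded (T : Type) (f : T -> nat) (l : seq T) :
  exists n, forall x, elems l x -> (f x <= n)%N.
Proof.
elim: l => [|x l [n nP]]; first by exists 0.
exists (maxn (f x) n) => y [<-|/nP fyn]; first exact: leq_maxl.
by rewrite leq_max fyn orbT.
Qed.

Lemma ex_unhit_index (T : Type) (hit : T -> nat -> Prop) (hs : seq T) :
  (forall h j k, hit h j -> hit h k -> j = k) ->
  exists2 p, (p <= size hs)%N & forall h, elems hs h -> ~ hit h p.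
Proof.
move=> hit_inj; apply: contrapT => all_hit.
have /choice [f fP] h : exists j, forall p, hit h p -> j = p.
  have [[j hj]|nh] := pselect (exists j, hit h j); last by exists 0 => p hp; case: nh; exists p.
  by exists j => p; exact: hit_inj.
have : {subset iota 0 (size hs).+1 <= map f hs}.
  move=> p; rewrite mem_iota ltnS => /= ps; apply/elemsP; rewrite elems_map.
  apply: contrapT => np; apply: all_hit; exists p => // h hhs /fP hp.
  by apply: np; exists h.
move=> /(uniq_leq_size (iota_uniq _ _)).
by rewrite size_iota size_map ltnn.
Qed.

Section Directed.
Import Order.TTheory.
Local Open Scope order_scope.
Variables (d : Order.disp_t) (I : orderType d).

Lemma elems_directed (T : Type) (J : set I) (R : I -> set T) : J !=set0 ->
  (forall i j, J i -> J j -> i <= j -> R i `<=` R j) ->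
  forall l, elems l `<=` \bigcup_(i in J) R i -> exists2 i, J i & elems l `<=` R i.
Proof.
move=> [i0 Ji0] mono; elim=> [|x l IH] lR; first by exists i0.
have [|i Ji li] := IH; first by move=> y yl; apply: lR; right.
have [j Jj xj] := lR x (or_introl erefl).
have [ij|ji] := leP i j.
  by exists j => // y [<-//|/li]; exact: mono.
by exists i => // y [<-|/li//]; apply: mono xj => //; exact: ltW.
Qed.

End Directed.

Section WellOrder.
Import Order.TTheory.
Local Open Scope order_scope.
Variables (d : Order.disp_t) (T : orderType d).
Hypothesis wo : well_order (<=%O : rel T).

Lemma wo_least (P : set T) x : P x -> exists2 m, P m & forall y, P y -> m <= y.
Proof.
move=> Px.
have [|m [[Pm mle] _]] := wo (A := [pred y | `[< P y >]]).
  by exists x; apply/asboolP.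
exists m => [|y Py]; first exact/asboolP.
by apply: mle; apply/asboolP.
Qed.

Lemma wo_wf : well_founded (fun x y : T => x < y).
Proof.
move=> x; apply: contrapT => nx.
have [m nm mle] := wo_least (P := fun y => ~ Acc (fun x y : T => x < y) y) nx.
apply: nm; constructor=> y ym; apply: contrapT => /mle.
by rewrite leNgt ym.
Qed.

Lemma wo_dependent_choice (S : Type) (s0 : S) (R : T -> (T -> S) -> S -> Prop) :
  (forall a h h' s, (forall b, b < a -> h b = h' b) -> R a h s -> R a h' s) ->
  (forall a h, (forall b, b < a -> R b h (h b)) -> exists s, R a h s) ->
  exists h, forall a, R a h (h a).
Proof.
move=> ext ex.
pose extend0 (a : T) (rec : forall b, b < a -> S) (b : T) : S :=
  if pselect (b < a) is left ba then rec b ba else s0.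
pose F a rec : {classic S} := xget (s0 : {classic S}) (R a (extend0 a rec)).
pose h := Fix wo_wf (fun=> S) F.
pose restrict a b := if pselect (b < a) is left _ then h b else s0.
have hE a : h a = xget (s0 : {classic S}) (R a (restrict a)).
  apply: (Fix_eq wo_wf (fun=> S) F) => x f g fg.
  suff -> : f = g by []; apply: functional_extensionality_dep => b.
  exact: funext.
exists h; apply: (well_founded_ind wo_wf) => a IH.
have restrictE b : b < a -> restrict a b = h b.
  by rewrite /restrict; case: pselect.
have : exists s, R a (restrict a) s.
  apply: ex => b ba; rewrite restrictE //; apply: ext (IH b ba) => c cb.
  by rewrite restrictE // (lt_trans cb).
by move=> /(xgetPex (s0 : {classic S})); rewrite -hE; apply: ext.
Qed.

End WellOrder.

(** * Cardinal arithmetic *)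

Definition injective_on (T U : Type) (A : set T) (f : T -> U) :=
  forall x y, A x -> A y -> f x = f y -> x = y.

Lemma card_le_funP (T U : Type) (u0 : U) (A : set T) (B : set U) :
  A #<= B <-> exists2 f : T -> U, set_fun A B f & injective_on A f.
Proof.
split=> [/card_leP [f]|[f fAB fI]].
  have /injfunPex [g gAB gI] : $|{injfun A >-> B}| by squash (valLR u0 f).
  by exists g => // x y Ax Ay; apply: gI; exact/mem_set.
have /injfunPex [g] : exists2 f : T -> U, set_fun A B f & set_inj A f.
  by exists f => // x y /set_mem Ax /set_mem Ay; exact: fI.
exact: inj_card_le.
Qed.

Lemma image_omits (T U : Type) (A : set U) (f : U -> T) :
  ~ ([set: T] #<= A) -> exists t, ~ (f @` A) t.
Proof.
move=> nle; apply: contrapT => /forallNP all; apply: nle.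
apply: card_le_trans (card_image_le f A); apply: subset_card_le => t _.
exact: contrapT.
Qed.

Lemma card_setU1_infinite (T : Type) (A : set T) (x : T) :
  infinite_set A -> x |` A #<= A.
Proof.
have [Ax _|nAx] := pselect (A x); first by apply: subset_card_le => y [->|].
move=> /infiniteP /(card_le_funP x) [n nA nI].
pose m k := if k is j.+1 then n j else x.
have mI j k : m j = m k -> j = k.
  case: j k => [|j] [|k] //= => [xn|nx|/nI -> //].
    by case: nAx; rewrite xn; exact: nA.
  by case: nAx; rewrite -nx; exact: nA.
have /choice [f fP] y : exists z,
    (exists2 k, y = m k & z = m k.+1) \/ ((forall k, y <> m k) /\ z = y).
  have [[k ->]|nm] := pselect (exists k, y = m k).
    by exists (m k.+1); left; exists k.
  by exists y; right; split=> // k ymk; apply: nm; exists k.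
apply/(card_le_funP x); exists f => [y Uy|y z _ _].
  case: (fP y) => [[k _ ->]|[ny ->]]; first exact: nA.
  by case: Uy => // yx; case: (ny 0).
case: (fP y) (fP z) => [[j -> ->]|[ny ->]] [[k -> ->]|[nz ->]] //.
- by move=> /mI [->].
- by move=> /esym /nz.
- by move=> /ny.
Qed.

Section CardinalSubset.
Import Order.TTheory.
Local Open Scope order_scope.
Variables (d : Order.disp_t) (T : orderType d).
Hypothesis cardT : is_cardinal T.

(* The Mostowski collapse of V is all of T or a proper initial segment. *)
Lemma cardinal_subset_dichotomy (V : set T) :
  [set: T] #<= V \/ exists a : T, V #<= below a.
Proof.
have [wo lt_below] := cardT.
have [|nV] := pselect ([set: T] #<= V); [by left|right].
have [t0 _] : exists t0 : T, True.
  apply: contrapT => nT; apply: nV; rewrite (_ : [set: T] = set0) ?card_ge0 //.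
  by apply/seteqP; split=> // t; case: nT; exists t.
pose before x : set T := fun y => V y /\ y < x.
have [r rP] : exists r : T -> T, forall x, ~ (r @` before x) (r x) /\
    forall z, z < r x -> (r @` before x) z.
  apply: (wo_dependent_choice wo t0 (R := fun x r s => ~ (r @` before x) s /\
    forall z, z < s -> (r @` before x) z)).
    move=> a h h' s hh'; have -> // : h @` before a = h' @` before a.
    by apply/seteqP; split=> _ [y [Vy ya] <-]; exists y; rewrite ?hh'.
  move=> a h _; have [|t tP] := @image_omits T T (before a) h.
    move=> /card_le_trans le; apply: (lt_below a).2; apply: le.
    by apply: subset_card_le => y [].
  have [s sP sle] := wo_least wo (P := ~` (h @` before a)) tP.
  by exists s; split=> // z zs; apply: contrapT => /sle; rewrite leNgt zs.
have rI : injective_on V r.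
  move=> x y Vx Vy rxy; apply/eqP/negP => /negP; rewrite neq_lt => /orP [xy|yx].
    by apply: (rP y).1; exists x.
  by apply: (rP x).1; exists y.
have [a aP] : exists a, ~ (r @` V) a by exact: image_omits.
exists a; apply/(card_le_funP t0); exists r => // x Vx.
rewrite /below /= ltNge le_eqVlt; apply/negP => /orP [/eqP ax|].
  by apply: aP; exists x.
by move=> /(rP x).2 [y [Vy _] rya]; apply: aP; exists y.
Qed.

End CardinalSubset.

Section InfiniteCardinal.
Import Order.TTheory.
Local Open Scope order_scope.
Variables (dL : Order.disp_t) (L : orderType dL).

Definition small (T : Type) (A : set T) : Prop := ~ ([set: L] #<= A).

Lemma small_sub (T : Type) (A B : set T) : A `<=` B -> small B -> small A.
Proof. by move=> AB sB LA; apply: sB; apply: card_le_trans LA (subset_card_le AB). Qed.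

Lemma small_image (T U : Type) (f : T -> U) (A : set T) : small A -> small (f @` A).
Proof. by move=> sA LA; apply: sA; apply: card_le_trans LA (card_image_le f A). Qed.

Lemma small_preimage (T U : Type) (f : T -> U) (B : set U) : injective f ->
  small B -> small (f @^-1` B).
Proof.
move=> fI sB LA; apply: sB; apply: card_le_trans LA _.
rewrite -(card_le_eql (inj_card_eq (in2W fI))); apply: subset_card_le.
exact: image_preimage_subset.
Qed.

Lemma card_lt_small (T : Type) (A : set T) : card_lt A [set: L] -> small A.
Proof. by case. Qed.

Hypothesis hL : is_infinite_cardinal L.

Lemma nat_injL : exists n : nat -> L, injective n.
Proof.
have [_ inf] := hL; have [l _] := infinite_setN0 inf.
by move: inf => /infiniteP /(card_le_funP l) [n _ nI]; exists n => j k; exact: nI.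
Qed.

Lemma card_leLP (T : Type) (A : set T) :
  A #<= [set: L] <-> exists f : T -> L, injective_on A f.
Proof.
have [n _] := nat_injL.
by rewrite (card_le_funP (n 0)); split=> [[f]|[f]]; exists f.
Qed.

Lemma card_geLP (T : Type) (A : set T) :
  [set: L] #<= A <-> exists2 f : L -> T, (forall l, A (f l)) & injective f.
Proof.
have [n _] := nat_injL; split=> [LA|[f fA fI]].
  have [/set0P [x Ax]|/negP/negPn/eqP A0] := pselect (A != set0).
    have /(card_le_funP x) [f fA fI] := LA.
    by exists f => [l|l l']; [exact: fA|exact: fI].
  have /card_le0P LT0 : [set: L] #<= @set0 T by rewrite -A0.
  by have : [set: L] (n 0) by []; rewrite LT0.
by apply/(card_le_funP (f (n 0))); exists f => // l l' _ _; exact: fI.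
Qed.

Lemma small_finite (T : Type) (A : set T) : finite_set A -> small A.
Proof. by move=> fA LA; apply: hL.2; exact: card_le_finite LA fA. Qed.

Lemma small_set0 (T : Type) : small (@set0 T).
Proof. exact/small_finite/finite_set0. Qed.

Lemma small_set1 (T : Type) (x : T) : small [set x].
Proof. exact/small_finite/finite_set1. Qed.

Lemma small_below (i : L) : small (below i).
Proof. by apply: card_lt_small; have [[_]] := hL. Qed.

Lemma infinite_cardinal_gt (i : L) : exists j, i < j.
Proof.
apply: contrapT => /forallNP max_i.
have LE : [set: L] = i |` below i.
  apply/seteqP; split=> // j _; have : j <= i by rewrite leNgt; exact/negP.
  by rewrite le_eqVlt => /orP [/eqP ->|ji]; [left|right].
have [[_ lt_below] inf] := hL; apply: (lt_below i).2.
rewrite LE; apply: card_setU1_infinite => fin; apply: inf.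
by rewrite LE finite_setU.
Qed.

Hypothesis hpow : [set: short_seq L] #= [set: L].

Definition seq_value (l0 : L) (t : short_seq L) (j : L) : L :=
  let: existT a f := t in
  if pselect (j < a) is left ja then f (exist _ j ja) else l0.

Lemma short_seq_injL : exists f : short_seq L -> L, injective f.
Proof.
have /card_eqPle [/card_leLP [f fI] _] := hpow.
by exists f => s t; exact: fI.
Qed.

(* Regularity of L: an unbounded small set would allow diagonalizing against an
   enumeration of the short sequences in order type L. *)
Lemma small_bounded (V : set L) : small V -> exists b, forall x, V x -> x < b.
Proof.
move=> sV; have [n _] := nat_injL; set l0 := n 0.
have [//|[a /(card_le_funP l0) [r ra rI]]] := cardinal_subset_dichotomy hL.1 V.
apply: contrapT => /forallNP unb.
have unbounded i : exists2 x, V x & i < x.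
  have [j ij] := infinite_cardinal_gt i.
  have /existsNP [x /not_implyP [Vx /negP xj]] := unb j.
  by exists x => //; apply: lt_le_trans ij _; rewrite leNgt.
have [code codeI] := short_seq_injL.
pose t0 : short_seq L := existT _ l0 (fun=> l0).
have /(choice_on t0) [e eP] l : range code l -> exists t, code t = l.
  by move=> [t _ <-]; exists t.
have eK t : e (code t) = t by apply: codeI; apply: eP; exists t.
have /(choice_on l0) [v vP] j : (r @` V) j -> exists x, V x /\ r x = j.
  by move=> [x Vx <-]; exists x.
have vK x : V x -> v (r x) = x.
  by move=> Vx; have [|Vv rv] := vP (r x); [exists x|apply: rI].
have /choice [s sP] j : exists t, ~ ((fun i => seq_value l0 (e i) j) @` below (v j)) t.
  exact/image_omits/small_below.
pose t : short_seq L := existT _ a (fun x => s (sval x)).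
have [x Vx ltx] := unbounded (code t).
apply: (sP (r x)); exists (code t); first by rewrite /below /= vK.
by rewrite eK /=; case: pselect => // nra; case: nra; exact: ra.
Qed.

Lemma small_bigcup (X T : Type) (J : set X) (U : X -> set T) :
  small J -> (forall j, J j -> small (U j)) -> small (\bigcup_(j in J) U j).
Proof.
move=> sJ sU /card_geLP [g gU gI]; have [n _] := nat_injL.
have /(choice_on (n 0)) [b bP] j : J j -> exists b, forall l, U j (g l) -> l < b.
  by move=> /sU /(small_preimage gI) /small_bounded.
have [c cP] := small_bounded (small_image (f := b) sJ).
have [j Jj Uj] := gU c; have : b j < c by apply: cP; exists j.
by rewrite ltNge ltW // bP.
Qed.

Lemma small_setU (T : Type) (A B : set T) : small A -> small B -> small (A `|` B).
Proof.
move=> sA sB; rewrite -bigcup2inE; apply: small_bigcup => [|[|[|]] //=].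
exact/small_finite/finite_II.
Qed.

Lemma small_lists (T : Type) (A : set T) (k : nat) : small A ->
  small [set l : seq T | size l = k /\ elems l `<=` A].
Proof.
move=> sA; elim: k => [|k IH].
  by apply: (@small_sub _ _ [set [::]]) => [[|x l] []|] //; exact: small_set1.
apply: (@small_sub _ _ (\bigcup_(x in A) (cons x @` [set l | size l = k /\ elems l `<=` A]))).
  move=> [|x l] [//= [lk] lA]; exists x; first by apply: lA; left.
  by exists l => //; split=> // y yl; apply: lA; right.
by apply: small_bigcup => // x _; exact: small_image.
Qed.

(* Finite subsets of a finite set A have the single upper bound A, so that
   this also holds when L is countable. *)
Lemma small_finite_cofinal (T : Type) (A : set T) : small A ->
  exists S : set (set T), [/\ small S,
    (forall s, S s -> finite_set s) &
    forall l, elems l `<=` A -> exists2 s, S s & elems l `<=` s].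
Proof.
move=> sA; have [fA|/infiniteP natA] := pselect (finite_set A).
  exists [set A]; split=> [|s ->//|l lA]; first exact: small_set1.
  by exists A.
exists (@elems T @` \bigcup_k [set l : seq T | size l = k /\ elems l `<=` A]); split.
- apply: small_image; apply: small_bigcup => [Lnat|k _]; last exact: small_lists.
  exact: sA (card_le_trans Lnat natA).
- by move=> _ [l _ <-]; exact: finite_elems.
- by move=> l lA; exists (elems l) => //; exists l => //; exists (size l).
Qed.

Lemma pairingL : exists p : L -> L -> L, forall x y x' y',
  p x y = p x' y' -> x = x' /\ y = y'.
Proof.
have [n _] := nat_injL; set c0 := n 0.
have [c1 c01] := infinite_cardinal_gt c0; have [c2 c12] := infinite_cardinal_gt c1.
have [f fI] := short_seq_injL.
pose t x y : short_seq L := existT _ c2 (fun j => if sval j == c0 then x else y).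
exists (fun x y => f (t x y)) => x y x' y' /fI txy.
have := congr1 (seq_value c0 ^~ c0) txy; have := congr1 (seq_value c0 ^~ c1) txy.
rewrite /=; case: pselect => [_|[]//]; case: pselect => [_|[]]; last exact: lt_trans c12.
by rewrite /= eqxx (gt_eqF c01).
Qed.

Lemma card_leL_nat : [set: nat] #<= [set: L].
Proof. by have [n nI] := nat_injL; apply/card_leLP; exists n => j k _ _; exact: nI. Qed.

Lemma card_leL_finite (T : Type) (A : set T) : finite_set A -> A #<= [set: L].
Proof. by move=> /finite_set_countable /card_le_trans; apply; exact: card_leL_nat. Qed.

Lemma card_leL_setX (T U : Type) (A : set T) (B : set U) :
  A #<= [set: L] -> B #<= [set: L] -> A `*` B #<= [set: L].
Proof.
move=> /card_leLP [f fI] /card_leLP [g gI]; have [p pI] := pairingL.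
apply/card_leLP; exists (fun x => p (f x.1) (g x.2)) => -[x y] [x' y'] /= [Ax By] [Ax' By'].
by move=> /pI [/fI -> // /gI ->].
Qed.

Lemma card_leL_bigcup (X T : Type) (J : set X) (U : X -> set T) :
  J #<= [set: L] -> (forall j, J j -> U j #<= [set: L]) ->
  \bigcup_(j in J) U j #<= [set: L].
Proof.
move=> leJ leU; have [n _] := nat_injL.
have /(choice_on (fun=> n 0)) [g gI] j : J j -> exists g : T -> L, injective_on (U j) g.
  by move=> /leU /card_leLP.
pose D : set (X * T) := fun jx => J jx.1 /\ U jx.1 jx.2.
have : D #<= [set: L].
  have /card_leLP [f fI] := leJ; have [p pI] := pairingL.
  apply/card_leLP; exists (fun jx => p (f jx.1) (g jx.1 jx.2)) => -[j x] [k y] /= [Jj Ux] [Jk Uy].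
  by move=> /pI [/fI jk]; move: Ux; rewrite jk // => Ux /gI ->.
apply: card_le_trans; apply: card_le_trans (card_image_le snd D).
by apply: subset_card_le => x [j Jj Ux]; exists (j, x).
Qed.

Lemma card_leL_setU (T : Type) (A B : set T) :
  A #<= [set: L] -> B #<= [set: L] -> A `|` B #<= [set: L].
Proof.
move=> leA leB; rewrite -bigcup2E; apply: card_leL_bigcup => [|[|[|i]] _] //=.
exact: card_leL_nat.
Qed.

Lemma card_leL_sum (V W : Type) : [set: V] #<= [set: L] -> [set: W] #<= [set: L] ->
  [set: V + W] #<= [set: L].
Proof.
move=> leV leW.
apply: (@card_le_trans _ _ _ (inl @` [set: V] `|` inr @` [set: W])).
  by apply: subset_card_le => -[v|w] _; [left; exists v|right; exists w].
by apply: card_leL_setU; apply: card_le_trans (card_image_le _ _) _.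
Qed.

(* A small subset of S is coded by the sequence of its elements listed along the
   dichotomy's injection into an initial segment, tagged to mark the gaps. *)
Lemma card_leL_small_subsets (T : Type) (S : set T) : S #<= [set: L] ->
  [set A : set T | small A /\ A `<=` S] #<= [set: L].
Proof.
move=> /card_leLP [i iI]; have [p pI] := pairingL; have [f fI] := short_seq_injL.
have [n nI] := nat_injL; have n01 : n 0 <> n 1 by move=> /nI.
pose decode t : set T := fun x => exists j, seq_value (p (n 0) (n 0)) t j = p (n 1) (i x).
pose t0 : short_seq L := existT _ (n 0) (fun=> n 0).
have /(choice_on t0) [t tP] A : small A /\ A `<=` S ->
    exists t, forall x, S x -> A x <-> decode t x.
  move=> [sA AS].
  have [/(small_image (f := i) sA) //|[a /(card_le_funP (n 0)) [r ra rI]]] :=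
    cardinal_subset_dichotomy hL.1 (i @` A).
  exists (existT _ a (fun j => if pselect (exists2 x, A x & r (i x) = sval j) is left e
    then p (n 1) (i (sval (cid2 e))) else p (n 0) (n 0))).
  move=> x Sx; rewrite /decode /=; split=> [Ax|[j]].
    exists (r (i x)); case: pselect => [ax|[]]; last by apply: ra; exists x.
    case: pselect => [e|[]]; last by exists x.
    by case: cid2 => y /= Ay ryx; congr p; apply: rI ryx; [exists y|exists x].
  case: pselect => [ja|_ /pI [] //]; case: pselect => [e|_ /pI [] //].
  by case: cid2 => y /= Ay _ /pI [_ /iI <- //]; exact: AS.
apply/card_leLP; exists (f \o t) => A B sA sB /= /fI tAB; apply/seteqP; split=> x.
  by move=> Ax; have Sx := sA.2 _ Ax; apply/(tP B sB) => //; rewrite -tAB; apply/(tP A sA).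
by move=> Bx; have Sx := sB.2 _ Bx; apply/(tP A sA) => //; rewrite tAB; apply/(tP B sB).
Qed.

Lemma card_leL_enum (T : Type) (S : set T) : S !=set0 -> S #<= [set: L] ->
  exists2 E : L -> T, (forall i, S (E i)) & S `<=` range E.
Proof.
move=> [x0 Sx0] /card_leLP [f fI].
have /choice [E EP] i : exists x, S x /\ forall y, S y -> f y = i -> x = y.
  have [[y Sy fy]|ny] := pselect (exists2 y, S y & f y = i).
    by exists y; split=> // z Sz fz; apply: fI => //; rewrite fy.
  by exists x0; split=> // y Sy fy; case: ny; exists y.
exists E => [i|x Sx]; first by have [] := EP i.
by exists (f x) => //; apply: (EP (f x)).2.
Qed.

Lemma descending_sequence (C : Type) (c0 : C) (ok : C -> Prop) (le : C -> C -> Prop)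
    (meets : L -> C -> Prop) :
  (forall i (h : L -> C), (forall j, j < i -> ok (h j) /\ forall k, k < j -> le (h j) (h k)) ->
     exists s, [/\ ok s, (forall j, j < i -> le s (h j)) & meets i s]) ->
  exists h : L -> C, forall i,
    [/\ ok (h i), (forall j, j < i -> le (h i) (h j)) & meets i (h i)].
Proof.
move=> ext; have [[wo _] _] := hL.
apply: (wo_dependent_choice wo c0 (R := fun i h s =>
  [/\ ok s, (forall j, j < i -> le s (h j)) & meets i s])).
  by move=> i h h' s hh' [s1 s2 s3]; split=> // j ji; rewrite -hh' //; exact: s2.
move=> i h IH; apply: ext => j ji.
by have [s1 s2 _] := IH j ji; split.
Qed.

End InfiniteCardinal.

Section SuccessorCardinal.
Import Order.TTheory.
Local Open Scope order_scope.
Variables (dL : Order.disp_t) (L : orderType dL).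
Variables (dK : Order.disp_t) (K : orderType dK).
Hypothesis hL : is_infinite_cardinal L.
Hypothesis hpow : [set: short_seq L] #= [set: L].
Hypothesis hK : is_succ_cardinal L K.

Lemma below_card_leL (a : K) : below a #<= [set: L].
Proof. by have [_ _] := hK; apply. Qed.

Lemma succ_not_leL : ~ ([set: K] #<= [set: L]).
Proof. by have [_ []] := hK. Qed.

Lemma succ_inhabited : exists k : K, True.
Proof.
apply: contrapT => nK; apply: succ_not_leL.
rewrite (_ : [set: K] = set0) ?card_ge0 //.
by apply/seteqP; split=> // k; case: nK; exists k.
Qed.

Lemma injLK : exists f : L -> K, injective f.
Proof.
have [_ [LK _] _] := hK; have [k _] := succ_inhabited.
by move/(card_le_funP k): LK => [f _ fI]; exists f => x y; exact: fI.
Qed.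

Lemma succ_bounded (X : Type) (S : set X) (w : X -> K) : S #<= [set: L] ->
  exists c, forall x, S x -> w x < c.
Proof.
move=> leS; apply: contrapT => /forallNP unb; apply: succ_not_leL.
apply: (@card_le_trans _ _ _ (\bigcup_(x in S) (below (w x) `|` [set w x]))).
  apply: subset_card_le => y _.
  have /existsNP [x /not_implyP [Sx /negP]] := unb y.
  by rewrite -leNgt le_eqVlt => /orP [/eqP ->|yx]; exists x => //; [right|left].
apply: card_leL_bigcup => // x _; apply: card_leL_setU => //.
  exact: below_card_leL.
exact/card_leL_finite/finite_set1.
Qed.

Lemma succ_gt (b : K) : exists a, b < a.
Proof.
have [c cP] := succ_bounded id (card_leL_finite hL (finite_set1 b)).
by exists c; exact: cP.
Qed.

Lemma card_leL_or_ge_succ (U : set K) : U #<= [set: L] \/ [set: K] #<= U.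
Proof.
have [cardK _ _] := hK.
have [KU|[a Ua]] := cardinal_subset_dichotomy cardK U; [by right|left].
exact: card_le_trans Ua (below_card_leL a).
Qed.

Lemma small_succ_card_leL (U : set K) : small L U -> U #<= [set: L].
Proof.
have [//|KU sU] := card_leL_or_ge_succ U.
by have [_ [LK _] _] := hK; case: sU; exact: card_le_trans LK KU.
Qed.

Lemma inj_avoiding (U : set K) : U #<= [set: L] ->
  exists2 g : L -> K, injective g & forall l, ~ U (g l).
Proof.
move=> leU; have [leC|KC] := card_leL_or_ge_succ (~` U).
  by case: succ_not_leL; rewrite -(setvU U); exact: card_leL_setU.
have [_ [LK _] _] := hK.
have /(card_geLP hL) [g gU gI] := card_le_trans LK KC.
by exists g.
Qed.

Lemma pairing_succ : exists p : K -> K -> K, forall x y x' y',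
  p x y = p x' y' -> x = x' /\ y = y'.
Proof.
have [[wo _] _ _] := hK; have [i iI] := injLK; have [p pI] := pairingL hL hpow.
have [G GP] : exists G : K -> L -> K, forall a,
    injective (G a) /\ forall b l l', b < a -> G a l <> G b l'.
  apply: (wo_dependent_choice wo i (R := fun a (h : K -> L -> K) g =>
    injective g /\ forall b l l', b < a -> g l <> h b l')).
    by move=> a h h' s hh' [sI sd]; split=> // b l l' ba; rewrite -hh' //; exact: sd.
  move=> a h _; have [|g gI gU] := @inj_avoiding (\bigcup_(b in below a) range (h b)).
    apply: (card_leL_bigcup hL hpow (below_card_leL a)) => b _.
    exact: card_image_le.
  by exists g; split=> // b l l' ba e; apply: (gU l); exists b => //; exists l'.
have GI a b l l' : G a l = G b l' -> a = b /\ l = l'.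
  move=> e; have [ab|ba|ab] := ltgtP a b.
  - by case: ((GP b).2 a l' l ab).
  - by case: ((GP a).2 b l l' ba).
  - by split=> //; apply: (GP a).1; rewrite e ab.
have /choice [m mP] (xy : K * K) : exists m, xy.1 < m /\ xy.2 < m.
  have [c cP] := succ_bounded id (card_leL_finite hL (finite_set2 xy.1 xy.2)).
  by exists c; split; apply: cP; [left|right].
have /choice [k kI] a : exists k : K -> L, injective_on (below a) k.
  exact/(card_leLP hL)/below_card_leL.
exists (fun x y => G (m (x, y)) (p (k (m (x, y)) x) (k (m (x, y)) y))).
move=> x y x' y' /GI [em /pI]; rewrite -em => -[ex ey].
have [xm ym] := mP (x, y); have := mP (x', y'); rewrite -em => -[x'm y'm].
by split; apply: (kI (m (x, y))).
Qed.

Lemma club_closed (B : K -> K) : club [set a | forall b, b < a -> B b < a].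
Proof.
have [[wo _] _ _] := hK; split=> [x|a _ lim b ba]; last first.
  have [c cB /andP [bc ca]] := lim b ba.
  exact: lt_trans (cB b bc) ca.
have /choice [s sP] (a : K) : exists c, a < c /\ forall b, b <= a -> B b < c.
  have lea : below a `|` [set a] #<= [set: L].
    apply: card_leL_setU => //; first exact: below_card_leL.
    exact/card_leL_finite/finite_set1.
  have [c cP] := succ_bounded (fun b => Order.max a (B b)) lea.
  have {}cP b : b <= a -> a < c /\ B b < c.
    move=> ba; have : (below a `|` [set a]) b.
      by move: ba; rewrite le_eqVlt => /orP [/eqP->|]; [right|left].
    by move=> /cP; rewrite gt_max => /andP.
  by exists c; split=> [|b /cP []//]; have [] := cP a (lexx a).
have [c cP] := succ_bounded (fun k => iter k s x) (card_leL_nat hL).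
have [m mP mle] := wo_least wo (P := fun c => forall k, iter k s x < c)
  (fun k => cP k I).
exists m; last exact: (mP 0).
move=> b bm; have [k bk] : exists k, b <= iter k s x.
  apply: contrapT => /forallNP nk; have : m <= b.
    by apply: mle => k; rewrite ltNge; exact/negP.
  by rewrite leNgt bm.
by apply: lt_trans (mP k.+1); apply: (sP (iter k s x)).2.
Qed.

Lemma cofinality_below (a : K) : has_cofinality L a -> exists b, b < a.
Proof.
move=> [[C [Ca _] CL] _]; have [n _] := nat_injL hL.
have /card_eqPle [_ /(card_geLP hL) [f fC _]] := CL.
by exists (f (n 0)); exact/Ca/fC.
Qed.

Lemma cofinality_limit (a b : K) : has_cofinality L a -> b < a ->
  exists2 c, b < c & c < a.
Proof.
move=> [_ cof] ba; apply: contrapT => max_b.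
suff : [set: L] #<= [set b] by exact: small_set1.
apply: cof; split=> [_ ->//|x xa]; exists b => //.
by rewrite leNgt; apply/negP => bx; apply: max_b; exists x.
Qed.

Lemma small_below_bounded (c : K) (U : set K) : has_cofinality L c -> small L U ->
  U `<=` below c -> exists2 b, b < c & forall x, U x -> x <= b.
Proof.
move=> [_ cof] sU Uc; apply: contrapT => unb; apply: sU; apply: cof; split=> // b bc.
apply: contrapT => nx; apply: unb; exists b => // x Ux.
by rewrite leNgt; apply/negP => bx; apply: nx; exists x => //; exact: ltW.
Qed.

Lemma succ_closure (X Y : Type) (S : K -> set X) (R : K -> X -> Y -> Prop)
    (rank : Y -> K) : (forall c, S c #<= [set: L]) ->
  (forall c x, S c x -> exists y, R c x y) ->
  exists B : K -> K, forall c x, S c x -> exists2 y, rank y < B c & R c x y.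
Proof.
move=> leS ex.
have /choice [B BP] c : exists b, forall x, S c x -> exists2 y, rank y < b & R c x y.
  have [k _] := succ_inhabited.
  have /(choice_on k) [r rP] x : S c x -> exists r, exists2 y, rank y = r & R c x y.
    by move=> /ex [y Ry]; exists (rank y); exists y.
  have [b bP] := succ_bounded r (leS c).
  by exists b => x Sx; have [y yr Ry] := rP x Sx; exists y => //; rewrite yr; exact: bP.
by exists B.
Qed.

Lemma name_classes (X Y : Type) (D : set X) (E : X -> X -> Prop) (cst : Y -> X)
    (e : Y -> K) : D #<= [set: L] -> range e #<= [set: L] -> injective e ->
  (forall x, E x x) -> (forall x y, E x y -> E y x) ->
  (forall x y z, E x y -> E y z -> E x z) ->
  (forall y y', E (cst y) (cst y') -> y = y') ->
  exists2 name : X -> K, (forall y, name (cst y) = e y) &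
    forall x x', D x -> D x' -> (name x = name x' <-> E x x').
Proof.
move=> leD lee eI Erefl Esym Etrans cstI.
have [g gI ge] := inj_avoiding lee.
have /(card_leLP hL) [k kI] : E @` D #<= [set: L] := card_le_trans (card_image_le E D) leD.
have classE x x' : E x x' -> E x = E x'.
  move=> xx'; apply/seteqP; split=> z; last exact: Etrans xx'.
  exact: Etrans (Esym _ _ xx').
have /choice [name nameP] x : exists c, (forall y, E x (cst y) -> c = e y) /\
    ((forall y, ~ E x (cst y)) -> c = g (k (E x))).
  have [[y xy]|/forallNP nc] := pselect (exists y, E x (cst y)).
    exists (e y); split=> [y' xy'|/(_ y)//].
    by congr e; apply: cstI; apply: Etrans (Esym _ _ xy) xy'.
  by exists (g (k (E x))); split=> // y /nc.
exists name => [y|x x' Dx Dx']; first exact: (nameP _).1.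
have [namex newx] := nameP x; have [namex' newx'] := nameP x'.
split=> [|xx']; last first.
  have [[y xy]|/forallNP nc] := pselect (exists y, E x (cst y)).
    by rewrite (namex y) // (namex' y) // -(classE _ _ xx').
  by rewrite newx // newx' -(classE _ _ xx').
have [[y xy]|/forallNP nc] := pselect (exists y, E x (cst y));
  have [[y' xy']|/forallNP nc'] := pselect (exists y, E x' (cst y)).
- rewrite (namex y) // (namex' y') // => /eI yy'; rewrite -yy' in xy'.
  exact: Etrans (Esym _ _ xy').
- by rewrite (namex y) // newx' // => ey; case: (ge (k (E x'))); exists y.
- by rewrite (namex' y') // newx // => /esym ey; case: (ge (k (E x))); exists y'.
- rewrite newx // newx' // => /gI /kI xx'.
  by rewrite xx'; [exact: Erefl|exists x|exists x'].
Qed.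

End SuccessorCardinal.

Section FormulaCode.
Variables (X : Type) (pair : X -> X -> X) (tag : nat -> X).
Hypothesis pairI : forall x y x' y', pair x y = pair x' y' -> x = x' /\ y = y'.
Hypothesis tagI : injective tag.

Fixpoint term_code (V : Type) (c : V -> X) (t : term V) : X :=
  match t with
  | Var v => pair (tag 0) (c v)
  | Zero => pair (tag 1) (tag 0)
  | One => pair (tag 2) (tag 0)
  | Add t1 t2 => pair (tag 3) (pair (term_code c t1) (term_code c t2))
  | Mul t1 t2 => pair (tag 4) (pair (term_code c t1) (term_code c t2))
  end.

Definition option_code (V : Type) (c : V -> X) (v : option V) : X :=
  if v is Some w then pair (tag 1) (c w) else pair (tag 0) (tag 0).

Fixpoint form_code (V : Type) (p : form V) : (V -> X) -> X :=
  match p with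
  | Equal t1 t2 => fun c => pair (tag 0) (pair (term_code c t1) (term_code c t2))
  | Less t1 t2 => fun c => pair (tag 1) (pair (term_code c t1) (term_code c t2))
  | Bot => fun c => pair (tag 2) (tag 0)
  | Imp p1 p2 => fun c => pair (tag 3) (pair (form_code p1 c) (form_code p2 c))
  | All p1 => fun c => pair (tag 4) (form_code p1 (option_code c))
  end.

Lemma term_code_inj (V : Type) (c : V -> X) : injective c -> injective (term_code c).
Proof.
move=> cI; elim=> [v|||t1 IH1 t2 IH2|t1 IH1 t2 IH2] [w|||u1 u2|u1 u2] //= /pairI [/tagI //= _].
- by move=> /cI ->.
- by move=> /pairI [/IH1 -> /IH2 ->].
- by move=> /pairI [/IH1 -> /IH2 ->].
Qed.

Lemma option_code_inj (V : Type) (c : V -> X) : injective c -> injective (option_code c).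
Proof. by move=> cI [v|] [w|] //= /pairI [/tagI //= _ /cI ->]. Qed.

Lemma form_code_inj (V : Type) (c : V -> X) : injective c ->
  injective (fun p => form_code p c).
Proof.
move=> cI p; elim: p c cI => {V} [V t1 t2|V t1 t2|V|V p1 IH1 p2 IH2|V p1 IH1] c cI
  [u1 u2|u1 u2||q1 q2|q1] //= /pairI [/tagI //= _].
- by move=> /pairI [/(term_code_inj cI) -> /(term_code_inj cI) ->].
- by move=> /pairI [/(term_code_inj cI) -> /(term_code_inj cI) ->].
- by move=> /pairI [/(IH1 _ cI) -> /(IH2 _ cI) ->].
- by move=> /(IH1 _ (option_code_inj cI)) ->.
Qed.

End FormulaCode.

Lemma card_leL_form (dL : Order.disp_t) (L : orderType dL) (V : Type) :
  is_infinite_cardinal L -> [set: short_seq L] #= [set: L] ->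
  [set: V] #<= [set: L] -> [set: form V] #<= [set: L].
Proof.
move=> hL hpow /(card_leLP hL) [f fI].
have [p pI] := pairingL hL hpow; have [n nI] := nat_injL hL.
apply/(card_leLP hL); exists (fun q => form_code p n q f) => x y _ _.
by apply: (form_code_inj pI nI) => u v; exact: fI.
Qed.

(** * Definable relations *)

Lemma teval_tsubst (M : structure) (V W : Type) (s : V -> term W) (v : W -> M) t :
  teval v (tsubst s t) = teval (fun x => teval v (s x)) t.
Proof. by elim: t => //= t1 -> t2 ->. Qed.

Lemma holds_fsubst (M : structure) (V W : Type) (p : form V) (s : V -> term W)
    (v : W -> M) : holds (fsubst p s) v <-> holds p (fun x => teval v (s x)).
Proof.
elim: p W s v => {V} [V t1 t2|V t1 t2|V|V p1 IH1 p2 IH2|V p1 IH1] W s v /=.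
- by rewrite !teval_tsubst.
- by rewrite !teval_tsubst.
- by [].
- by rewrite IH1 IH2.
- have upE a : (fun x => teval (extend v a) (up_subst s x)) =
             extend (fun x => teval v (s x)) a.
    by apply: funext => -[x|//] /=; rewrite teval_tsubst.
  by split=> h a; have := h a; rewrite IH1 upE.
Qed.

Lemma eq_holds (M : structure) (V : Type) (p : form V) (v w : V -> M) :
  v =1 w -> holds p v <-> holds p w.
Proof. by move=> /funext ->. Qed.

Definition frename (V W : Type) (s : V -> W) (p : form V) : form W :=
  fsubst p (fun x => Var (s x)).

Lemma holds_frename (M : structure) (V W : Type) (s : V -> W) (p : form V) (v : W -> M) :
  holds (frename s p) v <-> holds p (v \o s).
Proof. exact: holds_fsubst. Qed.

Fixpoint term_vars (V : Type) (t : term V) : seq V :=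
  match t with
  | Var v => [:: v]
  | Zero | One => [::]
  | Add t1 t2 | Mul t1 t2 => term_vars t1 ++ term_vars t2
  end.

Fixpoint form_vars (V : Type) (p : form V) : seq V :=
  match p with
  | Equal t1 t2 | Less t1 t2 => term_vars t1 ++ term_vars t2
  | Bot => [::]
  | Imp p1 p2 => form_vars p1 ++ form_vars p2
  | All p1 => pmap id (form_vars p1)
  end.

Lemma elems_pmap (T U : Type) (f : T -> option U) (y : U) l :
  elems (pmap f l) y <-> exists2 x, elems l x & f x = Some y.
Proof.
elim: l => [|x l IH] /=; first by split=> [|[]].
case fx: (f x) => [z|] /=; rewrite ?elems_cons; split.
- by move=> [<-|/IH [t tl ft]]; [exists x; [left|]|exists t; [right|]].
- by move=> [t [<-|tl]]; [rewrite fx => -[->]; left|right; apply/IH; exists t].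
- by move=> /IH [t tl ft]; exists t; [right|].
- by move=> [t [<-|tl] ft]; [rewrite fx in ft|apply/IH; exists t].
Qed.

Lemma eq_teval_vars (M : structure) (V : Type) (t : term V) (v w : V -> M) :
  (forall x, elems (term_vars t) x -> v x = w x) -> teval v t = teval w t.
Proof.
elim: t => [x|||t1 IH1 t2 IH2|t1 IH1 t2 IH2] //= vw; first by apply: vw; left.
all: by rewrite IH1 ?IH2 // => x xt; apply: vw; rewrite elems_cat; [right|left].
Qed.

Lemma eq_holds_vars (M : structure) (V : Type) (p : form V) (v w : V -> M) :
  (forall x, elems (form_vars p) x -> v x = w x) -> holds p v <-> holds p w.
Proof.
elim: p v w => {V} [V t1 t2|V t1 t2|V|V p1 IH1 p2 IH2|V p1 IH1] v w //= vw.
- by rewrite !(@eq_teval_vars _ _ _ v w) // => x xs; apply: vw; rewrite elems_cat; [right|left].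
- by rewrite !(@eq_teval_vars _ _ _ v w) // => x xs; apply: vw; rewrite elems_cat; [right|left].
- by rewrite (IH1 v w) ?(IH2 v w) // => x xs; apply: vw; rewrite elems_cat; [right|left].
- have IH a : holds p1 (extend v a) <-> holds p1 (extend w a).
    by apply: IH1 => -[x|//] xp /=; apply: vw; apply/elems_pmap; exists (Some x).
  by split=> h a; apply/IH.
Qed.

Definition scons (T : Type) (a : T) (r : nat -> T) (n : nat) : T :=
  if n is k.+1 then r k else a.

Definition shift (T : Type) (r : nat -> T) : nat -> T := fun n => r n.+1.

Definition sum_assign (T V : Type) (r : nat -> T) (c : V -> T) (x : nat + V) : T :=
  match x with inl n => r n | inr v => c v end.

Section Definable.
Variables (I V : Type) (M : I -> structure) (c : forall i, V -> M i).
Implicit Types (P Q : forall i, (nat -> M i) -> Prop) (g h k : forall i, (nat -> M i) -> M i).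

(* P i is a relation in finitely many of the variables r 0, r 1, ...; a single
   formula with the parameters c i defines P i in M i for all i at once. *)
Definition definable P :=
  exists p : form (nat + V), forall i r, P i r <-> holds p (sum_assign r (c i)).

Definition definable_fun g := definable (fun i r => r 0 = g i (shift r)).

Lemma def_ext P Q : (forall i r, P i r <-> Q i r) -> definable P -> definable Q.
Proof. by move=> PQ [p pP]; exists p => i r; rewrite -PQ. Qed.

Lemma def_bot : definable (fun _ _ => False). Proof. by exists Bot. Qed.

Lemma def_imp P Q : definable P -> definable Q -> definable (fun i r => P i r -> Q i r).
Proof. by move=> [p pP] [q qP]; exists (Imp p q) => i r /=; rewrite pP qP. Qed.

Lemma def_not P : definable P -> definable (fun i r => ~ P i r).
Proof. by move=> dP; apply: def_imp => //; exact: def_bot. Qed.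

Lemma def_and P Q : definable P -> definable Q -> definable (fun i r => P i r /\ Q i r).
Proof.
move=> dP dQ; apply: (@def_ext (fun i r => ~ (P i r -> ~ Q i r))).
  by move=> i r; split=> [/not_implyP [? /contrapT]|[Pr Qr] PnQ]; [|apply: PnQ].
by apply: def_not; apply: def_imp => //; exact: def_not.
Qed.

Lemma def_or P Q : definable P -> definable Q -> definable (fun i r => P i r \/ Q i r).
Proof.
move=> dP dQ; apply: (@def_ext (fun i r => ~ P i r -> Q i r)).
  by move=> i r; split=> [nPQ|[]//]; have [|/nPQ] := pselect (P i r); [left|right].
by apply: def_imp => //; exact: def_not.
Qed.

Lemma def_iff P Q : definable P -> definable Q -> definable (fun i r => P i r <-> Q i r).
Proof. by move=> dP dQ; apply: def_and; apply: def_imp. Qed.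

Lemma def_true : definable (fun _ _ => True).
Proof. by apply: def_ext (def_imp def_bot def_bot). Qed.

Lemma def_rename (s : nat -> nat) P : definable P -> definable (fun i r => P i (r \o s)).
Proof.
move=> [p pP].
exists (frename (fun x => match x with inl n => inl (s n) | inr a => inr a end) p) => i r.
by rewrite pP holds_frename; apply: eq_holds; case.
Qed.

Lemma def_all (P : forall i, M i -> (nat -> M i) -> Prop) :
  definable (fun i r => P i (r 0) (shift r)) -> definable (fun i r => forall a, P i a r).
Proof.
move=> [p pP].
exists (All (frename (fun x => match x with inl 0 => None | inl n.+1 => Some (inl n)
  | inr a => Some (inr a) end) p)) => i r /=.
set s := (X in frename X).
have sP a : P i a r <-> holds (frename s p) (extend (sum_assign r (c i)) a).
  rewrite holds_frename -[P i a r]/(P i (scons a r 0) (shift (scons a r))) pP.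
  by apply: eq_holds => -[[|n]|].
by split=> h a; apply/sP.
Qed.

Lemma def_ex (P : forall i, M i -> (nat -> M i) -> Prop) :
  definable (fun i r => P i (r 0) (shift r)) -> definable (fun i r => exists a, P i a r).
Proof.
move=> dP; apply: (@def_ext (fun i r => ~ forall a, ~ P i a r)).
  by move=> i r; split=> [/existsNP [a /contrapT]|[a Pa] nP]; [exists a|apply: (nP a)].
by apply: def_not; apply: def_all; exact: def_not.
Qed.

Lemma dfun_var n : definable_fun (fun _ r => r n).
Proof. by exists (Equal (Var (inl 0)) (Var (inl n.+1))). Qed.

Lemma dfun_param v : definable_fun (fun i _ => c i v).
Proof. by exists (Equal (Var (inl 0)) (Var (inr v))). Qed.

Lemma dfun_zero : definable_fun (fun _ _ => zero).
Proof. by exists (Equal (Var (inl 0)) Zero). Qed.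

Lemma dfun_one : definable_fun (fun _ _ => one).
Proof. by exists (Equal (Var (inl 0)) One). Qed.

Lemma dfun_rename (s : nat -> nat) g :
  definable_fun g -> definable_fun (fun i r => g i (r \o s)).
Proof. exact: (@def_rename (scons 0 (succn \o s))). Qed.

Lemma def_app1 (P : forall i, M i -> (nat -> M i) -> Prop) g :
  definable (fun i r => P i (r 0) (shift r)) -> definable_fun g ->
  definable (fun i r => P i (g i r) r).
Proof.
move=> dP dg; apply: (@def_ext (fun i r => exists a, a = g i r /\ P i a r)).
  by move=> i r; split=> [[_ [->]]|Pg] //; exists (g i r).
by apply: def_ex; apply: def_and.
Qed.

Lemma def_comp2 (R : forall i, M i -> M i -> Prop) g h :
  definable (fun i r => R i (r 0) (r 1)) -> definable_fun g -> definable_fun h ->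
  definable (fun i r => R i (g i r) (h i r)).
Proof.
move=> dR dg dh; apply: (@def_app1 (fun i a r => R i a (h i r))) => //.
apply: (@def_app1 (fun i b r => R i (r 0) b) (fun i r => h i (shift r))).
  exact: (@def_rename (fun n => if n is 0 then 1 else 0) _ dR).
exact: (@dfun_rename succn).
Qed.

Lemma def_comp3 (R : forall i, M i -> M i -> M i -> Prop) g h k :
  definable (fun i r => R i (r 0) (r 1) (r 2)) ->
  definable_fun g -> definable_fun h -> definable_fun k ->
  definable (fun i r => R i (g i r) (h i r) (k i r)).
Proof.
move=> dR dg dh dk; apply: (@def_app1 (fun i a r => R i a (h i r) (k i r))) => //.
apply: (@def_app1 (fun i b r => R i (r 0) b (k i (shift r))) (fun i r => h i (shift r))).
  apply: (@def_app1 (fun i e r => R i (r 1) (r 0) e) (fun i r => k i (shift (shift r)))).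
    exact: (@def_rename (fun n => 2 - n) _ dR).
  exact: (@dfun_rename (fun n => n.+2)).
exact: (@dfun_rename succn).
Qed.

Lemma def_eq g h : definable_fun g -> definable_fun h -> definable (fun i r => g i r = h i r).
Proof. by apply: (@def_comp2 (fun i => eq)); exists (Equal (Var (inl 0)) (Var (inl 1))). Qed.

Lemma def_less g h : definable_fun g -> definable_fun h ->
  definable (fun i r => less (g i r) (h i r)).
Proof.
by apply: (@def_comp2 (fun i => @less (M i))); exists (Less (Var (inl 0)) (Var (inl 1))).
Qed.

Lemma dfun_comp2 (F : forall i, M i -> M i -> M i) g h :
  definable (fun i r => r 0 = F i (r 1) (r 2)) -> definable_fun g -> definable_fun h ->
  definable_fun (fun i r => F i (g i r) (h i r)).
Proof.
move=> dF dg dh; apply: (@def_comp3 (fun i a b e => a = F i b e) (fun i r => r 0)) => //.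
- exact: dfun_var.
- exact: (@dfun_rename succn).
- exact: (@dfun_rename succn).
Qed.

Lemma dfun_add g h : definable_fun g -> definable_fun h ->
  definable_fun (fun i r => add (g i r) (h i r)).
Proof.
apply: (@dfun_comp2 (fun i => @add (M i))).
by exists (Equal (Var (inl 0)) (Add (Var (inl 1)) (Var (inl 2)))).
Qed.

Lemma dfun_mul g h : definable_fun g -> definable_fun h ->
  definable_fun (fun i r => mul (g i r) (h i r)).
Proof.
apply: (@dfun_comp2 (fun i => @mul (M i))).
by exists (Equal (Var (inl 0)) (Mul (Var (inl 1)) (Var (inl 2)))).
Qed.

Lemma dfun_pow g n : definable_fun g -> definable_fun (fun i r => power (g i r) n).
Proof. by move=> dg; elim: n => [|n IH]; [exact: dfun_one|exact: dfun_mul]. Qed.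

Lemma dfun_teval (W : Type) (t : term W) (v : forall i, (nat -> M i) -> W -> M i) :
  (forall x, definable_fun (fun i r => v i r x)) -> definable_fun (fun i r => teval (v i r) t).
Proof.
move=> dv; elim: t => [x|||t1 IH1 t2 IH2|t1 IH1 t2 IH2] /=.
- exact: dv.
- exact: dfun_zero.
- exact: dfun_one.
- exact: dfun_add.
- exact: dfun_mul.
Qed.

Lemma def_holds (W : Type) (p : form W) (v : forall i, (nat -> M i) -> W -> M i) :
  (forall x, definable_fun (fun i r => v i r x)) -> definable (fun i r => holds p (v i r)).
Proof.
elim: p v => {W} [W t1 t2|W t1 t2|W|W p1 IH1 p2 IH2|W p1 IH1] v dv /=.
- by apply: def_eq; exact: dfun_teval.
- by apply: def_less; exact: dfun_teval.
- exact: def_bot.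
- by apply: def_imp; auto.
- apply: def_all; apply: (IH1 (fun i r => extend (v i (shift r)) (r 0))) => -[x|].
    exact: (@dfun_rename succn _ (dv x)).
  exact: dfun_var.
Qed.

Lemma def_subst P (s : nat -> forall i, (nat -> M i) -> M i) : definable P ->
  (forall n, definable_fun (s n)) -> definable (fun i r => P i (fun n => s n i r)).
Proof.
move=> [p pP] ds; apply: def_ext (fun i r => iff_sym (pP i _)) _.
apply: (@def_holds _ _ (fun i r => sum_assign (fun n => s n i r) (c i))) => -[n|v]; first exact: ds.
exact: (dfun_param v).
Qed.

Lemma def_comp1 (R : forall i, M i -> Prop) g :
  definable (fun i r => R i (r 0)) -> definable_fun g -> definable (fun i r => R i (g i r)).
Proof. by move=> dR dg; apply: (def_subst dR (s := fun=> g)). Qed.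

Lemma dfun_comp (F : forall i, M i -> M i) g : definable_fun (fun i r => F i (r 0)) ->
  definable_fun g -> definable_fun (fun i r => F i (g i r)).
Proof.
move=> dF dg; apply: (def_subst dF (s := scons (fun i r => r 0) (fun=> fun i r => g i (shift r)))).
by case=> [|n]; [exact: dfun_var|exact: (@dfun_rename succn)].
Qed.

End Definable.

Lemma def_params (I V W : Type) (M : I -> structure) (c : forall i, V -> M i)
    (e : forall i, W -> M i) (s : V -> W) (P : forall i, (nat -> M i) -> Prop) :
  (forall i v, e i (s v) = c i v) -> definable c P -> definable e P.
Proof.
move=> es [p pP].
exists (frename (fun x => match x with inl n => inl n | inr v => inr (s v) end) p) => i r.
by rewrite pP holds_frename; apply: eq_holds => -[n|v] //=.
Qed.

Section DefinableIn.
Variable M : structure.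
Implicit Types (d e : set M) (P : (nat -> M) -> Prop) (g : (nat -> M) -> M).

Definition def_over d P : Prop :=
  definable (M := fun _ : unit => M) (fun _ => @sval M d) (fun _ => P).

Definition dfun_over d g : Prop :=
  definable_fun (M := fun _ : unit => M) (fun _ => @sval M d) (fun _ => g).

Lemma def_over_sub d e P : d `<=` e -> def_over d P -> def_over e P.
Proof.
by move=> de; apply: (def_params (s := fun x => exist _ (sval x) (de _ (proj2_sig x)))).
Qed.

Lemma dfun_over_sub d e g : d `<=` e -> dfun_over d g -> dfun_over e g.
Proof. exact: def_over_sub. Qed.

Lemma dfun_cst d x : d x -> dfun_over d (fun=> x).
Proof. by move=> dx; exact: (dfun_param _ (exist _ x dx)). Qed.

Lemma def_over_finite d P : def_over d P ->
  exists2 l : seq M, elems l `<=` d & def_over (elems l) P.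
Proof.
move=> [p pP].
pose l := pmap (fun x : nat + {x | d x} => if x is inr a then Some (sval a) else None)
  (form_vars p).
exists l => [x /elems_pmap [[n|[y dy]] _ //= [<-]]//|].
exists (fsubst p (fun x => match x with inl n => Var (inl n)
  | inr a => if pselect (elems l (sval a)) is left al then Var (inr (exist _ _ al))
             else Zero end)) => i r.
apply: iff_trans (pP i r) _; rewrite holds_fsubst; apply: eq_holds_vars => -[n|a] //= ap.
by case: pselect => //= -[]; apply/elems_pmap; exists (inr a).
Qed.

Definition dcl d x := dfun_over d (fun=> x).

Lemma dcl_self d x : d x -> dcl d x.
Proof. exact: dfun_cst. Qed.

Lemma dcl_sub d e x : d `<=` e -> dcl d x -> dcl e x.
Proof. exact: dfun_over_sub. Qed.

Lemma def_over_extend d (V : Type) (p : form (option V)) (v : V -> M) :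
  (forall x, dcl d (v x)) -> def_over d (fun r => holds p (extend v (r 0))).
Proof.
move=> dv; apply: (@def_holds _ _ _ _ _ _ (fun=> fun r => extend v (r 0))) => -[x|].
  exact: dv.
exact: dfun_var.
Qed.

Lemma reindex_finitely (V : Type) (s : seq V) (e : V -> M) :
  exists (k : V -> nat) (v : nat -> M), forall x, elems s x -> v (k x) = e x.
Proof.
elim: s => [|y s [k [v kv]]]; first by exists (fun=> 0), (fun=> zero).
exists (fun x => if pselect (x = y) then 0 else (k x).+1), (scons (e y) v) => x xs.
case: pselect => [xy|ne] /=; first by rewrite xy.
by apply: kv; case: xs => // /esym.
Qed.

Lemma def_over_ind (hM : model_of_PA M) d (X : M -> Prop) : def_over d (fun r => X (r 0)) ->
  X zero -> (forall x, X x -> X (add x one)) -> forall x, X x.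
Proof.
move=> [p pP] X0 XS.
have [k [v kv]] := reindex_finitely (form_vars p) (sum_assign (fun=> zero) (@sval M d)).
pose q : form (option nat) :=
  frename (fun x => match x with inl 0 => None | _ => Some (k x) end) p.
have qP a : holds q (extend v a) <-> X a.
  rewrite (pP tt (scons a (fun=> zero))) holds_frename; apply: eq_holds_vars.
  by case=> [[|n]|b] //= /kv.
clearbody q; have := hM _ (PA_induction q) v => /=; rewrite holds_fsubst => ind x.
apply/qP; apply: ind => [|y].
  by apply/(eq_holds _ (w := extend v zero)); [case|apply/qP].
rewrite holds_fsubst => /(qP _).1 /XS /(qP _).2.
by apply: (eq_holds _ _).1; case.
Qed.

End DefinableIn.

(** * Arithmetic in models of PA *)

Declare Scope pa_scope.
Delimit Scope pa_scope with pa.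

Local Notation "x + y" := (add x y) : pa_scope.
Local Notation "x * y" := (mul x y) : pa_scope.
Local Notation "x < y" := (less x y) : pa_scope.

Section ArithmeticalNotions.
Variable M : structure.
Local Open Scope pa_scope.
Implicit Types (a b c e i m u v w x y z : M).

Definition pa_le x y : Prop := x < y \/ x = y.

Definition pa_dvd x y := exists k, y = x * k.

(* When m is divisible by 1, ..., b, the moduli of distinct x < b are coprime, so
   that every definable subset of [0, b) is coded by some c. *)
Definition modulus m x := one + (x + one) * m.
Definition member m c x := pa_dvd (modulus m x) c.
Definition coded m b c : set M := fun x => x < b /\ member m c x.

Definition pa_pair i x := (i + x) * (i + x) + x.
Definition coded_graph m e i x := member m e (pa_pair i x).

(* M sees that X has at most c elements: X is covered by the range of a partial
   function on [0, c) whose graph is coded in M. *)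
Definition covered (X : set M) c := exists m e w,
  (forall i x y, i < c -> x < w -> y < w ->
     coded_graph m e i x -> coded_graph m e i y -> x = y) /\
  forall x, X x -> x < w /\ exists i, i < c /\ coded_graph m e i x.

Definition outside u v z := z < u \/ v < z.

End ArithmeticalNotions.

Local Notation "x <= y" := (pa_le x y) : pa_scope.

Ltac definability_step := lazymatch goal with
  | |- def_over _ _ => unfold def_over
  | |- dfun_over _ _ => unfold dfun_over
  | |- dcl _ _ => unfold dcl
  | |- definable _ (fun _ r => _ /\ _) => apply: def_and
  | |- definable _ (fun _ r => _ \/ _) => apply: def_or
  | |- definable _ (fun _ r => _ <-> _) => apply: def_iff
  | |- definable _ (fun _ r => ~ _) => apply: def_not
  | |- definable _ (fun _ r => exists x, _) => apply: def_ex; cbv beta delta [shift]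
  | |- definable _ (fun _ r => _ = _) => apply: def_eq
  | |- definable _ (fun _ r => less _ _) => apply: def_less
  | |- definable _ (fun _ r => pa_le _ _) => unfold pa_le
  | |- definable _ (fun _ r => pa_dvd _ _) => unfold pa_dvd
  | |- definable _ (fun _ r => member _ _ _) => unfold member, modulus
  | |- definable _ (fun _ r => coded _ _ _ _) => unfold coded
  | |- definable _ (fun _ r => coded_graph _ _ _ _) => unfold coded_graph, pa_pair
  | |- definable _ (fun _ r => outside _ _ _) => unfold outside
  | |- definable _ (fun _ r => True) => apply: def_true
  | |- definable _ (fun _ r => False) => apply: def_bot
  | |- definable_fun _ (fun _ r => r _) => apply: dfun_var
  | |- definable_fun _ (fun _ r => add _ _) => apply: dfun_add
  | |- definable_fun _ (fun _ r => mul _ _) => apply: dfun_mul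
  | |- definable_fun _ (fun _ r => power _ _) => apply: dfun_pow
  | |- definable_fun _ (fun _ r => zero) => apply: dfun_zero
  | |- definable_fun _ (fun _ r => one) => apply: dfun_one
  | |- definable_fun _ (fun _ r => ?h _) =>
      first [assumption | apply: (@dfun_comp _ _ _ _ (fun=> h)); [assumption|]]
  | |- definable_fun _ _ => first [assumption | apply: dfun_cst; solve [exact I | assumption]]
  | |- definable _ _ =>
      first [assumption | apply: def_imp | apply: def_all; cbv beta delta [shift]
      | match goal with
        | |- definable _ (fun _ r => ?X _) =>
            apply: (@def_comp1 _ _ _ _ (fun=> X)); [assumption|]
        | |- definable _ (fun _ r => ?R _ _) =>
            apply: (@def_comp2 _ _ _ _ (fun=> R)); [assumption| |]
        end]
  end.
Ltac definability := cbv beta delta [shift]; repeat definability_step.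

Section Arith.
Variable M : structure.
Hypothesis hM : model_of_PA M.
Local Open Scope pa_scope.
Implicit Types (x y z a b c k m i j w : M) (X Y : set M).

Let env x y := fun n => if n is 0 then x else y.

Lemma pa_succ_neq0 x : x + one <> zero.
Proof. exact: (hM PA_succ_neq0 (env x x)). Qed.

Lemma pa_succ_inj x y : x + one = y + one -> x = y.
Proof. exact: (hM PA_succ_inj (env x y)). Qed.

Lemma pa_addx0 x : x + zero = x.
Proof. exact: (hM PA_add0 (env x x)). Qed.

Lemma pa_addxS x y : x + (y + one) = (x + y) + one.
Proof. exact: (hM PA_addS (env x y)). Qed.

Lemma pa_mulx0 x : x * zero = zero.
Proof. exact: (hM PA_mul0 (env x x)). Qed.

Lemma pa_mulxS x y : x * (y + one) = x * y + x.
Proof. exact: (hM PA_mulS (env x y)). Qed.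

Lemma pa_ltP x y : x < y <-> exists z, x + (z + one) = y.
Proof.
have /= := hM PA_lt (env x y).
move=> h; split=> [lt|[z e]].
  apply: contrapT => ne; apply: h => h1 _; apply: (h1 lt) => z e.
  by apply: ne; exists z.
by apply: contrapT => ne; apply: h => _ h2; apply: ne; apply: h2 => h3; apply: (h3 z).
Qed.

Lemma pa_ind (X : M -> Prop) : def_over setT (fun r => X (r 0)) ->
  X zero -> (forall x, X x -> X (x + one)) -> forall x, X x.
Proof. exact: def_over_ind. Qed.

Lemma pa_add0x x : zero + x = x.
Proof.
elim/pa_ind: x => [||x IH]; [by definability|exact: pa_addx0|by rewrite pa_addxS IH].
Qed.

Lemma pa_addSx x y : (x + one) + y = (x + y) + one.
Proof.
elim/pa_ind: y => [||y IH]; [by definability|by rewrite !pa_addx0|by rewrite !pa_addxS IH].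
Qed.

Lemma pa_addC x y : x + y = y + x.
Proof.
elim/pa_ind: y => [||y IH]; [by definability|by rewrite pa_addx0 pa_add0x|].
by rewrite pa_addxS pa_addSx IH.
Qed.

Lemma pa_addA x y z : x + (y + z) = (x + y) + z.
Proof.
elim/pa_ind: z => [||z IH]; [by definability|by rewrite !pa_addx0|by rewrite !pa_addxS IH].
Qed.

Lemma pa_mul0x x : zero * x = zero.
Proof.
elim/pa_ind: x => [||x IH]; [by definability|exact: pa_mulx0|by rewrite pa_mulxS IH pa_addx0].
Qed.

Lemma pa_mulSx x y : (x + one) * y = x * y + y.
Proof.
elim/pa_ind: y => [||y IH]; [by definability|by rewrite !pa_mulx0 pa_addx0|].
rewrite !pa_mulxS IH !pa_addxS; congr add; rewrite -!pa_addA; congr add; exact: pa_addC.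
Qed.

Lemma pa_mulC x y : x * y = y * x.
Proof.
elim/pa_ind: y => [||y IH]; [by definability|by rewrite pa_mulx0 pa_mul0x|].
by rewrite pa_mulxS pa_mulSx IH.
Qed.

Lemma pa_mulDl x y z : (x + y) * z = x * z + y * z.
Proof.
elim/pa_ind: z => [||z IH]; [by definability|by rewrite !pa_mulx0 pa_addx0|].
rewrite !pa_mulxS IH -!pa_addA; congr add; rewrite !pa_addA; congr add; exact: pa_addC.
Qed.

Lemma pa_mulA x y z : x * (y * z) = (x * y) * z.
Proof.
elim/pa_ind: z => [||z IH]; [by definability|by rewrite !pa_mulx0|].
by rewrite !pa_mulxS -IH (pa_mulC x (_ + _)) pa_mulDl (pa_mulC _ x) (pa_mulC y x).
Qed.

Lemma pa_mul1x x : one * x = x.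
Proof. by rewrite -(pa_add0x one) pa_mulSx pa_mul0x pa_add0x. Qed.

Lemma pa_semi_ring : semi_ring_theory (@zero M) one (@add M) (@mul M) eq.
Proof.
constructor.
- exact: pa_add0x.
- exact: pa_addC.
- exact: pa_addA.
- exact: pa_mul1x.
- exact: pa_mul0x.
- exact: pa_mulC.
- exact: pa_mulA.
- exact: pa_mulDl.
Qed.
Add Ring pa_ring : pa_semi_ring.

Lemma pa_addIr x y z : x + z = y + z -> x = y.
Proof.
elim/pa_ind: z => [||z IH]; [by definability|by rewrite !pa_addx0|].
by rewrite !pa_addxS => /pa_succ_inj.
Qed.

Lemma pa_addx_eq0 x y : x + y = zero -> y = zero.
Proof.
elim/pa_ind: y => [||y _] //; first by definability.
by rewrite pa_addxS => /pa_succ_neq0.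
Qed.

Lemma pa_zeroVsucc x : x = zero \/ exists y, x = y + one.
Proof.
elim/pa_ind: x => [||x _]; [by definability|by left|by right; exists x].
Qed.

Lemma pa_leP x y : x <= y <-> exists z, y = x + z.
Proof.
split=> [[/pa_ltP [z <-]|->]|[z ->]]; first by exists (z + one).
  by exists zero; rewrite pa_addx0.
case: (pa_zeroVsucc z) => [->|[t ->]]; first by right; rewrite pa_addx0.
by left; apply/pa_ltP; exists t.
Qed.

Lemma pa_le_addr x y : x <= x + y. Proof. by apply/pa_leP; exists y. Qed.

Lemma pa_lexx x : x <= x. Proof. by right. Qed.

Lemma pa_ltxx x : ~ x < x.
Proof.
move=> /pa_ltP [z e]; apply: (@pa_succ_neq0 z); apply: (@pa_addIr _ _ x).
by rewrite pa_add0x pa_addC.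
Qed.

Lemma pa_le_trans x y z : x <= y -> y <= z -> x <= z.
Proof. by move=> /pa_leP [t ->] /pa_leP [u ->]; apply/pa_leP; exists (t + u); ring. Qed.

Lemma pa_lt_leS x y : x < y <-> x + one <= y.
Proof.
by split=> [/pa_ltP [z <-]|/pa_leP [z ->]]; [apply/pa_leP|apply/pa_ltP]; exists z; ring.
Qed.

Lemma pa_ltW x y : x < y -> x <= y. Proof. by left. Qed.

Lemma pa_lt_le_trans x y z : x < y -> y <= z -> x < z.
Proof. by rewrite !pa_lt_leS; exact: pa_le_trans. Qed.

Lemma pa_le_lt_trans x y z : x <= y -> y < z -> x < z.
Proof. by move=> [xy yz|->//]; apply: pa_lt_le_trans xy _; exact: pa_ltW. Qed.

Lemma pa_lt_trans x y z : x < y -> y < z -> x < z.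
Proof. by move=> xy /pa_ltW; exact: pa_lt_le_trans. Qed.

Lemma pa_ltxS x y : x < y + one <-> x <= y.
Proof.
rewrite pa_lt_leS; split=> /pa_leP [z]; last by move=> ->; apply/pa_leP; exists z; ring.
by move=> e; apply/pa_leP; exists z; apply: (@pa_addIr _ _ one); rewrite e; ring.
Qed.

Lemma pa_lt_succ x : x < x + one. Proof. by apply/pa_ltxS; exact: pa_lexx. Qed.

Lemma pa_le0x x : zero <= x. Proof. by apply/pa_leP; exists x; rewrite pa_add0x. Qed.

Lemma pa_leVlt x y : x <= y \/ y < x.
Proof.
elim/pa_ind: x => [||x [[xy|->]|yx]]; first by definability.
- by left; exact: pa_le0x.
- by left; apply/pa_lt_leS.
- by right; exact: pa_lt_succ.
- by right; apply: pa_lt_trans yx _; exact: pa_lt_succ.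
Qed.

Lemma pa_leNlt x y : x <= y <-> ~ y < x.
Proof.
split=> [xy yx|nyx]; first by apply: (@pa_ltxx x); exact: pa_le_lt_trans yx.
by case: (pa_leVlt x y).
Qed.

Lemma pa_ltNle x y : x < y <-> ~ y <= x.
Proof. by rewrite pa_leNlt; split=> [h []//|/contrapT]. Qed.

Lemma pa_lt_neq x y : x < y -> x <> y.
Proof. by move=> xy e; apply: (@pa_ltxx x); rewrite {2}e. Qed.

Lemma pa_neq_lt x y : x <> y -> x < y \/ y < x.
Proof. by move=> ne; case: (pa_leVlt x y) => [[|//]|]; auto. Qed.

Lemma pa_le_anti x y : x <= y -> y <= x -> x = y.
Proof. by move=> [xy|//] /pa_leNlt. Qed.

Lemma pa_ltx0 x : ~ x < zero. Proof. by apply/pa_leNlt; exact: pa_le0x. Qed.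

Lemma pa_le_add x y z w : x <= y -> z <= w -> x + z <= y + w.
Proof. by move=> /pa_leP [t ->] /pa_leP [u ->]; apply/pa_leP; exists (t + u); ring. Qed.

Lemma pa_lt_le_add x y z w : x < y -> z <= w -> x + z < y + w.
Proof.
rewrite !pa_lt_leS => xy zw; rewrite (_ : _ + _ + _ = (x + one) + z); last by ring.
exact: pa_le_add.
Qed.

Lemma pa_le_mul x y z w : x <= y -> z <= w -> x * z <= y * w.
Proof.
move=> /pa_leP [t ->] /pa_leP [u ->]; apply/pa_leP; exists (x * u + t * z + t * u); ring.
Qed.

Lemma pa_lt_mul x y z : zero < z -> x < y -> x * z < y * z.
Proof.
move=> /pa_ltP [t <-] /pa_ltP [u <-]; apply/pa_ltP.
by exists (x * zero + u * t + u + t); ring.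
Qed.

Lemma pa_le_addIr x y z : x + z <= y + z -> x <= y.
Proof.
move=> /pa_leP [t e]; apply/pa_leP; exists t; apply: (@pa_addIr _ _ z).
by rewrite e; ring.
Qed.

Lemma pa_least (d : set M) X x : def_over d (fun r => X (r 0)) -> X x ->
  exists2 y, X y & forall z, X z -> y <= z.
Proof.
move=> /(def_over_sub (@subsetT _ d)) dX Xx; apply: contrapT => no_least.
have below_free z : forall y, y < z -> ~ X y.
  elim/pa_ind: z => [||z IH y].
  - by definability.
  - by move=> y /pa_ltx0.
  - move=> /pa_ltxS yz Xy; apply: no_least; exists y => // t Xt.
    by apply/pa_leNlt => ty; apply: (IH t) => //; exact: pa_lt_le_trans yz.
exact: (below_free (x + one) x (pa_lt_succ x)).
Qed.

Lemma pa_lt_le_mul x y z : zero < x -> y <= z -> y <= x * z.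
Proof.
move=> /pa_lt_leS; rewrite pa_add0x => x1 yz; rewrite -(pa_mul1x y).
exact: pa_le_mul.
Qed.

Lemma pa_division a c : zero < a -> exists w, a * w <= c /\ c < a * (w + one).
Proof.
move=> a0; have [||w cw wmin] := @pa_least setT (fun w => c < a * (w + one)) c.
- by definability.
- by apply: pa_lt_le_trans (pa_lt_succ c) _; apply: pa_lt_le_mul => //; exact: pa_lexx.
exists w; split=> //; have [->|[t wt]] := pa_zeroVsucc w.
  by rewrite pa_mulx0; exact: pa_le0x.
rewrite pa_leNlt wt => /wmin; rewrite wt pa_leNlt; apply; exact: pa_lt_succ.
Qed.

Lemma pa_dvd_mulr x y z : pa_dvd x y -> pa_dvd x (y * z).
Proof. by move=> [k ->]; exists (k * z); ring. Qed.

Lemma pa_dvd_mull x y z : pa_dvd x y -> pa_dvd x (z * y).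
Proof. by move=> [k ->]; exists (k * z); ring. Qed.

Lemma pa_dvd_addIr x y z : pa_dvd x y -> pa_dvd x (y + z) -> pa_dvd x z.
Proof.
move=> [k ->] [j e]; case: (pa_leVlt k j) => [/pa_leP [t jE]|/pa_ltP [t kE]].
  by exists t; apply: (@pa_addIr _ _ (x * k)); rewrite pa_addC e jE; ring.
exists zero; rewrite pa_mulx0; apply: (@pa_addx_eq0 (x * (t + one))).
apply: (@pa_addIr _ _ (x * j)); rewrite pa_add0x -{2}e -kE; ring.
Qed.

Lemma pa_dvdxx x : pa_dvd x x.
Proof. by exists one; ring. Qed.

Definition divisible_upto m b := m <> zero /\ forall k, k <= b -> k <> zero -> pa_dvd k m.

Lemma ex_divisible_upto b : exists m, divisible_upto m b.
Proof.
elim/pa_ind: b => [||b [m [m0 mP]]].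
- by rewrite /divisible_upto; definability.
- exists one; split=> [e|k k0 nk]; first by apply: (@pa_succ_neq0 zero); rewrite pa_add0x.
  by case: nk; apply: pa_le_anti => //; exact: pa_le0x.
- exists (m * (b + one)); split=> [e|k kb k0].
    have [/m0//|[t mE]] := pa_zeroVsucc m.
    by apply: (@pa_succ_neq0 (t * b + t + b)); rewrite -e mE; ring.
  case: kb => [/pa_ltxS kb|->]; first by apply: pa_dvd_mulr; exact: mP.
  by apply: pa_dvd_mull; exact: pa_dvdxx.
Qed.

(* modulus m x is coprime to m, hence to every nonzero k <= b. *)
Lemma modulus_coprime m b k c x : divisible_upto m b -> k <= b -> k <> zero ->
  pa_dvd (modulus m x) (k * c) -> pa_dvd (modulus m x) c.
Proof.
move=> [_ mP] kb k0 dvd_kc; have [t mE] := mP k kb k0.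
have : pa_dvd (modulus m x) ((x + one) * m * c).
  rewrite (_ : _ * _ = (k * c) * ((x + one) * t)); last by rewrite mE; ring.
  exact: pa_dvd_mulr.
move=> /pa_dvd_addIr; apply; exists c; rewrite /modulus; ring.
Qed.

Lemma member_modulus_mul m b c x z : divisible_upto m b -> x < b -> z < b -> x <> z ->
  member m (c * modulus m z) x -> member m c x.
Proof.
move=> mb xb zb xz; rewrite /member => dvd_cz.
have [/pa_ltP [k zE]|/pa_ltP [k xE]] := pa_neq_lt xz.
- apply: (modulus_coprime mb (k := k + one)); last 1 first.
  + apply: (@pa_dvd_addIr _ ((x + one) * (c * modulus m z))); first exact: pa_dvd_mull.
    exists ((z + one) * c); rewrite -zE /modulus; ring.
  + apply: pa_le_trans (pa_ltW zb); rewrite -zE (pa_addC x); exact: pa_le_addr.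
  + exact: pa_succ_neq0.
- apply: (modulus_coprime mb (k := k + one)); last 1 first.
  + apply: (@pa_dvd_addIr _ (modulus m x * (z + one) * c)).
      by apply: pa_dvd_mulr; apply: pa_dvd_mulr; exact: pa_dvdxx.
    rewrite (_ : _ + _ = (x + one) * (c * modulus m z)); first exact: pa_dvd_mull.
    rewrite -xE /modulus; ring.
  + apply: pa_le_trans (pa_ltW xb); rewrite -xE (pa_addC z); exact: pa_le_addr.
  + exact: pa_succ_neq0.
Qed.

Lemma member_one m b x : divisible_upto m b -> ~ member m one x.
Proof.
move=> [m0 _] [k]; have [->|[t ->]] := pa_zeroVsucc k.
  by rewrite pa_mulx0 => e; case: (@pa_succ_neq0 zero); rewrite pa_add0x.
have [/m0 //|[s ->]] := pa_zeroVsucc m; rewrite /modulus => e.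
apply: (@pa_succ_neq0 ((x + one) * s + x + ((x + one) * s + x + one) * t + t)).
by apply: (@pa_addIr _ _ one); rewrite pa_add0x; apply: (etrans _ (esym e)); ring.
Qed.

Lemma ex_code d X m b : def_over d (fun r => X (r 0)) -> divisible_upto m b ->
  exists c, forall x, coded m b c x <-> x < b /\ X x.
Proof.
move=> /(def_over_sub (@subsetT _ d)) dX mb.
suff ex_code_below z : exists c, forall x, x < b -> (member m c x <-> x < z /\ X x).
  have [c cP] := ex_code_below b; exists c => x.
  by split=> [[xb] /(cP x xb) []//|[xb Xx]]; split=> //; apply/cP.
elim/pa_ind: z => [||z [c cP]]; first by definability.
  by exists one => x _; split=> [/(member_one mb)//|[/pa_ltx0]].
have [Xz|nXz] := pselect (X z); last first.
  by exists c => x xb; rewrite cP // pa_ltxS; split=> [[/pa_ltW]//|[[//|->]]].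
have [zb|bz] := pselect (z < b); last first.
  exists c => x xb; rewrite cP // pa_ltxS; split=> [[/pa_ltW]//|[xz Xx]]; split=> //.
  by apply: pa_lt_le_trans xb _; apply/pa_leNlt.
exists (c * modulus m z) => x xb; split.
  have [->|xz] := pselect (x = z); first by split=> //; exact: pa_lt_succ.
  move=> /(member_modulus_mul mb xb zb xz); rewrite cP // => -[xz' Xx]; split=> //.
  exact/pa_ltxS/pa_ltW.
move=> [/pa_ltxS [xz Xx|-> _]]; last by apply: pa_dvd_mull; exact: pa_dvdxx.
by apply: pa_dvd_mulr; apply/cP.
Qed.

Lemma pa_pair_lt_sum a b c e : a + b < c + e -> pa_pair a b < pa_pair c e.
Proof.
move=> ab_ce; apply: (@pa_lt_le_trans _ ((a + b + one) * (a + b + one))).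
  apply/pa_ltP; exists (a + a + b); rewrite /pa_pair; ring.
apply: pa_le_trans (pa_le_addr _ _).
by apply: pa_le_mul; apply/pa_lt_leS.
Qed.

Lemma pa_pair_inj i x j y : pa_pair i x = pa_pair j y -> i = j /\ x = y.
Proof.
move=> e; have ixjy : i + x = j + y.
  by apply: contrapT => /pa_neq_lt [] /pa_pair_lt_sum; rewrite e; exact: pa_ltxx.
move: e; rewrite /pa_pair ixjy => e.
have xy : x = y by apply: (@pa_addIr _ _ ((j + y) * (j + y))); rewrite pa_addC e pa_addC.
by split=> //; apply: (@pa_addIr _ _ x); rewrite ixjy xy.
Qed.

Lemma pa_pair_lt i x j y : i < j -> x < y -> pa_pair i x < pa_pair j y.
Proof.
move=> ij xy; rewrite /pa_pair pa_addC (pa_addC (_ * _)); apply: pa_lt_le_add => //.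
by apply: pa_le_mul; apply: pa_le_add; exact: pa_ltW.
Qed.

Lemma covered_by_definable d (F : M -> M -> Prop) X c z :
  def_over d (fun r => F (r 0) (r 1)) -> (forall x, X x -> x < z) ->
  (forall i x y, i < c -> F i x -> F i y -> x = y) ->
  (forall x, X x -> exists i, i < c /\ F i x) -> covered X c.
Proof.
move=> /(def_over_sub (@subsetT _ d)) dF Xz Ff FX.
have [m mb] := ex_divisible_upto (pa_pair c z).
have [|e eP] := @ex_code setT (fun t => exists i x,
  (i < c /\ x < z) /\ t = pa_pair i x /\ F i x) m (pa_pair c z) _ mb.
  by rewrite /pa_pair; definability.
have graphE i x : i < c -> x < z -> (coded_graph m e i x <-> F i x).
  move=> ic xz; have ix_lt := pa_pair_lt ic xz; split=> [gix|Fix_].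
    by have [_ [j [y [_ [/pa_pair_inj [-> ->]]]]]] := (eP (pa_pair i x)).1 (conj ix_lt gix).
  suff [] : coded m (pa_pair c z) e (pa_pair i x) by [].
  by apply/eP; split=> //; exists i, x.
exists m, e, z; split=> [i x y ic xz yz /graphE Fx /graphE Fy|x Xx].
  by apply: (Ff i) => //; auto.
split; first exact: Xz.
by have [i [ic Fi]] := FX x Xx; exists i; split=> //; apply/graphE => //; exact: Xz.
Qed.

Lemma def_covered (I V : Type) (N : I -> structure) (p : forall t : I, V -> N t)
    (P : forall t : I, N t -> (nat -> N t) -> Prop) (g : forall t : I, (nat -> N t) -> N t) :
  definable p (fun t r => P t (r 0) (shift r)) -> definable_fun p g ->
  definable p (fun t r => covered (P t ^~ r) (g t r)).
Proof.
move=> dP dg; have dg_shift (s : nat -> nat) : definable_fun p (fun t r => g t (fun n => r (s n))).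
  exact: (dfun_rename s dg).
rewrite /covered; do 3!apply: def_ex; cbv beta delta [shift]; apply: def_and.
  do 3!apply: def_all; cbv beta delta [shift]; apply: def_imp; last by definability.
  by apply: def_less; [definability|exact: (dg_shift (addn 6))].
apply: def_all; cbv beta delta [shift]; apply: def_imp.
  exact: (def_rename (fun n => if n is k.+1 then k.+4 else 0) dP).
apply: def_and; first by definability.
apply: def_ex; cbv beta delta [shift]; apply: def_and; last by definability.
by apply: def_less; [definability|exact: (dg_shift (addn 5))].
Qed.

Lemma covered_sub X Y c : X `<=` Y -> covered Y c -> covered X c.
Proof. by move=> XY [m [e [w [f h]]]]; exists m, e, w; split=> // x /XY; exact: h. Qed.

Lemma covered_set0 c : covered set0 c.
Proof.
by apply: (@covered_by_definable setT (fun _ _ => False) _ _ zero) => //; definability.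
Qed.

Lemma covered_set1 x : covered [set x] one.
Proof.
apply: (@covered_by_definable setT (fun i y => y = x) _ _ (x + one)).
- by definability.
- by move=> y ->; exact: pa_lt_succ.
- by move=> i y z _ -> ->.
- by move=> y ->; exists zero; split=> //; have := pa_lt_succ zero; rewrite pa_add0x.
Qed.

Lemma covered_lt z : covered (fun x => x < z) z.
Proof.
apply: (@covered_by_definable setT (fun i y => i = y) _ _ z) => //.
- by definability.
- by move=> i x y _ <-.
- by move=> x xz; exists x.
Qed.

Lemma covered_setU X Y c k : covered X c -> covered Y k -> covered (X `|` Y) (c + k).
Proof.
move=> [m [e [w [f h]]]] [m' [e' [w' [f' h']]]].
apply: (@covered_by_definable setT (fun i x => (i < c /\ x < w /\ coded_graph m e i x) \/
   exists j, i = c + j /\ j < k /\ x < w' /\ coded_graph m' e' j x) _ _ (w + w')).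
- by definability.
- move=> x [/h [xw _]|/h' [xw _]]; apply: pa_lt_le_trans xw _; first exact: pa_le_addr.
  by rewrite pa_addC; exact: pa_le_addr.
- move=> i x y ick [[ic [xw gx]]|[j [ij [jk [xw gx]]]]] [[ic' [yw gy]]|[j' [ij' [jk' [yw gy]]]]].
  + exact: (f i).
  + by exfalso; move: ic; rewrite ij'; apply/pa_leNlt; exact: pa_le_addr.
  + by exfalso; move: ic'; rewrite ij; apply/pa_leNlt; exact: pa_le_addr.
  + apply: (f' j) => //; rewrite (_ : j = j') //.
    by apply: (@pa_addIr _ _ c); rewrite pa_addC -ij ij' pa_addC.
- move=> x [/h [xw [i [ic g]]]|/h' [xw [i [ic g]]]].
    by exists i; split; [apply: pa_lt_le_trans ic _; exact: pa_le_addr|left].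
  exists (c + i); split; last by right; exists i.
  by rewrite !(pa_addC c); apply: pa_lt_le_add => //; exact: pa_lexx.
Qed.

Lemma covered_le X c k : c <= k -> covered X c -> covered X k.
Proof.
move=> /pa_leP [t ->] cX; rewrite -(setU0 X).
exact: covered_setU cX (covered_set0 t).
Qed.

(* Pigeonhole: removing c from the domain and redirecting its index turns a covering
   of [0, c + 2) by c + 1 indices into one of [0, c + 1) by c indices. *)
Lemma covered_pigeonhole c : ~ covered (fun x => x < c + one) c.
Proof.
elim/pa_ind: c => [||c IH [m [e [w [f h]]]]].
- by apply: def_not; apply: (def_covered (P := fun=> fun x r => x < r 0 + one)); definability.
- move=> [m [e [w [f h]]]]; have [|_ [i [/pa_ltx0 //]]] := h zero.
  exact: pa_lt_succ.
- apply: IH; have [cw [i0 [i0c g0]]] := h (c + one) (pa_lt_succ _).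
  apply: (@covered_by_definable setT (fun i x => x < w /\ ((i <> i0 /\ coded_graph m e i x) \/
     (i = i0 /\ coded_graph m e c x))) _ _ (c + one)) => //.
  + by definability.
  + have cc : c < c + one by exact: pa_lt_succ.
    move=> i x y ic [xw Hx] [yw Hy]; have ic' := pa_lt_trans ic cc.
    case: Hx => [[ii gx]|[ii gx]]; case: Hy => [[ii' gy]|[ii' gy]] //.
      exact: (f i).
    exact: (f c).
  + move=> x xc; have [xw [i [ic gx]]] := h x (pa_lt_trans xc (pa_lt_succ _)).
    have ii0 : i <> i0.
      move=> ii0; apply: (pa_lt_neq xc); apply: (f i) => //; by rewrite ii0.
    move/pa_ltxS: ic => [ic|ic]; first by exists i; split=> //; split=> //; left.
    exists i0; split; last by split=> //; right; rewrite -ic.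
    move/pa_ltxS: i0c => [//|i0c]; by case: ii0; rewrite ic i0c.
Qed.

Lemma covered_fibers d X (g : M -> M) a c : def_over d (fun r => X (r 0)) ->
  dfun_over d (fun r => g (r 0)) -> (forall x, X x -> g x < a) ->
  (forall k, k < a -> covered (fun x => X x /\ g x = k) c) -> covered X (a * c).
Proof.
move=> /(def_over_sub (@subsetT _ d)) dX /(dfun_over_sub (@subsetT _ d)) dg Xa cov.
have cov_below k : k <= a -> covered (fun x => X x /\ g x < k) (k * c).
  elim/pa_ind: k => [||k IH /pa_lt_leS ka].
  - apply: def_imp; first by definability.
    by apply: (def_covered (P := fun=> fun x r => X x /\ g x < r 0)); definability.
  - by move=> _; rewrite pa_mul0x; apply: covered_sub (covered_set0 _) => x [_ /pa_ltx0].
  - rewrite (_ : _ * _ = k * c + c); last by ring.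
    apply: covered_sub (covered_setU (IH (pa_ltW ka)) (cov k ka)).
    by move=> x [Xx /pa_ltxS [gk|gk]]; [left|right].
by apply: covered_sub (cov_below a (pa_lexx a)) => x Xx; split=> //; exact: Xa.
Qed.

Lemma pa_numeral_add n p : numeral M (n + p)%N = numeral M n + numeral M p.
Proof. by elim: p => [|p IH]; rewrite ?addn0 ?pa_addx0 // addnS /= IH pa_addxS. Qed.

Lemma pa_numeral_mul n p : numeral M (n * p)%N = numeral M n * numeral M p.
Proof.
elim: p => [|p IH]; first by rewrite muln0 pa_mulx0.
by rewrite mulnS pa_numeral_add IH /= pa_mulxS pa_addC.
Qed.

Lemma pa_numeral_lt n p : (n < p)%N -> numeral M n < numeral M p.
Proof.
elim: p => // p IH; rewrite ltnS leq_eqVlt => /orP [/eqP ->|/IH np].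
  exact: pa_lt_succ.
by apply: pa_lt_trans np _; exact: pa_lt_succ.
Qed.

Lemma numeral_inj : injective (numeral M).
Proof.
move=> n p e; case: (ltngtP n p) => // /pa_numeral_lt; rewrite e => /pa_ltxx //.
Qed.

Lemma pa_lt_numeral n x : x < numeral M n -> exists2 p, (p < n)%N & x = numeral M p.
Proof.
elim: n => [/pa_ltx0//|n IH] /pa_ltxS [/IH [p pn ->]|->]; last by exists n.
by exists p => //; exact: ltnW.
Qed.

Lemma numeral_lt_nonstandard a n : ~ standard a -> numeral M n < a.
Proof.
move=> na; case: (pa_leVlt a (numeral M n)) => // -[/pa_lt_numeral [p _ e]|e].
  by case: na; exists p.
by case: na; exists n.
Qed.

Lemma covered_numeral X n : covered X (numeral M n) -> exists l : seq M, X `<=` elems l.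
Proof.
move=> [m [e [w [f h]]]].
have /(choice_on (@zero M)) [g gP] p : (exists2 y, y < w & coded_graph m e (numeral M p) y) ->
    exists y, y < w /\ coded_graph m e (numeral M p) y.
  by move=> [y yw gy]; exists y.
exists (map g (iota 0 n)) => x /h [xw [i [ic gx]]].
have [p pn ip] := pa_lt_numeral ic; rewrite ip in gx.
have [|gw gg] := gP p; first by exists x.
rewrite elems_map; exists p; first by apply/elemsP; rewrite mem_iota.
by apply: (f (numeral M p)) => //; rewrite -ip.
Qed.

Lemma pa_pow_ge1 a n : one <= a -> one <= power a n.
Proof.
move=> a1; elim: n => [|n IH] /=; first exact: pa_lexx.
by rewrite -(pa_mul1x one); apply: pa_le_mul.
Qed.

Lemma pa_pow_add a n p : power a (n + p)%N = power a n * power a p.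
Proof. by elim: p => [|p IH]; rewrite ?addn0 ?addnS /= ?IH; ring. Qed.

Lemma pa_pow_le a n p : one <= a -> (n <= p)%N -> power a n <= power a p.
Proof.
move=> a1 np; rewrite -(subnKC np) pa_pow_add -{1}(pa_mul1x (power a n)) (pa_mulC one).
by apply: pa_le_mul; [exact: pa_lexx|exact: pa_pow_ge1].
Qed.

Lemma power_numeral n p : power (numeral M n) p = numeral M (n ^ p).
Proof.
elim: p => [|p IH] /=; first by rewrite pa_add0x.
by rewrite IH expnSr pa_numeral_mul.
Qed.

(* The notion of largeness of all filter conditions: no standard power of a bounds
   the internal cardinality of X. *)
Definition big a X := forall n, ~ covered X (power a n).

Lemma big_sub a X Y : X `<=` Y -> big a X -> big a Y.
Proof. by move=> XY bX n /(covered_sub XY); exact: bX. Qed.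

Lemma big_ex a X : big a X -> exists x, X x.
Proof.
move=> bX; apply: contrapT => nX; apply: (bX 0).
by apply: covered_sub (covered_set0 _) => x Xx; apply: nX; exists x.
Qed.

Lemma two_numeral : one + one = numeral M 2.
Proof. by rewrite /= pa_add0x. Qed.

Lemma big_of_infinite X : (forall l : seq M, exists2 x, X x & ~ elems l x) ->
  big (one + one) X.
Proof.
move=> inf n; rewrite two_numeral power_numeral => /covered_numeral [l Xl].
by have [x /Xl] := inf l.
Qed.

Section Base.
Variable a : M.
Hypothesis two_le_a : one + one <= a.

Lemma one_le_base : one <= a.
Proof. by apply: pa_le_trans two_le_a; exact: pa_le_addr. Qed.

Lemma double_pow_le n : power a n + power a n <= power a n.+1.
Proof.
rewrite /= (_ : _ + _ = power a n * (one + one)); last by ring.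
by apply: pa_le_mul => //; exact: pa_lexx.
Qed.

Lemma covered_bigcup_elems (W : Type) (ws : seq W) (D : W -> set M) n :
  (forall p, elems ws p -> covered (D p) (power a n)) ->
  covered (\bigcup_(p in elems ws) D p) (power a (n + size ws)).
Proof.
elim: ws => [|p ws IH] covD; first by apply: covered_sub (covered_set0 _) => x [].
have {}IH := IH (fun q qs => covD q (or_intror qs)).
apply: (@covered_le _ (power a n + power a (n + size ws))).
  rewrite addnS; apply: pa_le_trans (double_pow_le _).
  apply: pa_le_add; last exact: pa_lexx.
  by apply: pa_pow_le; [exact: one_le_base|exact: leq_addr].
apply: covered_sub (covered_setU (covD p (or_introl erefl)) IH).
by move=> x [q [<-|qs] Dx]; [left|right; exists q].
Qed.

Lemma covered_elems (ys : seq M) : covered (elems ys) (power a (size ys)).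
Proof.
apply: covered_sub (@covered_bigcup_elems _ ys set1 0 _) => [y yys|y _]; first by exists y.
exact: covered_set1.
Qed.

Lemma ex_uncovered_fiber d X (g : M -> M) n : def_over d (fun r => X (r 0)) ->
  dfun_over d (fun r => g (r 0)) -> (forall x, X x -> g x <= a) ->
  ~ covered X (power a n.+2) ->
  exists k, ~ covered (fun x => X x /\ g x = k) (power a n).
Proof.
move=> dX dg ga nc; apply: contrapT => all_covered; apply: nc.
apply: (@covered_le _ ((a + one) * power a n)).
  rewrite /= -pa_mulA (pa_mulC _ (a * a)); apply: pa_le_mul; last exact: pa_lexx.
  apply: (@pa_le_trans _ ((one + one) * a)); last by apply: pa_le_mul => //; exact: pa_lexx.
  rewrite pa_mulDl pa_mul1x; apply: pa_le_add; [exact: pa_lexx|exact: one_le_base].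
apply: (covered_fibers dX dg) => [x /ga /pa_ltxS //|k _].
by apply: contrapT => nc; apply: all_covered; exists k.
Qed.

Lemma big_lt b : (forall n, power a n <= b) -> big a (fun x => x < b).
Proof.
move=> pow_le_b n cov; apply: (@covered_pigeonhole (power a n)).
apply: covered_sub cov => x; move/pa_lt_le_trans; apply.
apply: pa_le_trans (pow_le_b n.+1); apply: pa_le_trans (double_pow_le n).
apply: pa_le_add; [exact: pa_lexx|exact/pa_pow_ge1/one_le_base].
Qed.

Lemma ex_internal_card X b : def_over setT (fun r => X (r 0)) ->
  (forall x, X x -> x < b) -> exists2 c, covered X c & forall k, covered X k -> c <= k.
Proof.
move=> dX Xb; apply: (@pa_least setT (covered X) b).
  by apply: (def_covered (P := fun=> fun x _ => X x)); definability.
exact: covered_sub (covered_lt b).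
Qed.

(* A discrete intermediate value property: one more element raises the count of
   X below z by at most one. *)
Lemma ex_initial_part X b c : def_over setT (fun r => X (r 0)) ->
  (forall x, X x -> x < b) -> (forall k, covered X k -> c <= k) ->
  exists2 z, covered (fun x => X x /\ x < z) c &
    forall k, covered (fun x => X x /\ x < z) k -> c <= k.
Proof.
move=> dX Xb cmin; pose uncovered z := forall k, k < c -> ~ covered (fun x => X x /\ x < z) k.
have uncoveredP z : uncovered z <-> forall k, covered (fun x => X x /\ x < z) k -> c <= k.
  by split=> h k => [ck|kc ck]; [apply/pa_leNlt => /h|have /pa_leNlt := h k ck].
have [||z zP zmin] := @pa_least setT uncovered b.
- apply: def_all; cbv beta delta [shift]; apply: def_imp; first by definability.
  apply: def_not; apply: (def_covered (P := fun=> fun x r => X x /\ x < r 1)).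
    by definability.
  by definability.
- by apply/uncoveredP => k ck; apply: cmin; apply: covered_sub ck => x Xx; split=> //; exact: Xb.
exists z; last exact/uncoveredP.
have [->|[t zt]] := pa_zeroVsucc z; first by apply: covered_sub (covered_set0 _) => x [_ /pa_ltx0].
have : ~ uncovered t by move=> /zmin; rewrite pa_leNlt; apply; rewrite zt; exact: pa_lt_succ.
move=> /existsNP [k /not_implyP [kc /contrapT tk]].
apply: (@covered_le _ (k + one)); first exact/pa_lt_leS.
apply: covered_sub (covered_setU tk (covered_set1 t)).
by move=> x [Xx]; rewrite zt => /pa_ltxS [xt|->]; [left|right].
Qed.

Lemma big_blocks X b : def_over setT (fun r => X (r 0)) -> (forall x, X x -> x < b) ->
  big a X -> exists U V : M -> M, (forall s t, s < t -> t < a -> V s < U t) /\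
    forall t, t < a -> big a (fun x => X x /\ U t <= x /\ x <= V t).
Proof.
move=> dX Xb bX; have a0 : zero < a.
  by apply: pa_lt_le_trans one_le_base; rewrite -[X in _ < X]pa_add0x; exact: pa_lt_succ.
have [c cX cmin] := ex_internal_card dX Xb; have [w [awc caw]] := pa_division c a0.
have pow_lt n : power a n < w.
  rewrite pa_ltNle => wn; apply: (bX n.+2); apply: covered_le cX; apply: pa_ltW.
  apply: (pa_lt_le_trans caw); rewrite (pa_mulC a); apply: pa_le_mul; last exact: pa_lexx.
  apply: pa_le_trans (double_pow_le n); apply: pa_le_add => //.
  exact/pa_pow_ge1/one_le_base.
have w0 : zero < w by apply: pa_le_lt_trans (pow_lt 0); exact: pa_le0x.
have /(choice_on (@zero M)) [U cutU] t : t <= a -> exists z,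
    covered (fun x => X x /\ x < z) (t * w) /\
    forall k, covered (fun x => X x /\ x < z) k -> t * w <= k.
  move=> ta; have [|z z1 z2] := @ex_initial_part X b (t * w) dX Xb; last by exists z.
  move=> k /cmin; apply: pa_le_trans; apply: pa_le_trans awc.
  by apply: pa_le_mul => //; exact: pa_lexx.
have Umono s t : s < t -> t <= a -> U s < U t.
  move=> st ta; apply/pa_ltNle => Uts.
  have [cs _] := cutU s (pa_le_trans (pa_ltW st) ta); have [_ tmin] := cutU t ta.
  have : t * w <= s * w.
    by apply: tmin; apply: covered_sub cs => x [Xx xt]; split=> //; exact: pa_lt_le_trans Uts.
  by rewrite pa_leNlt; apply; exact: pa_lt_mul.
have /(choice_on (@zero M)) [V VE] t : t < a -> exists v, U (t + one) = v + one.
  move=> /pa_lt_leS ta; have [U0|//] := pa_zeroVsucc (U (t + one)).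
  by have := Umono _ _ (pa_lt_succ t) ta; rewrite U0 => /pa_ltx0.
exists U, V; split=> [s t st ta|t ta n block].
  have sa := pa_lt_trans st ta; apply/pa_lt_leS; rewrite -VE //.
  have /pa_lt_leS [|->] := st; last exact: pa_lexx.
  by move=> st1; apply/pa_ltW/Umono/pa_ltW.
have ta1 : t + one <= a by apply/pa_lt_leS.
have [ct _] := cutU t (pa_ltW ta); have [_ min_t1] := cutU (t + one) ta1.
have : (t + one) * w <= t * w + power a n.
  apply: min_t1; apply: covered_sub (covered_setU ct block) => x [Xx].
  by rewrite VE // => /pa_ltxS xV; case: (pa_leVlt (U t) x) => Ux; [right|left].
rewrite pa_mulDl pa_mul1x !(pa_addC (t * w)) => /pa_le_addIr.
by rewrite pa_leNlt; apply; exact: pow_lt.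
Qed.

Definition escaping (X : set M) (hs : seq (M -> M)) u v x :=
  X x /\ forall h, elems hs h -> outside u v (h x).

Lemma def_escaping (d : set M) X (hs : seq (M -> M)) : def_over d (fun r => X (r 0)) ->
  (forall h, elems hs h -> dfun_over d (fun r => h (r 0))) ->
  def_over d (fun r => escaping X hs (r 1) (r 2) (r 0)).
Proof.
move=> dX; elim: hs => [|h hs IH] dhs; first by apply: def_ext dX => _ r; split=> [|[]].
have dh : dfun_over d (fun r => h (r 0)) by apply: dhs; left.
apply: (@def_ext _ _ _ _ (fun _ r =>
  escaping X hs (r 1) (r 2) (r 0) /\ outside (r 1) (r 2) (h (r 0)))).
  move=> _ r; split=> [[[Xr out] outh]|[Xr out]]; first by split=> // k [<-|/out].
  by split; [split=> // k khs; apply: out; right|apply: out; left].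
apply: def_and; first by apply: IH => k khs; apply: dhs; right.
by definability.
Qed.

Section IntervalAvoidance.
Variables (d : set M) (u v : M) (X : set M) (hs : seq (M -> M)) (n : nat).
Hypothesis da : d a.
Hypothesis uv_free : forall z, dcl d z -> outside u v z.
Hypothesis dX : def_over d (fun r => X (r 0)).
Hypothesis dhs : forall h, elems hs h -> dfun_over d (fun r => h (r 0)).

Lemma dcl_lt_interval s : dcl d s -> s <= v -> s < u.
Proof. by move=> /uv_free [//|vs] /pa_leNlt. Qed.

Lemma dcl_pa_least (P : M -> Prop) s : def_over d (fun r => P (r 0)) ->
  P s -> (forall z, P z -> s <= z) -> dcl d s.
Proof.
move=> dP Ps smin; apply: (@def_ext _ _ _ _ (fun _ r => P (r 0) /\ forall z, P z -> r 0 <= z)).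
  move=> _ r; split=> [[Pr rmin]|->]; last by split.
  by apply: pa_le_anti; [exact: rmin|exact: smin].
by definability.
Qed.

Hypothesis uv : u <= v.
Hypothesis cov : covered (escaping X hs u v) (power a n).

Lemma ex_next_interval s : dcl d s -> s < u ->
  exists t, [/\ dcl d t, t < u, s <= t & covered (escaping X hs s t) (power a n)].
Proof.
move=> ds su; pose P t := covered (escaping X hs s t) (power a n) /\ s <= t.
have Pv : P v.
  split; last by apply: pa_ltW; exact: pa_lt_le_trans uv.
  apply: covered_sub cov => x [Xx out]; split=> // h /out [hxs|vh]; last by right.
  left; exact: pa_lt_trans su.
have dP : def_over d (fun r => P (r 0)).
  have dX3 := def_escaping dX dhs.
  apply: def_and; last by definability.
  apply: (def_covered (P := fun=> fun x r => escaping X hs s (r 0) x)); last by definability.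
  apply: (def_comp3 (R := fun=> fun x y z => escaping X hs y z x)) => //; by definability.
have [t [ct st] tmin] := pa_least dP Pv.
have dt : dcl d t by apply: dcl_pa_least dP (conj ct st) tmin.
by exists t; split=> //; apply: dcl_lt_interval => //; exact: tmin.
Qed.

Lemma ex_disjoint_intervals : exists s t : nat -> M, [/\ forall p, s p <= t p,
  forall p q, (p < q)%N -> t p < s q &
  forall p, covered (escaping X hs (s p) (t p)) (power a n)].
Proof.
have /(choice_on (@zero M)) [next nextP] s : dcl d s /\ s < u -> exists t,
    [/\ dcl d t, t < u, s <= t & covered (escaping X hs s t) (power a n)].
  by case; exact: ex_next_interval.
pose s p := iter p (fun x => next x + one) zero.
have sP p : dcl d (s p) /\ s p < u.
  elim: p => [|p /nextP [dt tu _ _]].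
    have d0 : dcl d zero by definability.
    by split=> //; apply: dcl_lt_interval => //; exact: pa_le0x.
  have dt1 : dcl d (s p.+1) by rewrite /=; definability.
  split=> //; apply: dcl_lt_interval => //; apply: pa_le_trans uv; exact/pa_lt_leS.
exists s, (next \o s); split=> [p|p q|p]; try by have [] := nextP _ (sP p).
elim: q => // q IH; rewrite ltnS leq_eqVlt => /orP [/eqP ->|/IH tps].
  exact: pa_lt_succ.
apply: pa_lt_trans tps _; have [_ _ sq _] := nextP _ (sP q).
exact/pa_ltxS.
Qed.

Lemma covered_of_escaping : covered X (power a (n + (size hs).+1)).
Proof.
have [s [t [st disj cst]]] := ex_disjoint_intervals.
rewrite -(size_iota 0 (size hs).+1).
apply: covered_sub (covered_bigcup_elems (ws := iota 0 (size hs).+1)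
  (D := fun p => escaping X hs (s p) (t p)) _) => [x Xx|p _]; last exact: cst.
have [h p q hp hq|p phs out] := @ex_unhit_index _ (fun h p => ~ outside (s p) (t p) (h x)) hs.
  have before p' q' : (p' < q')%N -> ~ outside (s p') (t p') (h x) ->
      outside (s q') (t q') (h x).
    move=> pq hp'; left; apply: pa_le_lt_trans (disj _ _ pq); apply/pa_leNlt => th.
    by apply: hp'; right.
  by case: (ltngtP p q) => // pq; [case: hq|case: hp]; apply: before pq _.
exists p; first by apply/elemsP; rewrite mem_iota.
by split=> // h /out /contrapT.
Qed.

End IntervalAvoidance.

(* If too many x had some h x in [u, v], the same would hold for infinitely many
   disjoint intervals [s, t] with s and t definable over d, found one after the
   other below u; one point x cannot have an h x in more of them than there are
   functions h. *)
Lemma interval_avoidance (d : set M) u v X (hs : seq (M -> M)) n : d a ->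
  (forall z, dcl d z -> outside u v z) -> def_over d (fun r => X (r 0)) ->
  (forall h, elems hs h -> dfun_over d (fun r => h (r 0))) ->
  ~ covered X (power a (n + (size hs).+1)) ->
  ~ covered (escaping X hs u v) (power a n).
Proof.
move=> da uv_free dX dhs nc cov; have [uv|vu] := pa_leVlt u v.
  exact/nc/(covered_of_escaping da uv_free dX dhs uv cov).
apply: nc; apply: (@covered_le _ (power a n)).
  by apply: pa_pow_le; [exact: one_le_base|exact: leq_addr].
apply: covered_sub cov => x Xx; split=> // h _.
have [uh|hu] := pa_leVlt u (h x); last by left.
by right; exact: pa_lt_le_trans uh.
Qed.

End Base.
End Arith.

(** * Elementary chains *)

Section Prestructures.
Variable T : Type.

(* Structures on subsets of a fixed type, so that the union of an elementary chain
   is a literal union; the values outside [dom] are irrelevant. *)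
Record prestructure := Pre {
  dom : set T;
  pzero : T;
  pone : T;
  padd : T -> T -> T;
  pmul : T -> T -> T;
  pless : T -> T -> Prop
}.
Implicit Types P Q R : prestructure.

Definition wf_pre P := [/\ dom P (pzero P), dom P (pone P),
  forall x y, dom P x -> dom P y -> dom P (padd P x y) &
  forall x y, dom P x -> dom P y -> dom P (pmul P x y)].

Fixpoint peval P (V : Type) (v : V -> T) (t : term V) : T :=
  match t with
  | Var x => v x
  | Zero => pzero P
  | One => pone P
  | Add t1 t2 => padd P (peval P v t1) (peval P v t2)
  | Mul t1 t2 => pmul P (peval P v t1) (peval P v t2)
  end.

Fixpoint psat P (V : Type) (p : form V) : (V -> T) -> Prop :=
  match p with
  | Equal t1 t2 => fun v => peval P v t1 = peval P v t2
  | Less t1 t2 => fun v => pless P (peval P v t1) (peval P v t2)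
  | Bot => fun=> False
  | Imp p1 p2 => fun v => psat P p1 v -> psat P p2 v
  | All p1 => fun v => forall a, dom P a -> psat P p1 (extend v a)
  end.

Lemma peval_dom P (V : Type) (v : V -> T) t : wf_pre P -> (forall i, dom P (v i)) ->
  dom P (peval P v t).
Proof. by move=> [w0 w1 wa wm] vP; elim: t => //= t1 ? t2 ?; [exact: wa|exact: wm]. Qed.

Lemma peval_tsubst P (V W : Type) (s : V -> term W) (v : W -> T) t :
  peval P v (tsubst s t) = peval P (fun x => peval P v (s x)) t.
Proof. by elim: t => //= t1 -> t2 ->. Qed.

Lemma psat_fsubst P (V W : Type) (p : form V) (s : V -> term W) (v : W -> T) :
  psat P (fsubst p s) v <-> psat P p (fun x => peval P v (s x)).
Proof.
elim: p W s v => {V} [V t1 t2|V t1 t2|V|V p1 IH1 p2 IH2|V p1 IH1] W s v /=.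
- by rewrite !peval_tsubst.
- by rewrite !peval_tsubst.
- by [].
- by rewrite IH1 IH2.
- have upE a : (fun x => peval P (extend v a) (up_subst s x)) =
             extend (fun x => peval P v (s x)) a.
    by apply: funext => -[x|//] /=; rewrite peval_tsubst.
  by split=> h a da; have := h a da; rewrite IH1 upE.
Qed.

Definition structure_of P (w : wf_pre P) : structure :=
  let '(And4 w0 w1 wa wm) := w in
  @Structure {x : T | dom P x} (exist _ _ w0) (exist _ _ w1)
    (fun x y => exist _ _ (wa _ _ (proj2_sig x) (proj2_sig y)))
    (fun x y => exist _ _ (wm _ _ (proj2_sig x) (proj2_sig y)))
    (fun x y => pless P (sval x) (sval y)).

Definition pval P (w : wf_pre P) (x : structure_of w) : T.
Proof. by case: w x => w0 w1 wa wm x; exact: (sval x). Defined.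

Lemma pvalP P (w : wf_pre P) (x : structure_of w) : dom P (pval x).
Proof. by case: w x => w0 w1 wa wm x; exact: (proj2_sig x). Qed.

Lemma pval_inj P (w : wf_pre P) : injective (@pval P w).
Proof.
case: w => w0 w1 wa wm [x dx] [y dy] /= xy; case: _ / xy dy => dy.
by congr exist; exact: Prop_irrelevance.
Qed.

Definition pSub P (w : wf_pre P) (x : T) (dx : dom P x) : structure_of w.
Proof. by case: w => w0 w1 wa wm; exact: (exist _ x dx). Defined.

Lemma pSubK P (w : wf_pre P) (x : T) (dx : dom P x) : pval (pSub w dx) = x.
Proof. by case: w => w0 w1 wa wm. Qed.

Lemma pval_less P (w : wf_pre P) (x y : structure_of w) :
  less x y <-> pless P (pval x) (pval y).
Proof. by case: w x y. Qed.

Lemma pval_teval P (w : wf_pre P) (V : Type) (v : V -> structure_of w) t :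
  pval (teval v t) = peval P (fun i => pval (v i)) t.
Proof. by case: w v => w0 w1 wa wm v; elim: t => //= [t1 -> t2 ->|t1 -> t2 ->]. Qed.

Lemma holds_psat P (w : wf_pre P) (V : Type) (p : form V) (v : V -> structure_of w) :
  holds p v <-> psat P p (fun i => pval (v i)).
Proof.
elim: p v => {V} [V t1 t2|V t1 t2|V|V p1 IH1 p2 IH2|V p1 IH1] v /=.
- rewrite -!pval_teval; split=> [->//|]; exact: pval_inj.
- by rewrite pval_less !pval_teval.
- by [].
- by rewrite IH1 IH2.
- have extendE a : (fun i => pval (extend v a i)) = extend (fun i => pval (v i)) (pval a).
    by apply: funext => -[].
  split=> h a => [da|]; last by apply/IH1; rewrite extendE; apply: h; exact: pvalP.
  by have := h (pSub w da); rewrite IH1 extendE pSubK.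
Qed.

Definition elementary P Q := dom P `<=` dom Q /\
  forall (V : Type) (p : form V) (v : V -> T), (forall i, dom P (v i)) ->
    psat P p v <-> psat Q p v.

Lemma elementary_refl P : elementary P P. Proof. by split. Qed.

Lemma elementary_trans P Q R : elementary P Q -> elementary Q R -> elementary P R.
Proof.
move=> [PQ satPQ] [QR satQR]; split=> [x /PQ /QR //|V p v vP].
by rewrite satPQ // satQR // => i; apply: PQ.
Qed.

Lemma elementary_teval P Q (V : Type) (v : V -> T) t : wf_pre P -> elementary P Q ->
  (forall i, dom P (v i)) -> peval P v t = peval Q v t.
Proof.
move=> wP [_ satPQ] vP; pose q := Equal (Var None) (tsubst (fun i => Var (Some i)) t).
have [|+ _] := satPQ _ q (extend v (peval P v t)).
  by case=> [i|] /=; [exact: vP|exact: peval_dom].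
by rewrite /= !peval_tsubst; apply.
Qed.

Lemma elementary_less P Q x y : elementary P Q -> dom P x -> dom P y ->
  pless P x y <-> pless Q x y.
Proof.
move=> [_ satPQ] dx dy.
by apply: (satPQ _ (Less (Var true) (Var false)) (fun b => if b then x else y)); case.
Qed.

Section Union.
Variables (P0 : prestructure) (fam : set prestructure).
Hypothesis fam0 : fam P0.
Hypothesis wf_fam : forall P, fam P -> wf_pre P.
Hypothesis chain : forall P Q, fam P -> fam Q -> elementary P Q \/ elementary Q P.

Definition member_over (S : set T) : prestructure :=
  xget (P0 : {classic prestructure}) [set P | fam P /\ S `<=` dom P].

Definition chain_union : prestructure := Pre
  (\bigcup_(P in fam) dom P) (pzero P0) (pone P0)
  (fun x y => padd (member_over [set x; y]) x y)
  (fun x y => pmul (member_over [set x; y]) x y)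
  (fun x y => pless (member_over [set x; y]) x y).

Let bool_assign (x y : T) (b : bool) := if b then x else y.

Lemma member_overP P x y : fam P -> dom P x -> dom P y ->
  fam (member_over [set x; y]) /\ forall b, dom (member_over [set x; y]) (bool_assign x y b).
Proof.
move=> fP dx dy; have [|fR dR] := @xgetPex {classic prestructure} P0
    [set P | fam P /\ [set x; y] `<=` dom P].
  by exists P; split=> // z [->|->].
by split=> // -[]; apply: dR; [left|right].
Qed.

Lemma chain_teval P R (V : Type) (v : V -> T) t : fam P -> fam R ->
  (forall i, dom P (v i)) -> (forall i, dom R (v i)) -> peval P v t = peval R v t.
Proof.
move=> fP fR vP vR; have [PR|RP] := chain fP fR.
  by apply: elementary_teval => //; exact: wf_fam.
by apply/esym/elementary_teval => //; exact: wf_fam.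
Qed.

Lemma chain_less P R x y : fam P -> fam R -> dom P x -> dom P y -> dom R x -> dom R y ->
  pless P x y <-> pless R x y.
Proof.
move=> fP fR Px Py Rx Ry.
by have [PR|RP] := chain fP fR; [|apply: iff_sym]; apply: elementary_less.
Qed.

Lemma chain_union_teval P (V : Type) (v : V -> T) t : fam P -> (forall i, dom P (v i)) ->
  peval chain_union v t = peval P v t.
Proof.
move=> fP vP; have wP := wf_fam fP.
have op2 (u : term bool) x y : dom P x -> dom P y ->
    peval (member_over [set x; y]) (bool_assign x y) u = peval P (bool_assign x y) u.
  move=> dx dy; have [fR dR] := member_overP fP dx dy.
  by apply: chain_teval => // -[].
elim: t => [x|||t1 IH1 t2 IH2|t1 IH1 t2 IH2]; cbn [peval].
- by [].
- exact: (@chain_teval _ _ void (of_void T) Zero).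
- exact: (@chain_teval _ _ void (of_void T) One).
- by rewrite IH1 IH2; apply: (op2 (Add (Var true) (Var false))); exact: peval_dom.
- by rewrite IH1 IH2; apply: (op2 (Mul (Var true) (Var false))); exact: peval_dom.
Qed.

Lemma chain_union_less P x y : fam P -> dom P x -> dom P y ->
  pless chain_union x y <-> pless P x y.
Proof.
move=> fP dx dy; have [fR dR] := member_overP fP dx dy.
by apply: (chain_less fR fP (dR true) (dR false)).
Qed.

Lemma chain_union_pair x y : dom chain_union x -> dom chain_union y ->
  exists2 P, fam P & dom P x /\ dom P y.
Proof.
move=> [P fP Px] [Q fQ Qy].
by case: (chain fP fQ) => -[sub _]; [exists Q|exists P] => //; split=> //; exact: sub.
Qed.

Lemma chain_union_wf : wf_pre chain_union.
Proof.
have op2 u x y : dom chain_union x -> dom chain_union y ->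
    dom chain_union (peval chain_union (bool_assign x y) u).
  move=> dx dy; have [P fP [Px Py]] := chain_union_pair dx dy.
  have xyP b : dom P (bool_assign x y b) by case: b.
  by rewrite (chain_union_teval _ fP) //; exists P => //; apply: peval_dom => //; exact: wf_fam.
have [w0 w1 _ _] := wf_fam fam0; split; [by exists P0|by exists P0| |] => x y.
  exact: (op2 (Add (Var true) (Var false))).
exact: (op2 (Mul (Var true) (Var false))).
Qed.

Lemma chain_union_elementary P : fam P -> elementary P chain_union.
Proof.
move=> fP; split=> [x dx|V p]; first by exists P.
elim: p P fP => {V} [V t1 t2|V t1 t2|V|V p1 IH1 p2 IH2|V p1 IH1] P fP v vP; cbn [psat].
- by rewrite !(chain_union_teval _ fP).
- rewrite !(chain_union_teval _ fP) //; apply: iff_sym.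
  by apply: (chain_union_less fP); apply: peval_dom => //; exact: wf_fam.
- by [].
- by rewrite (IH1 P) // (IH2 P).
- split=> h a da; last by rewrite (IH1 P) //; [apply: h; exists P|case].
  have [R [fR dR PR]] : exists R, [/\ fam R, dom R a & elementary P R].
    case: da => Q fQ dQ; case: (chain fP fQ) => [|QP]; first by exists Q.
    by exists P; split=> //; [exact: QP.1|exact: elementary_refl].
  have vR i : dom R (v i) by apply: PR.1.
  have hR : psat R (All p1) v by rewrite -PR.2.
  by rewrite -(IH1 R) //; [exact: hR|case].
Qed.

End Union.

Definition close0 (p : form nat) : form nat :=
  All (frename (fun n => if n is k.+1 then Some k else None) p).

Lemma holds_iter_close0 (M : structure) n (p : form nat) (v : nat -> M) :
  holds (iter n close0 p) v <->
  forall u : nat -> M, holds p (fun k => if (k < n)%N then u k else v (k - n)%N).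
Proof.
elim: n p v => [|n IH] p v.
  have vE (u : nat -> M) : (fun k => if (k < 0)%N then u k else v (k - 0)%N) = v.
    by apply: funext => k; rewrite subn0.
  by split=> [h u|h]; [rewrite vE|have := h v; rewrite vE].
have close0P q (w : nat -> M) : holds (close0 q) w <-> forall a, holds q (scons a w).
  have bodyP a : holds (frename (fun k => if k is j.+1 then Some j else None) q)
      (extend w a) <-> holds q (scons a w).
    by rewrite holds_frename; apply: eq_holds; case.
  by split=> h a; apply/bodyP.
rewrite iterSr IH; split=> h u.
  have /close0P /(_ (u 0)) := h (fun k => u k.+1).
  by apply: (eq_holds _ _).1; case.
by apply/close0P => a; apply: (eq_holds _ _).1 (h (scons a u)); case.
Qed.

Lemma elementary_PA P Q (wP : wf_pre P) (wQ : wf_pre Q) : elementary P Q ->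
  model_of_PA (structure_of wP) -> model_of_PA (structure_of wQ).
Proof.
move=> PQ hP p hp v; have [n nP] := elems_bounded id (form_vars p).
have closed (u : nat -> structure_of wP) : holds (iter n.+1 close0 p) u.
  by apply/holds_iter_close0 => u'; exact: hP.
have [dP0 _ _ _] := wP.
have /holds_psat := closed (fun=> pSub wP dP0); rewrite PQ.2 => [|i]; last exact: pvalP.
rewrite (_ : (fun=> _) = fun _ : nat => pval (pSub wQ (PQ.1 _ dP0))); last first.
  by apply: funext => i; rewrite !pSubK.
move=> /holds_psat /holds_iter_close0 /(_ v); apply: (eq_holds_vars _).1 => k /nP kn.
by rewrite ltnS kn.
Qed.

Lemma elementary_Th P Q (wP : wf_pre P) (wQ : wf_pre Q) : elementary P Q ->
  Th (structure_of wP) `<=` Th (structure_of wQ).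
Proof.
move=> [_ satPQ] p /holds_psat; rewrite satPQ; last by case.
move=> satp; apply/holds_psat; set v := fun i => pval _ in satp; set v' := fun i => pval _.
by rewrite (_ : v' = v) //; apply: funext => -[].
Qed.

Lemma exists_numeral_notin P (w : wf_pre P) (ys : seq T) : model_of_PA (structure_of w) ->
  exists n, ~ elems ys (pval (numeral (structure_of w) n)).
Proof.
move=> hM; apply: contrapT => /forallNP all_in.
have /finite_setPn := finite_elems ys; apply.
apply/(card_le_funP (pzero P)); exists (fun n => pval (numeral (structure_of w) n)).
  by move=> n _; apply: contrapT; exact: all_in.
by move=> n k _ _ /pval_inj /(numeral_inj hM).
Qed.

End Prestructures.

Lemma skolem (M : structure) (hM : model_of_PA M) (d : set M) (A : M -> M -> Prop) :
  def_over d (fun r => A (r 0) (r 1)) ->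
  exists2 h : M -> M, dfun_over d (fun r => h (r 0)) &
    forall t, (exists a, A t a) -> A t (h t).
Proof.
move=> dA.
have dAt t : def_over setT (fun r => A t (r 0)).
  have {}dA : def_over setT (fun r => A (r 0) (r 1)) by apply: def_over_sub dA.
  by apply: (def_comp2 (R := fun=> A)) => //; definability.
pose least_witness t a := (A t a /\ forall z, A t z -> pa_le a z) \/
  ((~ exists z, A t z) /\ a = zero).
have /choice [h hP] t : exists a, least_witness t a.
  have [[z Az]|nA] := pselect (exists z, A t z); last by exists zero; right.
  by have [y Ay ymin] := pa_least hM (dAt t) Az; exists y; left.
exists h => [|t [a Aa]]; last by case: (hP t) => [[]//|[[]]]; exists a.
have uniq t a : least_witness t a -> a = h t.
  case: (hP t) => [[Ah hmin]|[nA ->]] [[Aa amin]|[nAa ->]] //.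
  - by apply: (pa_le_anti hM); [exact: amin|exact: hmin].
  - by case: nAa; exists (h t).
  - by case: nA; exists a.
apply: (@def_ext _ _ _ _ (fun _ r => least_witness (r 1) (r 0))).
  by move=> _ r; split=> [/uniq|->].
by rewrite /least_witness; definability.
Qed.

(** * Elementary embeddings *)

(* Indexing by all structures with names for the elements of V makes one formula
   define the relation R in all of them, so that it passes along elementary
   embeddings. *)
Definition uniformly_definable (V : Type)
    (R : forall i : {M : structure & V -> M}, (nat -> projT1 i) -> Prop) :=
  definable (fun i => projT2 i) R.

Section Embedding.
Variables (T : Type) (P Q : prestructure T) (wP : wf_pre P) (wQ : wf_pre Q).
Hypothesis PQ : elementary P Q.

Definition emb (x : structure_of wP) : structure_of wQ := pSub wQ (PQ.1 _ (pvalP x)).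

Lemma pval_emb x : pval (emb x) = pval x.
Proof. exact: pSubK. Qed.

Lemma emb_inj : injective emb.
Proof. by move=> x y /(congr1 (@pval _ _ wQ)); rewrite !pval_emb => /pval_inj. Qed.

Lemma emb_onto x : dom P (pval x) -> exists y, emb y = x.
Proof. by move=> dx; exists (pSub wP dx); apply: pval_inj; rewrite pval_emb pSubK. Qed.

Lemma emb_holds (V : Type) (p : form V) (v : V -> structure_of wP) :
  holds p v <-> holds p (emb \o v).
Proof.
rewrite !holds_psat (_ : (fun i => pval ((emb \o v) i)) = fun i => pval (v i)).
  by apply: PQ.2 => i; exact: pvalP.
by apply: funext => i; rewrite /= pval_emb.
Qed.

Lemma emb_definable (V : Type) (c : V -> structure_of wP)
    (R : forall i : {M : structure & V -> M}, (nat -> projT1 i) -> Prop)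
    (r : nat -> structure_of wP) : uniformly_definable R ->
  R (existT _ _ c) r <-> R (existT _ _ (emb \o c)) (emb \o r).
Proof.
move=> [p pP]; rewrite !pP emb_holds.
by apply: eq_holds => -[].
Qed.

Lemma emb_dfun (g : forall i : {M : structure & void -> M}, (nat -> projT1 i) -> projT1 i)
    (r : nat -> structure_of wP) : definable_fun (fun i => projT2 i) g ->
  emb (g (existT _ _ (of_void _)) r) = g (existT _ _ (emb \o of_void _)) (emb \o r).
Proof.
move=> dg; set a := g (existT _ (structure_of wP) (of_void _)) r.
exact: (emb_definable (of_void _) (scons a r) dg).1 erefl.
Qed.

Let emb_arith (R : forall i : {M : structure & void -> M}, (nat -> projT1 i) -> Prop) r :=
  @emb_definable void (of_void _) R r.

Lemma emb_less x y : less x y <-> less (emb x) (emb y).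
Proof.
apply: (emb_arith (R := fun i r => less (r 0) (r 1)) (scons x (fun=> y))).
by rewrite /uniformly_definable; definability.
Qed.

Lemma emb_le x y : pa_le x y <-> pa_le (emb x) (emb y).
Proof.
apply: (emb_arith (R := fun i r => pa_le (r 0) (r 1)) (scons x (fun=> y))).
by rewrite /uniformly_definable; definability.
Qed.

Lemma emb_outside u v z : outside u v z <-> outside (emb u) (emb v) (emb z).
Proof. by rewrite /outside -!emb_less. Qed.

Lemma emb_pow x n : emb (power x n) = power (emb x) n.
Proof.
by apply: (emb_dfun (g := fun i r => power (r 0) n) (fun=> x)); definability.
Qed.

Lemma emb_two : emb (add one one) = add one one.
Proof.
by apply: (emb_dfun (g := fun i r => add one one) (fun=> zero)); definability.
Qed.

Lemma emb_coded m b y x : coded m b y x <-> coded (emb m) (emb b) (emb y) (emb x).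
Proof.
apply: (emb_arith (R := fun i r => coded (r 0) (r 1) (r 2) (r 3))
  (scons m (scons b (scons y (fun=> x))))).
by rewrite /uniformly_definable; definability.
Qed.

Lemma emb_coded_sub m b y z : coded m b y `<=` coded m b z <->
  coded (emb m) (emb b) (emb y) `<=` coded (emb m) (emb b) (emb z).
Proof.
apply: (emb_arith (R := fun i r => coded (r 0) (r 1) (r 2) `<=` coded (r 0) (r 1) (r 3))
  (scons m (scons b (scons y (fun=> z))))).
by rewrite /uniformly_definable /subset; definability.
Qed.

Lemma emb_covered_coded a m b y n : covered (coded m b y) (power a n) <->
  covered (coded (emb m) (emb b) (emb y)) (power (emb a) n).
Proof.
apply: (emb_arith (R := fun i r => covered (coded (r 0) (r 1) (r 2)) (power (r 3) n))
  (scons m (scons b (scons y (fun=> a))))).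
by apply: (def_covered (P := fun i x r => coded (r 0) (r 1) (r 2) x)); definability.
Qed.

Lemma emb_big a m b y : big a (coded m b y) <-> big (emb a) (coded (emb m) (emb b) (emb y)).
Proof. by split=> bY n; have := bY n; rewrite emb_covered_coded. Qed.

Lemma emb_dfun_over (hQ : model_of_PA (structure_of wQ)) d
    (g : structure_of wP -> structure_of wP) :
  dfun_over d (fun r => g (r 0)) ->
  exists2 g', dfun_over (emb @` d) (fun r => g' (r 0)) & forall x, g' (emb x) = emb (g x).
Proof.
move=> [p pP]; pose c (q : {x | d x}) := sval q.
have gP a x : a = g x <-> holds p (sum_assign (scons a (fun=> x)) c).
  exact: (pP tt (scons a (fun=> x))).
have [|g' dg' g'P] := @skolem _ hQ (emb @` d)
  (fun t a => holds p (sum_assign (scons a (fun=> t)) (emb \o c))).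
  apply: (@def_holds _ _ _ _ _ p (fun _ r => sum_assign (scons (r 1) (fun=> r 0)) (emb \o c))).
  move=> [[|n]|q]; [exact: dfun_var|exact: dfun_var|].
  by apply: dfun_cst; exists (c q) => //; exact: proj2_sig.
exists g' => // x.
have graph_uniq : forall a,
    holds p (sum_assign (scons a (fun=> emb x)) (emb \o c)) -> a = emb (g x).
  apply: (emb_definable c (R := fun i r =>
    forall a, holds p (sum_assign (scons a (fun=> r 0)) (projT2 i)) -> a = r 1)
    (scons x (fun=> g x)) _).1 => [|a /gP//].
  apply: def_all; apply: def_imp; last by definability.
  by apply: def_holds => -[[|n]|q]; [exact: dfun_var|exact: dfun_var|exact: dfun_param].
apply/graph_uniq/g'P; exists (emb (g x)).
have /emb_holds := (gP (g x) x).1 erefl.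
by apply: (eq_holds _ _).1 => -[[|n]|q].
Qed.

Lemma dcl_emb d z : dcl (emb @` d) z -> exists2 z', emb z' = z & dcl d z'.
Proof.
move=> [p pP].
have /choice [c cP] (q : {x | (emb @` d) x}) : exists y, d y /\ emb y = sval q.
  by have [y dy yq] := proj2_sig q; exists y.
have zP a : a = z <-> holds p (sum_assign (fun=> a) (emb \o c)).
  rewrite (pP tt (fun=> a)); apply: eq_holds => -[n|q] //=.
  by rewrite (cP q).2.
have zPc a : emb a = z <-> holds p (sum_assign (fun=> a) c).
  by rewrite zP emb_holds; apply: eq_holds => -[].
have [a /zPc az] : exists a, holds p (sum_assign (fun=> a) c).
  apply: (emb_definable c (R := fun i r => exists a, holds p (sum_assign (fun=> a) (projT2 i)))
    (fun=> zero) _).2; last by exists z; apply/zP.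
  by apply: def_ex; apply: def_holds => -[n|q]; [exact: dfun_var|exact: dfun_param].
exists a => //; apply: (@def_ext _ _ _ _ (fun _ r => holds p (sum_assign (fun=> r 0) c))).
  by move=> _ r; rewrite -zPc -az; split=> [/emb_inj|->].
apply: def_holds => -[n|q]; first exact: dfun_var.
exact: dfun_cst (cP q).1.
Qed.

End Embedding.

(** * Definable ultrapowers and good cuts *)

Definition definable_map (M : structure) (c : set M) (h : M -> M) :=
  dfun_over c (fun r => h (r 0)).

Section Ultrapower.
Variables (T : Type) (M : structure) (hM : model_of_PA M) (c : set M).
Variables (U : set_system M) (UU : UltraFilter U) (name : (M -> M) -> T).
Hypothesis nameP : forall h h', definable_map c h -> definable_map c h' ->
  (name h = name h' <-> U [set t | h t = h' t]).

Let PU : ProperFilter U := @ultra_proper _ _ UU.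

Definition repr (z : T) : M -> M :=
  xget ((fun=> zero) : {classic M -> M}) [set h | definable_map c h /\ name h = z].

Definition ultrapower : prestructure T := Pre
  (name @` definable_map c)
  (name (fun=> zero)) (name (fun=> one))
  (fun x y => name (fun t => add (repr x t) (repr y t)))
  (fun x y => name (fun t => mul (repr x t) (repr y t)))
  (fun x y => U [set t | less (repr x t) (repr y t)]).

Lemma reprP h : definable_map c h ->
  definable_map c (repr (name h)) /\ U [set t | repr (name h) t = h t].
Proof.
move=> dh; have [|dr /nameP] := @xgetPex {classic M -> M} (fun=> zero)
    [set h' | definable_map c h' /\ name h' = name h].
  by exists h.
by move=> /(_ dr dh).
Qed.

Lemma ultrapower_wf : wf_pre ultrapower.
Proof.
split=> /= [||_ _ [h dh <-] [h' dh' <-]|_ _ [h dh <-] [h' dh' <-]].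
- by exists (fun=> zero) => //; exact: dfun_zero.
- by exists (fun=> one) => //; exact: dfun_one.
- eexists; last reflexivity.
  by apply: dfun_add; [exact: (reprP dh).1|exact: (reprP dh').1].
- eexists; last reflexivity.
  by apply: dfun_mul; [exact: (reprP dh).1|exact: (reprP dh').1].
Qed.

Lemma definable_map_teval (V : Type) (H : V -> M -> M) t :
  (forall i, definable_map c (H i)) -> definable_map c (fun s => teval (fun i => H i s) t).
Proof. by move=> dH; apply: (dfun_teval t (v := fun _ r i => H i (r 0))). Qed.

Lemma ultrapower_teval (V : Type) (H : V -> M -> M) t : (forall i, definable_map c (H i)) ->
  peval ultrapower (fun i => name (H i)) t = name (fun s => teval (fun i => H i s) t).
Proof.
move=> dH; have dt u := definable_map_teval u dH.
elim: t => [x|||t1 IH1 t2 IH2|t1 IH1 t2 IH2] //; cbn [peval]; rewrite IH1 IH2 /=;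
  have [d1 U1] := reprP (dt t1); have [d2 U2] := reprP (dt t2).
- apply/nameP; [exact: dfun_add|exact: (dt (Add t1 t2))|].
  by apply: filterS (filterI U1 U2) => s [/= -> ->].
- apply/nameP; [exact: dfun_mul|exact: (dt (Mul t1 t2))|].
  by apply: filterS (filterI U1 U2) => s [/= -> ->].
Qed.

Lemma ultrapower_less h h' : definable_map c h -> definable_map c h' ->
  (pless ultrapower (name h) (name h') <-> U [set t | less (h t) (h' t)]).
Proof.
move=> /reprP [_ U1] /reprP [_ U2]; rewrite /=; split=> U3.
  by apply: filterS (filterI (filterI U1 U2) U3) => s [/= [<- <-]].
by apply: filterS (filterI (filterI U1 U2) U3) => s [/= [-> ->]].
Qed.

Lemma los (V : Type) (p : form V) (H : V -> M -> M) : (forall i, definable_map c (H i)) ->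
  (psat ultrapower p (fun i => name (H i)) <-> U [set t | holds p (fun i => H i t)]).
Proof.
elim: p H => {V} [V t1 t2|V t1 t2|V|V p1 IH1 p2 IH2|V p1 IH1] H dH; cbn [psat].
- by rewrite !ultrapower_teval // nameP //; exact: definable_map_teval.
- by rewrite !ultrapower_teval // ultrapower_less //; exact: definable_map_teval.
- split=> // U0; apply: (@filter_not_empty _ U PU).
  by apply: filterS U0.
- rewrite IH1 // IH2 //; split=> [U12|U12 U1]; last first.
    by apply: filterS (filterI U12 U1) => t /= [h12 /h12].
  have [/U12 U2|nU1] := in_ultra_setVsetC [set t | holds p1 (fun i => H i t)] UU.
    by apply: filterS U2 => t /=.
  by apply: filterS nU1 => t /= n1 /n1.
pose H' h (i : option V) : M -> M := if i is Some j then H j else h.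
have H'E h t : (fun i => H' h i t) = extend (fun i => H i t) (h t).
  by apply: funext => -[].
have losH' h : definable_map c h -> psat ultrapower p1 (extend (fun i => name (H i)) (name h)) <->
    U [set t | holds p1 (extend (fun i => H i t) (h t))].
  move=> dh; have <- : (fun i => name (H' h i)) = extend (fun i => name (H i)) (name h).
    by apply: funext => -[].
  rewrite IH1; last by case.
  by rewrite (_ : [set t | holds p1 (fun i => H' h i t)] =
    [set t | holds p1 (extend (fun i => H i t) (h t))]) //; apply/seteqP; split=> t /=; rewrite H'E.
split=> [all|Uall _ [h dh <-]]; last first.
  by apply/losH' => //; apply: filterS Uall => t /= /(_ (h t)).
have [//|Unall] := in_ultra_setVsetC [set t | holds (All p1) (fun i => H i t)] UU.
have [|h dh hP] := @skolem _ hM c (fun t a => ~ holds p1 (extend (fun i => H i t) a)).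
  apply: def_not; apply: (@def_holds _ _ _ _ _ p1 (fun _ r => extend (fun i => H i (r 0)) (r 1))).
  by case=> [j|]; [exact: dH|exact: dfun_var].
have /losH' Uh := all _ (ex_intro2 _ _ h dh erefl).
exfalso; apply: (@filter_not_empty _ U PU).
by apply: filterS (filterI (Uh dh) Unall) => t /= [ht /existsNP /hP].
Qed.

Lemma ultrapower_valid (V : Type) (p : form V) : (forall v : V -> M, holds p v) ->
  forall v : V -> structure_of ultrapower_wf, holds p v.
Proof.
move=> valid v; have /choice [H HP] i : exists h, definable_map c h /\ name h = pval (v i).
  by have [h dh hE] := pvalP (v i); exists h.
rewrite holds_psat (_ : (fun i => pval (v i)) = fun i => name (H i)); last first.
  by apply: funext => i; have [_ ->] := HP i.
by apply/los => [i|]; [have [] := HP i|apply: filterE => t; exact: valid].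
Qed.

End Ultrapower.

Section GoodCuts.
Variables (dL : Order.disp_t) (L : orderType dL).

Definition avoidable (M : structure) (A B : set M) :=
  forall d, small L d -> exists u v, [/\ A u, B v & forall z, dcl d z -> outside u v z].

Definition good_cut (M : structure) (A B : set M) :=
  (forall u v, A u -> B v -> less u v) /\ avoidable A B.

Definition good_cut_in (T : Type) (P : prestructure T) (A B : set T) :=
  [/\ A `<=` dom P, B `<=` dom P &
    exists w : wf_pre P, good_cut (@pval _ _ w @^-1` A) (@pval _ _ w @^-1` B)].

(* The condition on a filter under which an ultrapower by a finer ultrafilter
   leaves the cut avoidable. *)
Definition filter_avoids (M : structure) (F : set_system M) (A B : set M) :=
  forall e, small L e -> exists u v, [/\ A u, B v &
    forall h, definable_map e h -> F [set t | outside u v (h t)]].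

Hypothesis hL : is_infinite_cardinal L.
Hypothesis hpow : [set: short_seq L] #= [set: L].

Lemma card_leL_definable_map (M : structure) (c : set M) : c #<= [set: L] ->
  definable_map c #<= [set: L].
Proof.
move=> lec; pose params : Type := (nat + {x | c x})%type.
have leparams : [set: params] #<= [set: L].
  apply: card_leL_sum => //; first exact: card_leL_nat.
  have [f fI] := (card_leLP hL c).1 lec; apply/(card_leLP hL).
  exists (fun x => f (sval x)) => -[x cx] [y cy] _ _ /= /fI xy.
  by have {}xy := xy cx cy; case: _ / xy cy => cy; congr exist; exact: Prop_irrelevance.
pose graph_of (p : form params) h := forall x a, a = h x <->
  holds p (sum_assign (scons a (fun=> x)) (@sval M c)).
have /(choice_on (@Bot params)) [g gP] h : definable_map c h -> exists p, graph_of p h.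
  by move=> [p pP]; exists p => x a; exact: (pP tt (scons a (fun=> x))).
have [f fI] := (card_leLP hL [set: form params]).1 (card_leL_form hL hpow leparams).
apply/(card_leLP hL); exists (f \o g) => h k /gP gh /gP gk /= /fI ghk.
by apply: funext => x; apply/gk; rewrite -ghk //; apply/gh.
Qed.

Section UltrapowerExtension.
Variables (K : Type) (P : prestructure K) (w : wf_pre P).
Let M := structure_of w.
Hypothesis hM : model_of_PA M.
Variables (U : set_system M) (UU : UltraFilter U) (name : (M -> M) -> K).
Hypothesis nameP : forall h h', definable_map setT h -> definable_map setT h' ->
  (name h = name h' <-> U [set t | h t = h' t]).
Hypothesis name_cst : forall x, name (fun=> x) = pval x.

Let ult := ultrapower setT U name.
Let wult : wf_pre ult := ultrapower_wf nameP.
Let losU := los hM UU nameP.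

Let definable_cst (x : M) : definable_map setT (fun=> x).
Proof. exact: dfun_cst. Qed.

Let definable_id : definable_map (M := M) setT id.
Proof. exact: dfun_var. Qed.

Lemma ultrapower_elementary : elementary P ult.
Proof.
split=> [x dx|V p v vP].
  by exists (fun=> pSub w dx) => //; rewrite name_cst pSubK.
have vE : v = fun i => name (fun=> pSub w (vP i)).
  by apply: funext => i; rewrite name_cst pSubK.
rewrite [in X in _ <-> X]vE (losU p (fun i => definable_cst (pSub w (vP i)))).
have -> : U [set t | holds p (fun i => pSub w (vP i))] <-> holds p (fun i => pSub w (vP i)).
  by split=> [/filter_const|?]; last exact: filterE.
rewrite holds_psat (_ : (fun i => pval (pSub w (vP i))) = v) //.
by apply: funext => i; rewrite pSubK.
Qed.

Lemma ultrapower_realizes (V : Type) (v : V -> M) (q : form (option V)) :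
  U [set t | holds q (extend v t)] -> psat ult q (extend (fun i => pval (v i)) (name id)).
Proof.
move=> Uq; rewrite (_ : extend _ _ = fun i => name (if i is Some j then fun=> v j else id)).
  apply/losU; first by case.
  by apply: filterS Uq => t /=; apply: (eq_holds _ _).1; case.
by apply: funext => -[j|//] /=; rewrite name_cst.
Qed.

Lemma ultrapower_new : (forall s, U [set t | t <> s]) -> ~ dom P (name id).
Proof.
move=> Un dx; have [/(_ _)] := nameP definable_id (definable_cst (pSub w dx)).
rewrite name_cst pSubK => /(_ erefl) Ux _.
by have [t [/= tx /(_ tx)]] := filter_ex (filterI Ux (Un (pSub w dx))).
Qed.

Lemma ultrapower_dcl (d : set (structure_of wult)) (e : set M)
    (H : structure_of wult -> M -> M) z :
  (forall x, definable_map setT (H x) /\ name (H x) = pval x) ->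
  (forall x, d x -> definable_map e (H x)) -> dcl d z ->
  exists2 h, definable_map e h & name h = pval z.
Proof.
move=> HP He [p pP]; pose Hd (t : M) (q : {x | d x}) := H (sval q) t.
have zP y : definable_map setT y ->
    name y = pval z <-> U [set t | holds p (sum_assign (fun=> y t) (Hd t))].
  move=> dy; pose G := sum_assign (fun=> y) (fun q : {x | d x} => H (sval q)).
  have GE t : (fun i => G i t) = sum_assign (fun=> y t) (Hd t) by apply: funext => -[].
  have -> : [set t | holds p (sum_assign (fun=> y t) (Hd t))] = [set t | holds p (G ^~ t)].
    by apply/seteqP; split=> t /=; rewrite GE.
  rewrite -losU; last by case=> [n|q] //; exact: (HP _).1.
  have dom_y : dom ult (name y) by exists y.
  have -> : (fun i => name (G i)) =
      (fun i => pval (sum_assign (fun=> pSub wult dom_y) (@sval _ d) i)).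
    by apply: funext => -[n|q] /=; [rewrite pSubK|exact: (HP _).2].
  rewrite -holds_psat -(pP tt (fun=> pSub wult dom_y)).
  by split=> [yz|<-]; [apply: pval_inj|]; rewrite pSubK.
have [|h dh hP] := @skolem _ hM e (fun t a => holds p (sum_assign (fun=> a) (Hd t))).
  apply: (@def_holds _ _ _ _ _ p (fun _ r => sum_assign (fun=> r 1) (Hd (r 0)))).
  by case=> [n|q]; [exact: dfun_var|exact: He (proj2_sig q)].
exists h => //; apply/zP; first exact: dfun_over_sub dh.
have /(zP _ (HP z).1) Uz := (HP z).2.
by apply: filterS Uz => t Hzt; apply: hP; exists (H z t).
Qed.

Lemma ultrapower_good_cut (A B : set M) : (forall u v, A u -> B v -> less u v) ->
  filter_avoids U A B -> good_cut_in ult (@pval _ _ w @` A) (@pval _ _ w @` B).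
Proof.
move=> AB UAB; have dom_ult (x : M) : dom ult (pval x).
  by apply: ultrapower_elementary.1; exact: pvalP.
split; [by move=> _ [u _ <-]|by move=> _ [v _ <-]|exists wult; split].
  move=> x y [u Au ux] [v Bv vy]; apply/pval_less; rewrite -ux -vy.
  by apply/(elementary_less ultrapower_elementary); [exact: pvalP..|apply/pval_less; exact: AB].
move=> d sd; have /choice [H HP] (z : structure_of wult) :
    exists h, definable_map setT h /\ name h = pval z.
  by have [h] := pvalP z; exists h.
have /choice [l lP] z : exists l : seq M, definable_map (elems l) (H z).
  by have [l _] := def_over_finite (HP z).1; exists l.
have [|u [v [Au Bv uv]]] := UAB (\bigcup_(z in d) elems (l z)).
  by apply: small_bigcup => // z _; exact/small_finite/finite_elems.
exists (pSub wult (dom_ult u)), (pSub wult (dom_ult v)).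
split; [by exists u; rewrite ?pSubK|by exists v; rewrite ?pSubK|move=> z dz].
have [|h dh hz] := ultrapower_dcl HP _ dz (e := \bigcup_(z in d) elems (l z)).
  by move=> x dx; apply: dfun_over_sub (lP x) => y yl; exists x.
have dhT : definable_map setT h by exact: dfun_over_sub dh.
rewrite /outside !pval_less !pSubK -hz -!name_cst.
have [Ul|Ul] := in_ultra_setVsetC [set t | less (h t) u] UU; [left|right].
  exact/(ultrapower_less UU nameP).
apply/(ultrapower_less UU nameP) => //.
by apply: filterS (filterI (uv h dh) Ul) => t /= [[]].
Qed.

End UltrapowerExtension.

Variables (dK : Order.disp_t) (K : orderType dK).
Hypothesis hK : is_succ_cardinal L K.

(* The extension is the definable ultrapower of P by an ultrafilter finer than F,
   the class of the identity being the new element. *)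
Lemma ex_filter_extension (P : prestructure K) (w : wf_pre P)
    (F : set_system (structure_of w)) : model_of_PA (structure_of w) ->
  dom P #<= [set: L] -> ProperFilter F ->
  exists (Q : prestructure K) (x : K),
   [/\ wf_pre Q, elementary P Q, dom Q #<= [set: L], dom Q x &
    [/\ (forall s, F [set t | t <> s]) -> ~ dom P x,
     forall (V : Type) (v : V -> structure_of w) (q : form (option V)),
       F [set t | holds q (extend v t)] -> psat Q q (extend (fun i => pval (v i)) x) &
     forall A B : set (structure_of w), (forall u v, A u -> B v -> less u v) ->
       filter_avoids F A B -> good_cut_in Q (@pval _ _ w @` A) (@pval _ _ w @` B)]].
Proof.
move=> hM leP PF; set M := structure_of w in hM F PF *.
have [U [UU FU]] := ultraFilterLemma PF; have PU : ProperFilter U := @ultra_proper _ _ UU.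
have range_pval : range (@pval _ _ w) #<= [set: L].
  by apply: card_le_trans leP; apply: subset_card_le => _ [x _ <-]; exact: pvalP.
have leM : [set: M] #<= [set: L].
  by rewrite -(card_le_eql (inj_card_eq (in2W (@pval_inj _ _ w)))).
have led := card_leL_definable_map leM.
have [name name_cst nameP] : exists2 name : (M -> M) -> K, forall x, name (fun=> x) = pval x &
    forall h h', definable_map setT h -> definable_map setT h' ->
      (name h = name h' <-> U [set t | h t = h' t]).
  apply: (name_classes hL hpow hK led range_pval (@pval_inj _ _ w)).
  - by move=> h; exact: filterE.
  - by move=> h h'; apply: filterS => t /= ->.
  - by move=> h h' h'' U1 U2; apply: filterS (filterI U1 U2) => t [/= -> ->].
  - by move=> x y /filter_const.
exists (ultrapower setT U name), (name id); split=> //.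
- exact: ultrapower_wf nameP.
- exact: ultrapower_elementary.
- exact: card_le_trans (card_image_le _ _) led.
- by exists id => //; exact: dfun_var.
split=> [Fn|V v q /FU|A B AB FAB].
- by apply: ultrapower_new => // s; exact/FU/Fn.
- exact: ultrapower_realizes.
apply: ultrapower_good_cut => // e /FAB [u [v [Au Bv uv]]].
by exists u, v; split=> // h /uv /FU.
Qed.

End GoodCuts.

(** * Filters preserving good cuts *)

Definition list_meet (T : Type) (l : seq (set T)) : set T := \bigcap_(X in elems l) X.

Lemma list_meet_cat (T : Type) (l k : seq (set T)) :
  list_meet (l ++ k) = list_meet l `&` list_meet k.
Proof. by rewrite /list_meet elems_cat bigcap_setU. Qed.

Lemma def_list_meet (M : structure) (d : set M) (l : seq (set M)) :
  (forall X, elems l X -> def_over d (fun r => X (r 0))) ->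
  def_over d (fun r => list_meet l (r 0)).
Proof.
elim: l => [|X l IH] dl; first by apply: def_ext (def_true _) => _ r; split=> // _ X [].
apply: (@def_ext _ _ _ _ (fun _ r => X (r 0) /\ list_meet l (r 0))).
  move=> _ r; split=> [[Xr lr] Y [<-//|/lr//]|lr].
  by split=> [|Y Yl]; apply: lr; [left|right].
by apply: def_and; [apply: dl; left|apply: IH => Y Yl; apply: dl; right].
Qed.

Section Filters.
Variables (dL : Order.disp_t) (L : orderType dL).
Hypothesis hL : is_infinite_cardinal L.
Hypothesis hpow : [set: short_seq L] #= [set: L].
Variable M : structure.
Hypothesis hM : model_of_PA M.
Hypothesis leM : [set: M] #<= [set: L].
Variable cuts : set (set M * set M).
Hypothesis le_cuts : cuts #<= [set: L].
Hypothesis cuts_avoidable : forall D, cuts D -> avoidable L D.1 D.2.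

Lemma avoidable_one_zero : avoidable L [set @one M] [set zero].
Proof.
move=> d _; exists one, zero; split=> // z _.
have [z0|] := pa_leVlt hM z zero; [left|by right].
by apply: (pa_le_lt_trans hM z0); rewrite -[X in less _ X](pa_add0x hM); exact: pa_lt_succ.
Qed.

(* The cut ({1}, {0}), whose interval is empty, keeps the tasks defined when there
   are no cuts. *)
Lemma task_enum : exists E : L -> (set M * set M) * set M,
  [/\ forall i, avoidable L (E i).1.1 (E i).1.2 /\ small L (E i).2,
    forall e, small L e -> exists i, (E i).2 = e &
    forall D e, cuts D -> small L e -> exists i, E i = (D, e)].
Proof.
pose D1 : set M * set M := ([set one], [set zero]).
pose S := (cuts `|` [set D1]) `*` [set e : set M | small L e /\ e `<=` setT].
have leS : S #<= [set: L].
  apply: card_leL_setX => //; last exact: card_leL_small_subsets.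
  by apply: card_leL_setU => //; exact/card_leL_finite/finite_set1.
have [|E ES SE] := card_leL_enum hL _ leS.
  by exists (D1, set0); split; [right|split=> //; exact: small_set0].
exists E; split=> [i|e se|D e cD se].
- have [[cE|->] [sE _]] := ES i; split=> //; first exact: cuts_avoidable.
  exact: avoidable_one_zero.
- by have [|i _ iE] := SE (D1, e); [split; [right|split]|exists i; rewrite iE].
- by have [|i _ iE] := SE (D, e); [split; [left|split]|exists i].
Qed.

Local Notation two := (add (@one M) one).

Definition big_base (d : set M) (G : set (set M)) :=
  [/\ small L d, forall X, G X -> def_over d (fun r => X (r 0)) &
    forall l, elems l `<=` G -> big two (list_meet l)].

Lemma big_filter (G : set (set M)) : (forall l, elems l `<=` G -> big two (list_meet l)) ->
  exists F : set_system M, [/\ ProperFilter F, G `<=` F & forall s, F [set t | t <> s]].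
Proof.
move=> bigG; pose D := [set p : seq (set M) * seq M | elems p.1 `<=` G].
pose B (p : seq (set M) * seq M) := list_meet p.1 `\` elems p.2.
exists (filter_from D B); split=> [|X GX|s].
- apply: filter_from_proper.
    apply: filter_from_filter => [|[l xs] [k ys] Gl Gk]; first by exists ([::], [::]).
    exists (l ++ k, xs ++ ys) => [X|x]; first by rewrite /= elems_cat => -[/Gl|/Gk].
    rewrite /B /= list_meet_cat elems_cat => -[[lx kx] not_xys].
    by split; split=> // x_in; apply: not_xys; [left|right].
  move=> [l ys] Gl; apply: contrapT => empty; apply: (bigG l Gl (size ys)).
  apply: covered_sub (covered_elems hM (pa_lexx two) ys) => x meet_x.
  by apply: contrapT => nys; apply: empty; exists x.
- by exists ([:: X], [::]) => [Y [<-|]|x [meet_x _]] //; apply: meet_x; left.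
- by exists ([::], [:: s]) => // x [_ ns] xs; apply: ns; left.
Qed.

Lemma big_base_bigcup (d0 : set M) (G0 : set (set M)) (i : L)
    (h : L -> set M * set (set M)) : big_base d0 G0 ->
  (forall j, below i j -> [/\ big_base (h j).1 (h j).2, G0 `<=` (h j).2 &
    forall k, below j k -> (h k).2 `<=` (h j).2]) ->
  big_base (d0 `|` \bigcup_(j in below i) (h j).1) (G0 `|` \bigcup_(j in below i) (h j).2).
Proof.
move=> [sd0 dG0 bigG0] hP; split.
- apply: small_setU => //; apply: small_bigcup => //; first exact: small_below.
  by move=> j /hP [[]].
- move=> X [G0X|[j ji hX]]; first by apply: def_over_sub (dG0 X G0X) => x; left.
  have [[_ dhj _] _ _] := hP j ji; apply: def_over_sub (dhj X hX) => x dx.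
  by right; exists j.
have [[j0 j0i]|none] := pselect (exists j, below i j); last first.
  move=> l lG; apply: bigG0 => X /lG [//|[j ji _]].
  by case: none; exists j.
move=> l lG.
have [|||j ji lj] := elems_directed (J := below i) (R := fun j => (h j).2) _ _ (l := l).
- by exists j0.
- move=> j k ji ki; rewrite Order.POrderTheory.le_eqVlt => /orP [/eqP -> //|jk].
  by have [_ _] := hP k ki; apply.
- by move=> X /lG [G0X|//]; exists j0 => //; have [_ sub _] := hP j0 j0i; exact: sub.
by have [[_ _ bigj] _ _] := hP j ji; exact: bigj.
Qed.

(* Avoiding one interval costs only finitely many factors of two. *)
Lemma big_base_avoid (d : set M) (G : set (set M)) (A B e : set M) :
  big_base d G -> avoidable L A B -> small L e -> exists (s : set M * set (set M)) u v,
  [/\ big_base s.1 s.2, G `<=` s.2, A u, B v &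
    forall h, definable_map e h -> s.2 [set t | outside u v (h t)]].
Proof.
move=> [sd dG bigG] avoidAB se; pose d1 := d `|` (e `|` [set two]).
have sd1 : small L d1.
  by apply: small_setU => //; apply: small_setU => //; exact: small_set1.
have [u [v [Au Bv uv]]] := avoidAB d1 sd1.
pose out (h : M -> M) := [set t | outside u v (h t)].
exists (d1 `|` [set u; v], G `|` out @` definable_map e), u, v; split=> //=.
- split.
  + by apply: small_setU => //; exact/small_finite/finite_set2.
  + move=> X [GX|[h dh <-]]; first by apply: def_over_sub (dG X GX) => x dx; left; left.
    have du : (d1 `|` [set u; v]) u by right; left.
    have dv : (d1 `|` [set u; v]) v by right; right.
    have {}dh : dfun_over (d1 `|` [set u; v]) (fun r => h (r 0)).
      by apply: dfun_over_sub dh => x ex; left; right; left.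
    by rewrite /out /=; definability.
  + move=> l /elems_setU [s [_ [sG /elems_image [hs hse ->] lE]]] n.
    have ds X : elems s X -> def_over d1 (fun r => X (r 0)).
      by move=> /sG /dG; apply: def_over_sub => x; left.
    have dhs h : elems hs h -> dfun_over d1 (fun r => h (r 0)).
      by move=> /hse; apply: dfun_over_sub => x ex; right; left.
    have d1two : d1 two by right; right.
    have := interval_avoidance hM (pa_lexx two) d1two uv (def_list_meet ds) dhs (bigG s sG _).
    move=> /(_ n); apply: contra_not; apply: covered_sub => x [meet_s out_hs] X.
    rewrite lE elems_map => -[|[h hhs <-]]; [exact: meet_s|exact: out_hs].
- by move=> h dh; right; exists h.
Qed.

Lemma ex_avoiding_filter (d0 : set M) (G0 : set (set M)) : big_base d0 G0 ->
  exists F : set_system M, [/\ ProperFilter F, G0 `<=` F, forall s, F [set t | t <> s] &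
    forall D, cuts D -> filter_avoids L F D.1 D.2].
Proof.
move=> base0; have [E [Eok _ Esurj]] := task_enum.
have [|h hP] := @descending_sequence _ L hL _ (d0, G0)
  (fun s => big_base s.1 s.2 /\ G0 `<=` s.2) (fun s s' => s'.2 `<=` s.2)
  (fun i s => exists u v, [/\ (E i).1.1 u, (E i).1.2 v &
    forall g, definable_map (E i).2 g -> s.2 [set t | outside u v (g t)]]) _.
  move=> i h IH; have [avoidE sE] := Eok i.
  have [|s [u [v [baseS subS Au Bv uv]]]] :=
    big_base_avoid (big_base_bigcup (i := i) (h := h) base0 _) avoidE sE.
    by move=> j /IH [[]].
  exists s; split=> [|j ji X hX|]; last by exists u, v.
    by split=> // X GX; apply: subS; left.
  by apply: subS; right; exists j.
have mono i j : (i <= j)%O -> (h i).2 `<=` (h j).2.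
  rewrite Order.POrderTheory.le_eqVlt => /orP [/eqP -> //|ij].
  by have [_ sub _] := hP j; exact: sub.
have [i0 _] := nat_injL hL.
have [|F [PF GF Fne]] := @big_filter (\bigcup_i (h i).2).
  move=> l lG; have [|||i _ li] := elems_directed (J := setT) (R := fun i => (h i).2) _ _ (l := l).
  - by exists (i0 0).
  - by move=> i j _ _; exact: mono.
  - by [].
  by have [[[_ _ bigh] _] _ _] := hP i; exact: bigh.
exists F; split=> // [X G0X|D cD e se].
  by apply: GF; exists (i0 0) => //; have [[_ sub] _ _] := hP (i0 0); exact: sub.
have [i iE] := Esurj D e cD se; have [_ _] := hP i; rewrite iE => -[u [v [Au Bv uv]]].
by exists u, v; split=> // g dg; apply: GF; exists i => //; exact: uv.
Qed.

Definition lower_cut (F : set_system M) : set M := [set s | F [set x | pa_le s x]].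
Definition upper_cut (F : set_system M) : set M := [set t | F [set x | pa_le x t]].

Lemma lower_upper_lt (F : set_system M) : ProperFilter F -> (forall s, ~ F [set s]) ->
  forall s t, lower_cut F s -> upper_cut F t -> less s t.
Proof.
move=> PF Fne s t Fs Ft; apply/(pa_ltNle hM) => ts; apply: (Fne s).
apply: filterS (filterI Fs Ft) => x [/= sx xt].
by apply: (pa_le_anti hM) => //; exact: pa_le_trans xt ts.
Qed.

Definition flat (a : M) (g : M -> M) (X : set M) :=
  forall x x', X x -> X x' -> g x = g x' \/ (pa_le a (g x) /\ pa_le a (g x')).

Inductive requirement := Size of nat | Inside of M | Tame of (M -> M).

Definition meets (a b m u v : M) (q : requirement) (y : M) : Prop :=
  match q with
  | Size n => ~ covered (coded m b y) (power a n)
  | Inside z => coded m b y `<=` coded m b z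
  | Tame g => flat a g (coded m b y) /\ forall x, coded m b y x -> outside u v (g x)
  end.

Definition admissible (d d0 : set M) (q : requirement) : Prop :=
  match q with
  | Size _ => True
  | Inside z => d0 z
  | Tame g => definable_map d g
  end.

Definition refinement (a b m u v : M) (d d0 : set M) (y : M) :=
  forall q, admissible d d0 q -> meets a b m u v q y.

Definition finitely_bounded_below (a b m : M) (d0 : set M) :=
  forall l, elems l `<=` d0 -> exists2 y, big a (coded m b y) &
    forall z, elems l z -> coded m b y `<=` coded m b z.

Definition refinable (a b m u v : M) (d d0 : set M) :=
  [/\ small L d, d a /\ d b /\ d m, d0 `<=` d,
    forall z, dcl d z -> outside u v z & finitely_bounded_below a b m d0].

Definition shrunk (a b m y : M) (forbidden : set M) (s t y' : M) :=
  [/\ big a (coded m b y'), coded m b y' `<=` coded m b y,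
    forall x, coded m b y' x -> pa_le s x /\ pa_le x t &
    forall z, pa_le s z -> pa_le z t -> ~ forbidden z].

Section CutFilling.
Variables (a b m : M) (h : M -> M).
Hypothesis two_le_a : pa_le two a.
Hypothesis pow_le_b : forall n, pa_le (power a n) b.
Hypothesis h_mono : forall x y, less x y <-> less (h x) (h y).
Hypothesis h_surj : forall y, exists x, h x = y.
Hypothesis hb : h b = a.
Hypothesis ex_refinement : forall u v d d0,
  refinable a b m u v d d0 -> exists y, refinement a b m u v d d0 y.
Hypothesis ex_shrunk : forall d y, small L d -> big a (coded m b y) ->
  exists s t y', shrunk a b m y (h @^-1` dcl d) s t y'.

Lemma outside_image d s t z : (forall x, pa_le s x -> pa_le x t -> ~ dcl d (h x)) ->
  dcl d z -> outside (h s) (h t) z.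
Proof.
move=> st_free; have [x <-] := h_surj z => dz; rewrite /outside -!h_mono.
have [sx|] := pa_leVlt hM s x; [right|by left].
by apply/(pa_ltNle hM) => xt; exact: st_free dz.
Qed.

(* The values of h on [0, b) lie below a, and a flat function is constant where its
   values lie below a, so that its value is definable. *)
Lemma flat_outside_image d g y s t x : d a -> d b -> d m -> d y -> definable_map d g ->
  flat a g (coded m b y) -> (forall z, pa_le s z -> pa_le z t -> ~ dcl d (h z)) ->
  coded m b y x -> pa_le s x -> pa_le x t -> outside (h s) (h t) (g x).
Proof.
move=> da db dm dy dg flat_g st_free yx sx xt.
have [ga|ag] := pselect (less (g x) a).
  apply: outside_image st_free _.
  apply: (@def_ext _ _ _ _ (fun _ r => exists x', coded m b y x' /\ g x' = r 0)).
    move=> _ r; split=> [[x' [yx' <-]]|->]; last by exists x.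
    by case: (flat_g x x' yx yx') => [->//|[/(pa_leNlt hM)]].
  by rewrite /definable_map in dg; definability.
right; apply: (pa_lt_le_trans hM (y := a)); last exact/(pa_leNlt hM).
rewrite -hb -h_mono; apply/(pa_ltNle hM) => bt; apply: (st_free b) => //; last first.
  by rewrite hb; exact: dcl_self.
by apply: (pa_le_trans hM sx); apply: pa_ltW; case: yx.
Qed.

Definition meets_task (A B e : set M) (y : M) :=
  (exists u v, [/\ A u, B v &
    forall g, definable_map e g -> forall x, coded m b y x -> outside u v (g x)]) /\
  exists s t, (forall x, coded m b y x -> pa_le s x /\ pa_le x t) /\
    forall g, definable_map e g -> forall x, coded m b y x -> outside (h s) (h t) (g x).

Lemma ex_condition (d0 A B e : set M) : small L d0 -> small L e -> avoidable L A B ->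
  finitely_bounded_below a b m d0 -> exists y, [/\ big a (coded m b y),
    forall z, d0 z -> coded m b y `<=` coded m b z & meets_task A B e y].
Proof.
move=> sd0 se avoidAB bound0; pose d := (d0 `|` e) `|` [set a; b; m].
have sd : small L d.
  by apply: small_setU => //; [exact: small_setU|exact/small_finite/finite_set3].
have dabm : d a /\ d b /\ d m.
  by split; [|split]; right; [left; left|left; right|right].
have ed g : definable_map e g -> definable_map d g by apply: dfun_over_sub => x; left; right.
have [u [v [Au Bv uv]]] := avoidAB d sd.
have [|y refines] := @ex_refinement u v d d0.
  by split=> // x; left; left.
have bigy : big a (coded m b y) by move=> n; exact: (refines (Size n)).
have sdy : small L (d `|` [set y]) by apply: small_setU => //; exact: small_set1.
have [s [t [y' [bigy' y'y y'st st_free]]]] := ex_shrunk sdy bigy.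
exists y'; split=> //; first by move=> z d0z x /y'y; exact: (refines (Inside z)).
split; first exists u, v; last exists s, t; split=> // g /ed dg x y'x.
  by have [_] := refines (Tame g) dg; apply; exact: y'y.
have [flat_g _] := refines (Tame g) dg; have [sx xt] := y'st x y'x.
apply: flat_outside_image flat_g st_free (y'y _ y'x) sx xt.
- by left; exact: dabm.1.
- by left; exact: dabm.2.1.
- by left; exact: dabm.2.2.
- by right.
- by apply: dfun_over_sub dg => z; left.
Qed.

Lemma chain_bounded_below (H : L -> M) (i : L) :
  (forall j, below i j -> big a (coded m b (H j)) /\
    forall k, below j k -> coded m b (H j) `<=` coded m b (H k)) ->
  finitely_bounded_below a b m (H @` below i).
Proof.
move=> HP l lH; have [[j0 j0i]|none] := pselect (exists j, below i j); last first.
  exists zero => [|z /lH [j ji]]; last by case: none; exists j.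
  apply: big_sub (big_lt hM two_le_a pow_le_b) => x xb; split=> //.
  by exists zero; rewrite (pa_mulx0 hM).
have [|||j ji lj] := elems_directed (J := below i)
    (R := fun j => [set z | coded m b (H j) `<=` coded m b z]) _ _ (l := l).
- by exists j0.
- move=> j k ji ki; rewrite Order.POrderTheory.le_eqVlt => /orP [/eqP -> //|jk] z jz.
  by apply: subset_trans jz; have [_] := HP k ki; apply.
- by move=> z /lH [j ji <-]; exists j.
by have [bigj _] := HP j ji; exists (H j).
Qed.

Lemma ex_cut_filling_filter : exists F : set_system M, [/\ ProperFilter F,
  forall s, ~ F [set s],
  filter_avoids L F (h @` lower_cut F) (h @` upper_cut F) &
  forall D, cuts D -> filter_avoids L F D.1 D.2].
Proof.
have [E [Eok Ee Esurj]] := task_enum.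
have [|H HP] := @descending_sequence _ L hL _ a (fun y => big a (coded m b y))
  (fun y z => coded m b y `<=` coded m b z)
  (fun i => meets_task (E i).1.1 (E i).1.2 (E i).2) _.
  move=> i H IH; have [avoidE sE] := Eok i.
  have sH : small L (H @` below i) by apply: small_image; exact: small_below.
  have [y [bigy yH ymeets]] := ex_condition sH sE avoidE (chain_bounded_below IH).
  by exists y; split=> // j ji; apply: yH; exists j.
pose F := filter_from [set: L] (fun i => coded m b (H i)).
have FH i : F (coded m b (H i)) by exists i.
have mono i j : (i <= j)%O -> coded m b (H j) `<=` coded m b (H i).
  rewrite Order.POrderTheory.le_eqVlt => /orP [/eqP -> //|ij].
  by have [_ sub _] := HP j; exact: sub.
have [i0 _] := nat_injL hL.
have PF : ProperFilter F.
  apply: filter_from_proper => [|i _]; last by have [bigH _ _] := HP i; exact: big_ex bigH.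
  apply: filter_from_filter => [|i j _ _]; first by exists (i0 0).
  exists (Order.max i j) => // x Hx; split; apply: mono Hx.
    by rewrite Order.TotalTheory.le_max Order.POrderTheory.lexx.
  by rewrite Order.TotalTheory.le_max Order.POrderTheory.lexx orbT.
exists F; split=> // [s [i _ is_]|e se|D cD e se].
- by have [bigH _ _] := HP i; apply: (bigH 0); apply: covered_sub is_ (covered_set1 hM s).
- have [i iE] := Ee e se; have [_ _ [_ [s [t [st out]]]]] := HP i.
  exists (h s), (h t); split.
  + by exists s => //; apply: filterS (FH i) => x /st [].
  + by exists t => //; apply: filterS (FH i) => x /st [].
  + by rewrite -iE => g dg; apply: filterS (FH i) => x; exact: out.
- have [i iE] := Esurj D e cD se; have [_ _ [+ _]] := HP i; rewrite iE.
  move=> [u [v [Au Bv out]]]; exists u, v; split=> // g dg.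
  by apply: filterS (FH i) => x; exact: out.
Qed.

End CutFilling.

End Filters.

Arguments Size {M} n.

(** * Refinements in saturated models *)

Section Saturation.
Variables (dL : Order.disp_t) (L : orderType dL).
Hypothesis hL : is_infinite_cardinal L.
Hypothesis hpow : [set: short_seq L] #= [set: L].
Variable M : structure.
Hypothesis hM : model_of_PA M.

Definition set_saturated := forall A : set M, small L A -> forall G : set (set M),
  (forall X, G X -> def_over A (fun r => X (r 0))) ->
  (forall l, elems l `<=` G -> list_meet l !=set0) -> \bigcap_(X in G) X !=set0.

Lemma saturated_of_sets : set_saturated -> saturated L M.
Proof.
move=> sat A ltA p fin_sat.
have [||x px] := sat A (card_lt_small ltA) (@satisfies M A @` p).
- move=> _ [f pf <-]; apply: (@def_over_extend _ _ _ _ (fun x : {x | A x} => sval x)) => x.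
  by apply: dcl_self; exact: proj2_sig.
- move=> _ /elems_image [q qp ->]; have [x qx] := fin_sat _ qp (finite_elems q).
  by exists x => X; rewrite elems_map => -[f /qx fx <-].
by exists x => f pf; apply: px; exists f.
Qed.

Variables (a b m u v : M).
Hypothesis two_le_a : pa_le (add one one) a.
Hypothesis mb : divisible_upto m b.

Lemma ex_flat_subset (gs : seq (M -> M)) n (X : set M) : def_over setT (fun r => X (r 0)) ->
  (forall g, elems gs g -> definable_map setT g) ->
  ~ covered X (power a (n + (size gs).*2)) ->
  exists Y : set M, [/\ Y `<=` X, def_over setT (fun r => Y (r 0)), ~ covered Y (power a n) &
    forall g, elems gs g -> flat a g Y].
Proof.
elim: gs X => [|g gs IH] X dX dgs nc; first by exists X; split=> //; rewrite addn0 in nc.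
pose cut_at_a x y := (less (g x) a /\ y = g x) \/ (~ less (g x) a /\ y = a).
have /choice [cg cgP] x : exists y, cut_at_a x y.
  by have [ga|ag] := pselect (less (g x) a); [exists (g x); left|exists a; right].
have cut_uniq x y : cut_at_a x y -> y = cg x.
  by case: (cgP x) => -[? ->] [[? ->]|[? ->]].
have dg : dfun_over setT (fun r => g (r 0)) by apply: dgs; left.
have dcg : dfun_over setT (fun r => cg (r 0)).
  apply: (@def_ext _ _ _ _ (fun _ r => cut_at_a (r 1) (r 0))).
    by move=> _ r; split=> [/cut_uniq|->].
  by rewrite /cut_at_a; definability.
have cga x : X x -> pa_le (cg x) a by case: (cgP x) => -[ga ->]; [left|right].
rewrite /= doubleS !addnS in nc.
have [k nk] := ex_uncovered_fiber hM two_le_a dX dcg cga nc.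
have [||Y [YX dY nY flatY]] := IH (fun x => X x /\ cg x = k) _ _ nk.
- by definability.
- by move=> f fs; apply: dgs; right.
exists Y; split=> // [x /YX []//|f [<-|/flatY//]].
move=> x x' /YX [_ xk] /YX [_ x'k].
case: (cgP x) (cgP x') => -[ga cE] [[ga' cE']|[ga' cE']].
- by left; rewrite -cE -cE' xk x'k.
- by case: (pa_ltxx hM (x := a)); rewrite -{1}cE' x'k -xk cE.
- by case: (pa_ltxx hM (x := a)); rewrite -{1}cE xk -x'k cE'.
- by right; split; apply/(pa_leNlt hM).
Qed.

Lemma ex_tame_code (d X : set M) (gs : seq (M -> M)) n : d a ->
  (forall z, dcl d z -> outside u v z) -> def_over d (fun r => X (r 0)) ->
  (forall g, elems gs g -> definable_map d g) -> (forall x, X x -> less x b) -> big a X ->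
  exists y, [/\ coded m b y `<=` X, ~ covered (coded m b y) (power a n) &
    forall g, elems gs g -> meets a b m u v (Tame g) y].
Proof.
move=> da uv dX dgs Xb bX.
have nX1 : ~ covered (escaping X gs u v) (power a (n + (size gs).*2)).
  exact: (interval_avoidance hM two_le_a da uv dX dgs (bX _)).
have dX1 : def_over setT (fun r => escaping X gs u v (r 0)).
  have dT : def_over setT (fun r => escaping X gs (r 1) (r 2) (r 0)).
    exact: def_over_sub (def_escaping dX dgs).
  apply: (def_subst dT (s := scons (fun _ r => r 0) (scons (fun _ _ => u) (fun _ _ _ => v)))).
  by case=> [|[|k]]; [exact: dfun_var|exact: dfun_cst|exact: dfun_cst].
have [|X2 [X21 dX2 nX2 flatX2]] := ex_flat_subset dX1 _ nX1.
  by move=> g /dgs; exact: dfun_over_sub.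
have [y yP] := ex_code hM dX2 mb.
have yX2 x : coded m b y x -> X2 x by move=> /yP [].
exists y; split=> [x /yX2 /X21 []//||g gs_g].
  apply: contra_not nX2; apply: covered_sub => x X2x; apply/yP.
  by split=> //; apply: Xb; have [] := X21 _ X2x.
split=> [x x' /yX2 X2x /yX2|x /yX2 /X21 [_]]; last exact.
exact: (flatX2 g gs_g).
Qed.

Lemma ex_meets_finitely d d0 (qs : seq (requirement M)) : refinable L a b m u v d d0 ->
  elems qs `<=` admissible d d0 -> exists y, forall q, elems qs q -> meets a b m u v q y.
Proof.
move=> [_ [da [db dm]] d0d uv bound0] qs_adm.
pose inside_of (q : requirement M) := if q is Inside z then Some z else None.
pose X : set M := fun x => less x b /\ list_meet (map (coded m b) (pmap inside_of qs)) x.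
pose gs := map (fun q : requirement M => if q is Tame g then g else fun=> zero) qs.
have zs_d0 z : elems (pmap inside_of qs) z -> d0 z.
  by move=> /elems_pmap [[k|z'|g] // /qs_adm adm [<-]].
have [n nP] := elems_bounded (fun q : requirement M => if q is Size k then k else 0) qs.
have dX : def_over d (fun r => X (r 0)).
  apply: def_and; first by definability.
  apply: def_list_meet => Y; rewrite elems_map => -[z /zs_d0 /d0d dz <-].
  by definability.
have dgs g : elems gs g -> definable_map d g.
  rewrite elems_map => -[[k|z|g'] /qs_adm adm <-] //; exact: dfun_zero.
have bX : big a X.
  have [y0 by0 y0z] := bound0 _ zs_d0; apply: big_sub by0 => x y0x.
  split=> [|Y]; first by case: y0x.
  by rewrite elems_map => -[z /y0z + <-]; apply.
have [|y [yX ny tame_gs]] := ex_tame_code n da uv dX dgs _ bX; first by move=> x [].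
exists y => -[k|z|g] qq.
- apply: contra_not ny; apply: covered_le => //; apply: pa_pow_le => //.
    exact: one_le_base.
  exact: nP _ qq.
- move=> x /yX [_]; apply; rewrite elems_map; exists z => //.
  by apply/elems_pmap; exists (Inside z).
- by apply: tame_gs; rewrite /gs elems_map; exists (Tame g).
Qed.

Lemma def_meets (A : set M) (q : requirement M) : A a -> A b -> A m -> A u -> A v ->
  admissible A A q -> def_over A (fun r => meets a b m u v q (r 0)).
Proof.
move=> Aa Ab Am Au Av; case: q => [n _|z Az|g dg]; rewrite /meets.
- apply: def_not; apply: (def_covered (P := fun _ x r => coded m b (r 0) x));
    by definability.
- by rewrite /subset; definability.
- by rewrite /flat; rewrite /admissible /definable_map in dg; definability.
Qed.

Lemma refinement_of_saturated d d0 : set_saturated -> refinable L a b m u v d d0 ->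
  exists y, refinement a b m u v d d0 y.
Proof.
move=> sat hyp; have [sd [da [db dm]] d0d _ _] := hyp.
pose A : set M := d `|` [set u; v].
have dA : d `<=` A by move=> x; left.
have sA : small L A by apply: small_setU => //; exact/small_finite/finite_set2.
have [||y yP] := sat A sA (meets a b m u v @` admissible d d0).
- move=> _ [q adm <-]; apply: def_meets; rewrite /A //; try by [left|right; left|right; right].
  case: q adm => [//|z d0z|g] /=; first by left; exact: d0d.
  exact: dfun_over_sub.
- move=> _ /elems_image [qs /(ex_meets_finitely hyp) [y yqs] ->].
  by exists y => X; rewrite elems_map => -[q /yqs yq <-].
by exists y => q adm; apply: yP; exists q.
Qed.

End Saturation.

Section RefinementEmbedding.
Variables (dL : Order.disp_t) (L : orderType dL).
Variables (T : Type) (P Q : prestructure T) (wP : wf_pre P) (wQ : wf_pre Q).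
Hypothesis PQ : elementary P Q.
Hypothesis hQ : model_of_PA (structure_of wQ).
Let e : structure_of wP -> structure_of wQ := emb wQ PQ.

Lemma refinable_emb a b m u v d d0 : refinable L a b m u v d d0 ->
  refinable L (e a) (e b) (e m) (e u) (e v) (e @` d) (e @` d0).
Proof.
move=> [sd [da [db dm]] d0d uv bound0]; split.
- exact: small_image.
- by split; [exists a|split; [exists b|exists m]].
- by move=> _ [x /d0d dx <-]; exists x.
- by move=> z /dcl_emb [z' <- /uv]; rewrite (emb_outside wQ PQ).
move=> _ /elems_image [l ld0 ->]; have [y bigy yl] := bound0 l ld0.
exists (e y); first by rewrite -emb_big.
by move=> z; rewrite elems_map => -[z' /yl yz' <-]; apply/(emb_coded_sub wQ PQ).
Qed.

Lemma refinement_emb a b m u v d d0 y :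
  refinement (e a) (e b) (e m) (e u) (e v) (e @` d) (e @` d0) (e y) ->
  refinement a b m u v d d0 y.
Proof.
move=> refines [n _|z d0z|g /(emb_dfun_over PQ hQ) [g' dg' gE]].
- by have := refines (Size n) I; rewrite /= -emb_covered_coded.
- apply/(emb_coded_sub wQ PQ)/(refines (Inside (e z))).
  by exists z.
have [flat_g' out_g'] := refines (Tame g') dg'.
split=> [x x'|x]; rewrite !(emb_coded wQ PQ).
  move=> yx yx'; have := flat_g' _ _ yx yx'; rewrite !gE.
  case=> [/emb_inj|]; first by left.
  by rewrite -!emb_le; right.
by move=> /out_g'; rewrite gE -emb_outside.
Qed.

End RefinementEmbedding.

(** * Good cuts in unions of chains *)

Section ChainUnionGood.
Variables (dL : Order.disp_t) (L : orderType dL).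
Hypothesis hL : is_infinite_cardinal L.
Hypothesis hpow : [set: short_seq L] #= [set: L].

(* The intervals avoiding the finite subsets of d are bounded on both sides by one
   interval that avoids their endpoints. *)
Lemma avoidable_of_finite (M : structure) (A B : set M) : model_of_PA M ->
  (forall x y, A x -> B y -> less x y) ->
  (forall s, finite_set s ->
     exists u v, [/\ A u, B v & forall z, dcl s z -> outside u v z]) ->
  (forall D, small L D -> D `<=` A `|` B ->
     exists u v, [/\ A u, B v & D `<=` outside u v]) ->
  avoidable L A B.
Proof.
move=> hM AB avoid_finite avoid_ends d sd.
have [S [sS Sfin Scof]] := small_finite_cofinal hL hpow sd.
have /(choice_on (zero, zero)) [uv uvP] s : S s -> exists p : M * M,
    [/\ A p.1, B p.2 & forall z, dcl s z -> outside p.1 p.2 z].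
  by move=> /Sfin /avoid_finite [u [v uv]]; exists (u, v).
have [||u [v [Au Bv ends]]] := avoid_ends ((fst \o uv) @` S `|` (snd \o uv) @` S).
- by apply: small_setU => //; exact: small_image.
- by move=> _ [[s /uvP [As _ _] <-]|[s /uvP [_ Bs _] <-]]; [left|right].
exists u, v; split=> // z /def_over_finite [l /Scof [s Ss ls] dz].
have [As Bs outs] := uvP s Ss.
have us : less (uv s).1 u.
  have [//|vu] : outside u v (uv s).1 by apply: ends; left; exists s.
  by case: (pa_ltxx hM (x := v)); apply: (pa_lt_trans hM vu); exact: AB.
have vs : less v (uv s).2.
  have [vu|//] : outside u v (uv s).2 by apply: ends; right; exists s.
  by case: (pa_ltxx hM (x := u)); apply: (pa_lt_trans hM _ vu); exact: AB.
case: (outs z); first exact: dcl_sub dz.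
  by move=> zs; left; exact: (pa_lt_trans hM zs us).
by move=> sz; right; exact: (pa_lt_trans hM vs sz).
Qed.

Variables (T : Type) (P0 : prestructure T) (fam : set (prestructure T)).
Hypothesis fam0 : fam P0.
Hypothesis wf_fam : forall P, fam P -> wf_pre P.
Hypothesis chain : forall P Q, fam P -> fam Q -> elementary P Q \/ elementary Q P.

Lemma chain_union_good_cut (wU : wf_pre (chain_union P0 fam)) (A B : set T) :
  model_of_PA (structure_of wU) ->
  (forall ys : seq T, elems ys `<=` dom (chain_union P0 fam) ->
     exists P, [/\ fam P, elems ys `<=` dom P & good_cut_in L P A B]) ->
  good_cut_in L (chain_union P0 fam) A B.
Proof.
set U := chain_union P0 fam in wU * => hU cof.
have [|P1 [f1 _ [A1 B1 [w1 [AB1 avoid1]]]]] := cof [::]; first by [].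
have elU P : fam P -> elementary P U by exact: chain_union_elementary.
have elP1 := elU _ f1; pose e1 : structure_of w1 -> structure_of wU := emb wU elP1.
have onto1 x : dom P1 (pval x) -> exists y, e1 y = x by exact: emb_onto.
have ABU : forall x y : structure_of wU, A (pval x) -> B (pval y) -> less x y.
  move=> x y Ax By; have [x' xE] := onto1 x (A1 _ Ax); have [y' yE] := onto1 y (B1 _ By).
  by rewrite -xE -yE -emb_less; apply: AB1; rewrite /= -(pval_emb wU elP1) -/e1 ?xE ?yE.
split; [by move=> x /A1; exact: elP1.1|by move=> x /B1; exact: elP1.1|exists wU; split=> //].
apply: avoidable_of_finite => // [s fs|D sD DAB].
  have [l sl] := finite_set_elems fs.
  have [|P [fP lP [_ _ [wP [_ avoidP]]]]] := cof (map (@pval _ _ wU) l).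
    by rewrite elems_map => _ [x _ <-]; exact: pvalP.
  pose e : structure_of wP -> structure_of wU := emb wU (elU P fP).
  have se : small L (e @^-1` s).
    by apply: small_preimage; [exact: emb_inj|exact: small_finite].
  have [u [v [Au Bv out]]] := avoidP _ se.
  exists (e u), (e v); split; rewrite /= ?pval_emb // => z dz.
  have [|z' <- /out] := dcl_emb (PQ := elU P fP) (d := e @^-1` s) (z := z).
    apply: dcl_sub dz => x sx; have [|x' xE] := emb_onto wP (elU P fP) (x := x).
      by apply: lP; rewrite elems_map; exists x => //; exact: sl.
    by exists x' => //; rewrite /= /e xE.
  by rewrite (emb_outside wU (elU P fP)).
have [|u [v [Au Bv out]]] := avoid1 (e1 @^-1` D).
  by apply: small_preimage => //; exact: emb_inj.
exists (e1 u), (e1 v); split; rewrite /= ?pval_emb // => x Dx.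
have [|x' xE] := onto1 x; first by case: (DAB x Dx) => [/A1|/B1].
rewrite -xE -emb_outside; apply: out; apply: dcl_self.
by rewrite /= xE.
Qed.

End ChainUnionGood.

(** * The chain of models *)

Section RealizedTypes.
Variable T : Type.

(* The condition is semantic because the parameters of f range over all of T. *)
Definition depends_on (d : set T) (f : form (option T)) :=
  forall (P : prestructure T) (v v' : option T -> T), v None = v' None ->
    (forall x, d x -> v (Some x) = v' (Some x)) -> psat P f v -> psat P f v'.

Definition realizes (P : prestructure T) (p : set (form (option T))) (x : T) :=
  dom P x /\ forall f, p f -> psat P f (extend id x).

Definition infinitely_satisfiable (q : prestructure T) (p : set (form (option T))) :=
  forall l ys, elems l `<=` p -> exists2 b, ~ elems ys b & realizes q (elems l) b.

Definition imp_list (V : Type) (l : seq (form V)) (q : form V) : form V :=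
  foldr (@Imp V) q l.

Lemma psat_imp_list (V : Type) (P : prestructure T) (l : seq (form V)) q v :
  psat P (imp_list l q) v <-> ((forall f, elems l f -> psat P f v) -> psat P q v).
Proof.
elim: l => [|f l IH]; first by split=> [//|]; apply; case.
rewrite /= -/(imp_list l q); split=> [imp all|imp vf].
  by apply: (IH.1 (imp _)) => [|f' f'l]; apply: all; [left|right].
by apply/IH => all; apply: imp => f' [<-//|]; exact: all.
Qed.

Lemma elementary_infinitely_satisfiable (P Q : prestructure T) (d : set T)
    (p : set (form (option T))) : wf_pre P -> elementary P Q -> d `<=` dom P ->
  p `<=` depends_on d -> infinitely_satisfiable Q p -> infinitely_satisfiable P p.
Proof.
move=> [dP0 _ _ _] [PQ satPQ] dP pd inf l ys lp.
have /choice [v vP] y : exists z, dom P z /\ (dom P y -> z = y).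
  by have [dy|ndy] := pselect (dom P y); [exists y|exists (pzero P)].
pose differs y : form (option T) := Neg (Equal (Var None) (Var (Some y))).
pose none := All (imp_list (l ++ map differs ys) Bot).
have satE R f x : elems l f -> psat R f (extend v x) <-> psat R f (extend id x).
  by move=> /lp /pd fd; split; apply: fd => //= y /dP /(vP y).2.
have [b nb [db lb]] := inf l (map v ys) lp.
have Qsome : ~ psat Q none v.
  move=> /(_ b db) /psat_imp_list; apply=> f.
  rewrite elems_cat elems_map => -[fl|[y yys <-] /= by_]; first exact/satE/lb.
  by apply: nb; rewrite elems_map; exists y.
apply: contrapT => none_realizes; apply: Qsome.
apply/satPQ => [y|x dx]; first by have [] := vP y.
apply/psat_imp_list => all; apply: none_realizes; exists x => [xys|].
  have := all (differs x); rewrite elems_cat elems_map /= (vP x).2 //; apply=> //.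
  by right; exists x.
split=> // f fl; apply/satE => //; apply: all.
by rewrite elems_cat; left.
Qed.

End RealizedTypes.

Section Chain.
Local Open Scope order_scope.
Variables (dL : Order.disp_t) (L : orderType dL).
Variables (dK : Order.disp_t) (K : orderType dK).
Hypothesis hL : is_infinite_cardinal L.
Hypothesis hpow : [set: short_seq L] #= [set: L].
Hypothesis hK : is_succ_cardinal L K.
Variables (P0 : prestructure K) (w0 : wf_pre P0).
Hypothesis PA0 : model_of_PA (structure_of w0).
Hypothesis leP0 : dom P0 #<= [set: L].
Variables (guess : K -> set K) (pair : K -> K -> K) (tag : nat -> K).
Hypothesis pairI : forall x y x' y', pair x y = pair x' y' -> x = x' /\ y = y'.
Hypothesis tagI : injective tag.

(* A stage of the construction: a model and a cut that has to stay unfilled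
   (the empty pair of sets when there is no such cut). *)
Record stage := Stage { model : prestructure K; kept : set K * set K }.

Definition active (s : stage) := (kept s).1 !=set0.

Definition earlier_models (B : set K) (h : K -> stage) : set (prestructure K) :=
  [set P0] `|` (model \o h) @` B.

Definition limit_model (B : set K) (h : K -> stage) : prestructure K :=
  chain_union P0 (earlier_models B h).

Definition extends_chain a h (s : stage) :=
  [/\ wf_pre (model s), elementary (limit_model (below a) h) (model s),
    dom (model s) #<= [set: L],
    forall c, c < a -> active (h c) -> good_cut_in L (model s) (kept (h c)).1 (kept (h c)).2 &
    active s -> good_cut_in L (model s) (kept s).1 (kept s).2].

Definition coded_image (X A : set K) : set K :=
  [set y | exists2 u, A u & X (pair (tag 1) (pair u y))].

(* X codes, under the tag 1, the graph of a function f; a new element x fills the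
   cut (A, B) of q, and the image of this cut under f has to stay unfilled. *)
Definition kills (q : prestructure K) (s : stage) (X : set K) :=
  exists (A B : set K) (x : K),
  [/\ A `<=` dom q, B `<=` dom q, dom (model s) x,
    (forall u, A u -> ~ pless (model s) x u) /\ (forall v, B v -> ~ pless (model s) v x) &
    kept s = (coded_image X A, coded_image X B) /\ active s].

Definition code (f : form (option K)) : K :=
  form_code pair tag f (option_code pair tag id).

Lemma code_inj : injective code.
Proof. by apply: form_code_inj => //; apply: option_code_inj. Qed.

Definition coded_type (X : set K) : set (form (option K)) :=
  [set f | X (pair (tag 0) (code f))].

Definition realizable (q : prestructure K) (p : set (form (option K))) :=
  (exists d, [/\ small L d, d `<=` dom q & p `<=` depends_on d]) /\
  infinitely_satisfiable q p.

Definition killable a h := exists2 s, extends_chain a h s &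
  kills (limit_model (below a) h) s (guess a).

Definition follows_guess a h (s : stage) :=
  let q := limit_model (below a) h in
  [/\ extends_chain a h s, killable a h -> kills q s (guess a) &
    ~ killable a h -> realizable q (coded_type (guess a)) ->
      exists2 x, ~ dom q x & realizes (model s) (coded_type (guess a)) x].

Lemma earlier_total (B : set K) (h : K -> stage) :
  (forall c P, B c -> earlier_models (below c) h P -> elementary P (model (h c))) ->
  forall P R, earlier_models B h P -> earlier_models B h R ->
    elementary P R \/ elementary R P.
Proof.
move=> elB P R [->|[b Bb <-]] [->|[c Bc <-]].
- by left; exact: elementary_refl.
- by left; apply: elB => //; left.
- by right; apply: elB => //; left.
case: (Order.TotalTheory.ltgtP b c) => [bc|cb|->]; last by left; exact: elementary_refl.
  by left; apply: elB => //; right; exists b.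
by right; apply: elB => //; right; exists c.
Qed.

Lemma earlier0 B h : earlier_models B h P0.
Proof. by left. Qed.

Lemma earlier_stage (B : set K) h b : B b -> earlier_models B h (model (h b)).
Proof. by move=> Bb; right; exists b. Qed.

Section Limit.
Variables (B : set K) (h : K -> stage).
Hypothesis Bdown : forall b c, b < c -> B c -> B b.
Hypothesis hB : forall b, B b -> follows_guess b h (h b).

Lemma earlier_wf P : earlier_models B h P -> wf_pre P.
Proof. by move=> [->//|[b Bb <-]]; have [[]] := hB Bb. Qed.

Lemma earlier_elementary c P : B c -> earlier_models (below c) h P ->
  elementary P (model (h c)).
Proof.
have [[wo _] _ _] := hK.
move: P; elim/(well_founded_ind (wo_wf wo)): c => c IH P Bc cP.
have [[_ elc _ _ _] _ _] := hB Bc; apply: elementary_trans elc.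
apply: chain_union_elementary cP => [|R [->//|[b bc <-]]|]; first exact: earlier0.
  by have [[]] := hB (Bdown bc Bc).
by apply: earlier_total => b R bc; apply: IH => //; exact: Bdown Bc.
Qed.

Lemma earlier_chain P R : earlier_models B h P -> earlier_models B h R ->
  elementary P R \/ elementary R P.
Proof. by apply: earlier_total; exact: earlier_elementary. Qed.

Lemma limit_wf : wf_pre (limit_model B h).
Proof. exact: (chain_union_wf (earlier0 B h) earlier_wf earlier_chain). Qed.

Lemma limit_elementary P : earlier_models B h P -> elementary P (limit_model B h).
Proof. exact: (chain_union_elementary (earlier0 B h) earlier_wf earlier_chain). Qed.

Lemma limit_PA : model_of_PA (structure_of limit_wf).
Proof. by apply: elementary_PA PA0; apply: limit_elementary; exact: earlier0. Qed.

Lemma limit_card_leL : B #<= [set: L] -> dom (limit_model B h) #<= [set: L].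
Proof.
move=> leB; apply: (@card_le_trans _ _ _ (dom P0 `|` \bigcup_(b in B) dom (model (h b)))).
  by apply: subset_card_le => x [P [->|[b Bb <-]] dx]; [left|right; exists b].
apply: (card_leL_setU hL hpow leP0); apply: (card_leL_bigcup hL hpow leB) => b Bb.
by have [[]] := hB Bb.
Qed.

Lemma stage_good_cut b c : B b -> c <= b -> active (h c) ->
  good_cut_in L (model (h b)) (kept (h c)).1 (kept (h c)).2.
Proof.
move=> Bb; have [[_ _ _ good_lt good_b] _ _] := hB Bb.
by rewrite Order.POrderTheory.le_eqVlt => /orP [/eqP -> //|]; exact: good_lt.
Qed.

Lemma limit_good_cut c : B c -> active (h c) ->
  good_cut_in L (limit_model B h) (kept (h c)).1 (kept (h c)).2.
Proof.
move=> Bc act.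
apply: (chain_union_good_cut hL hpow (earlier0 B h) earlier_wf earlier_chain limit_PA).
move=> ys ysB; pose J := B `&` [set b | c <= b].
have mono i j : J i -> J j -> i <= j -> dom (model (h i)) `<=` dom (model (h j)).
  move=> _ [Bj _]; rewrite Order.POrderTheory.le_eqVlt => /orP [/eqP -> //|ij].
  by apply: (earlier_elementary Bj _).1; exact: earlier_stage.
have Jc : J c by split=> //=; exact: Order.POrderTheory.lexx.
have [|b [Bb cb] ysb] := elems_directed (ex_intro _ c Jc) mono (l := ys).
  move=> y /ysB [P [->|[b Bb <-]] dy].
    by exists c => //; exact: (earlier_elementary Bc (earlier0 _ h)).1.
  case: (Order.TotalTheory.leP c b) => [cb|bc]; first by exists b.
  by exists c => //; exact: (earlier_elementary Bc (earlier_stage _ bc)).1.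
by exists (model (h b)); split=> //; [exact: earlier_stage|exact: stage_good_cut].
Qed.

Lemma limit_infinite ys : exists2 b, dom (limit_model B h) b & ~ elems ys b.
Proof.
have [n ny] := exists_numeral_notin ys limit_PA.
by exists (pval (numeral (structure_of limit_wf) n)) => //; exact: pvalP.
Qed.

End Limit.

Section OneStep.
Variables (a : K) (h : K -> stage).
Hypothesis IH : forall b, b < a -> follows_guess b h (h b).
Let q := limit_model (below a) h.

Let below_down b c : b < c -> below a c -> below a b.
Proof. exact: Order.POrderTheory.lt_trans. Qed.

Variable wq : wf_pre q.

Lemma stage_PA : model_of_PA (structure_of wq).
Proof. by rewrite (Prop_irrelevance wq (limit_wf below_down IH)); exact: limit_PA. Qed.

Definition kept_cuts : set (set (structure_of wq) * set (structure_of wq)) :=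
  (fun c => (@pval _ _ wq @^-1` (kept (h c)).1, @pval _ _ wq @^-1` (kept (h c)).2)) @`
  [set c | c < a /\ active (h c)].

Lemma kept_cuts_card_leL : kept_cuts #<= [set: L].
Proof.
apply: card_le_trans (card_image_le _ _) _; apply: card_le_trans (below_card_leL hK a).
by apply: subset_card_le => c [].
Qed.

Lemma kept_cuts_good D : kept_cuts D -> good_cut L D.1 D.2.
Proof.
move=> [c [ca act] <-]; have [_ _ [w gw]] := limit_good_cut below_down IH ca act.
by rewrite (Prop_irrelevance wq w).
Qed.

Lemma kept_cuts_avoidable D : kept_cuts D -> avoidable L D.1 D.2.
Proof. by move=> /kept_cuts_good []. Qed.

Lemma limit_dom_card_leL : dom q #<= [set: L].
Proof. exact: (limit_card_leL IH (below_card_leL hK a)). Qed.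

Lemma structure_card_leL : [set: structure_of wq] #<= [set: L].
Proof.
apply: card_le_trans limit_dom_card_leL.
rewrite -(card_le_eql (inj_card_eq (in2W (@pval_inj _ _ wq)))).
by apply: subset_card_le => _ [x _ <-]; exact: pvalP.
Qed.

Lemma ex_stage_model (F : set_system (structure_of wq)) : ProperFilter F ->
  (forall D, kept_cuts D -> filter_avoids L F D.1 D.2) ->
  exists (P : prestructure K) (x : K), [/\ forall D, 
      (active (Stage P D) -> good_cut_in L P D.1 D.2) -> extends_chain a h (Stage P D),
    dom P x, (forall s, F [set t | t <> s]) -> ~ dom q x,
    forall (V : Type) (v : V -> structure_of wq) (f : form (option V)),
      F [set t | holds f (extend v t)] -> psat P f (extend (fun i => pval (v i)) x) &
    forall A B : set (structure_of wq), (forall u v, A u -> B v -> less u v) ->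
      filter_avoids L F A B -> good_cut_in L P (@pval _ _ wq @` A) (@pval _ _ wq @` B)].
Proof.
move=> PF Fkept.
have [P [x [wP qP leP dx [new real good]]]] :=
  ex_filter_extension hL hpow hK stage_PA limit_dom_card_leL PF.
exists P, x; split=> // D goodD; split=> //= c ca act.
have [Aq Bq _] := limit_good_cut below_down IH ca act.
have cD : kept_cuts (@pval _ _ wq @^-1` (kept (h c)).1, @pval _ _ wq @^-1` (kept (h c)).2).
  by exists c.
have := good _ _ (kept_cuts_good cD).1 (Fkept _ cD).
have image_preimage A : A `<=` dom q -> @pval _ _ wq @` (@pval _ _ wq @^-1` A) = A.
  move=> Asub; apply/seteqP; split=> [_ [y Ay <-]//|y Ay].
  by exists (pSub wq (Asub _ Ay)); rewrite /= ?pSubK.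
by rewrite !image_preimage.
Qed.

Lemma ex_realizing_stage (d : set K) (p : set (form (option K))) : small L d ->
  d `<=` dom q -> p `<=` depends_on d -> infinitely_satisfiable q p ->
  exists s, extends_chain a h s /\ exists2 x, ~ dom q x & realizes (model s) p x.
Proof.
move=> sd dq pd inf.
have /choice [v vP] x : exists y : structure_of wq, (d x -> pval y = x) /\ (~ d x -> y = zero).
  have [dx|ndx] := pselect (d x); last by exists zero.
  by exists (pSub wq (dq _ dx)); rewrite pSubK.
have vE x : d x -> pval (v x) = x by have [] := vP x.
have satE (P : prestructure K) f y : p f ->
    psat P f (extend (fun x => pval (v x)) y) <-> psat P f (extend id y).
  by move=> pf; split; apply: (pd f pf) => //= x dx; rewrite vE.
pose sol (f : form (option K)) : set (structure_of wq) := [set t | holds f (extend v t)].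
have solE f t : p f -> sol f t <-> psat q f (extend id (pval t)).
  move=> pf; rewrite -satE // /sol /= holds_psat.
  rewrite (_ : (fun i => pval (extend v t i)) = extend (fun x => pval (v x)) (pval t)) //.
  by apply: funext => -[].
have base : big_base L (v @` d) (sol @` p).
  split=> [|_ [f _ <-]|_ /elems_image [l lp ->]]; first exact: small_image.
    apply: def_over_extend => x; have [dx|/(vP x).2 ->] := pselect (d x).
      by apply: dcl_self; exists x.
    exact: dfun_zero.
  apply: (big_of_infinite stage_PA) => ys.
  have [b nb [db lb]] := inf l (map (@pval _ _ wq) ys) lp.
  exists (pSub wq db) => [X|bys]; last first.
    by apply: nb; rewrite elems_map; exists (pSub wq db) => //; rewrite pSubK.
  rewrite elems_map => -[f fl <-]; apply/solE; first exact: lp.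
  by rewrite pSubK; exact: lb.
have [F [PF GF Fne Fkept]] := ex_avoiding_filter hL hpow stage_PA structure_card_leL
  kept_cuts_card_leL kept_cuts_avoidable base.
have [P [x [ext dx new real _]]] := ex_stage_model PF Fkept.
exists (Stage P (set0, set0)); split; first by apply: ext => -[].
exists x; first exact: new.
split=> // f pf; apply/satE => //; apply: real.
by apply: GF; exists f.
Qed.

Lemma ex_next_stage : exists s, follows_guess a h s.
Proof.
have [[s ext kill]|nk] := pselect (killable a h).
  by exists s; split=> // nk; case: nk; exists s.
have [[[d [sd dq pd]] inf]|nr] := pselect (realizable q (coded_type (guess a))).
  have [s [ext real]] := ex_realizing_stage sd dq pd inf.
  by exists s.
have inf0 : infinitely_satisfiable q set0.
  move=> l ys l0; have [b db nb] := limit_infinite below_down IH ys.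
  by exists b => //; split=> // f /l0.
have [s [ext _]] := ex_realizing_stage (@small_set0 _ _ hL K) (@sub0set _ _) (@sub0set _ _) inf0.
by exists s.
Qed.

End OneStep.

Lemma limit_model_ext a h h' : (forall b, b < a -> h b = h' b) ->
  limit_model (below a) h = limit_model (below a) h'.
Proof.
move=> hh'; rewrite /limit_model /earlier_models; congr (chain_union P0 (_ `|` _)).
by apply/seteqP; split=> _ [b ba <-]; exists b; rewrite //= hh'.
Qed.

Lemma extends_chain_ext a h h' : (forall b, b < a -> h b = h' b) ->
  extends_chain a h = extends_chain a h'.
Proof.
move=> hh'; have sub h1 h2 s : (forall b, b < a -> h1 b = h2 b) ->
    extends_chain a h1 s -> extends_chain a h2 s.
  move=> h12 [w el le good_lt good_s]; rewrite (limit_model_ext h12) in el.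
  by split=> // c ca; rewrite -h12 //; exact: good_lt.
by apply/seteqP; split=> s; apply: sub => b /hh'.
Qed.

Lemma ex_chain : exists h : K -> stage, forall a, follows_guess a h (h a).
Proof.
have [[wo _] _ _] := hK.
apply: (wo_dependent_choice wo (Stage P0 (set0, set0)) (R := follows_guess)).
  move=> a h h' s hh'.
  by rewrite /follows_guess /killable (limit_model_ext hh') (extends_chain_ext hh').
move=> a h IH; apply: ex_next_stage => //; apply: (limit_wf _ IH) => b c.
exact: Order.POrderTheory.lt_trans.
Qed.

End Chain.

(** * The limit of the chain *)

Lemma E4_of_lt_power (N : structure) (a b : N) n k : model_of_PA N -> ~ standard a ->
  ~ standard b -> less a (power b n) -> less b (power a k) -> E4 a b.
Proof.
move=> hN na nb an bk.
have one_le (x : N) : ~ standard x -> pa_le one x.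
  by move=> /(numeral_lt_nonstandard hN 1); rewrite /= (pa_add0x hN) => /pa_ltW.
split=> //; exists (n + k); split.
- exact: (pa_lt_le_trans hN an (pa_pow_le hN (one_le b nb) (leq_addr _ _))).
- exact: (pa_lt_le_trans hN bk (pa_pow_le hN (one_le a na) (leq_addl _ _))).
Qed.

Section FinalModel.
Local Open Scope order_scope.
Variables (dL : Order.disp_t) (L : orderType dL).
Variables (dK : Order.disp_t) (K : orderType dK).
Hypothesis hL : is_infinite_cardinal L.
Hypothesis hpow : [set: short_seq L] #= [set: L].
Hypothesis hK : is_succ_cardinal L K.
Variables (P0 : prestructure K) (w0 : wf_pre P0).
Hypothesis PA0 : model_of_PA (structure_of w0).
Hypothesis leP0 : dom P0 #<= [set: L].
Variables (guess : K -> set K) (pair : K -> K -> K) (tag : nat -> K).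
Hypothesis pairI : forall x y x' y', pair x y = pair x' y' -> x = x' /\ y = y'.
Hypothesis tagI : injective tag.
Hypothesis guessP : forall X : set K,
  stationary [set a | has_cofinality L a /\ X `&` below a = guess a].
Variable h : K -> stage K.
Hypothesis hS : forall a, follows_guess L P0 guess pair tag a h (h a).

Let allS b : [set: K] b -> follows_guess L P0 guess pair tag b h (h b).
Proof. by []. Qed.

Let belowS a b : below a b -> follows_guess L P0 guess pair tag b h (h b).
Proof. by []. Qed.

Let below_down (a b c : K) : b < c -> below a c -> below a b.
Proof. exact: Order.POrderTheory.lt_trans. Qed.

Definition final_model : prestructure K := limit_model P0 setT h.
Definition model_at (a : K) : prestructure K := limit_model P0 (below a) h.

Definition final_wf : wf_pre final_model := limit_wf hK w0 (fun _ _ _ _ => I) allS.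
Definition model_at_wf a : wf_pre (model_at a) :=
  limit_wf hK w0 (@below_down a) (@belowS a).

Let N := structure_of final_wf.

Lemma final_PA : model_of_PA N.
Proof. exact: (limit_PA PA0 (hB := allS)). Qed.

Lemma model_at_PA a : model_of_PA (structure_of (model_at_wf a)).
Proof. exact: (limit_PA PA0 (hB := @belowS a)). Qed.

Lemma stage_elementary a : elementary (model (h a)) final_model.
Proof. exact: (limit_elementary hK w0 (fun _ _ _ _ => I) allS (earlier_stage P0 h I)). Qed.

Lemma model_at_elementary_stage a : elementary (model_at a) (model (h a)).
Proof. by have [[]] := hS a. Qed.

Lemma model_at_elementary a : elementary (model_at a) final_model.
Proof. exact: elementary_trans (model_at_elementary_stage a) (stage_elementary a). Qed.

Lemma model_at_mono a b : a <= b -> dom (model_at a) `<=` dom (model_at b).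
Proof.
move=> ab x [P [->|[c ca <-]] dx]; first by exists P0 => //; exact: earlier0.
exists (model (h c)) => //; apply: earlier_stage.
exact: Order.POrderTheory.lt_le_trans ab.
Qed.

Lemma ex_model_at x : dom final_model x -> exists a, dom (model_at a) x.
Proof.
move=> [P [->|[b _ <-]] dx]; first by exists x, P0 => //; exact: earlier0.
have [a ba] := succ_gt hL hpow hK b; exists a, (model (h b)) => //.
exact: earlier_stage.
Qed.

Lemma model_at_card_leL a : dom (model_at a) #<= [set: L].
Proof. exact: (limit_card_leL hL hpow leP0 (@belowS a) (below_card_leL hK a)). Qed.

Lemma ex_model_at_bound (U : set K) : U #<= [set: L] -> U `<=` dom final_model ->
  exists a, U `<=` dom (model_at a).
Proof.
move=> leU UN; have [k _] := succ_inhabited hK.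
have /(choice_on k) [r rP] x : U x -> exists a, dom (model_at a) x by move=> /UN /ex_model_at.
have [a aP] := succ_bounded hL hpow hK r leU; exists a => x Ux.
by apply: model_at_mono (rP x Ux); apply: Order.POrderTheory.ltW; exact: aP.
Qed.

Lemma ex_guessing_stage (X : set K) (Bs : seq (K -> K)) (c : K) : exists a : K,
  [/\ has_cofinality L a, X `&` below a = guess a, c < a &
    forall B, elems Bs B -> forall b, b < a -> B b < a].
Proof.
have /choice [M MP] b : exists m, forall B, elems ((fun=> c) :: Bs) B -> B b < m.
  exact: (succ_bounded hL hpow hK (fun B => B b) (card_leL_finite hL (finite_elems _))).
have [a [[cof gX] Ma]] := guessP X (club_closed hL hpow hK M).
have closed B b : elems ((fun=> c) :: Bs) B -> b < a -> B b < a.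
  by move=> /(MP b) /Order.POrderTheory.lt_trans + /Ma; apply.
exists a; split=> // [|B BBs b]; last by apply: closed; right.
by have [b] := cofinality_below hL cof; apply: (closed (fun=> c)); left.
Qed.

Lemma final_realizes (d : set K) (p : set (form (option K))) c : small L d ->
  d `<=` dom final_model -> p `<=` depends_on d -> p #<= [set: L] ->
  infinitely_satisfiable final_model p ->
  exists2 x, ~ dom (model_at c) x & realizes final_model p x.
Proof.
move=> sd dN pd lep inf; pose coded_formula f := pair (tag 0) (code pair tag f).
have [c1 c1P] := succ_bounded hL hpow hK coded_formula lep.
have [c2 c2P] := ex_model_at_bound (small_succ_card_leL hK sd) dN.
have [a [_ gX]] := ex_guessing_stage (coded_formula @` p) [::] (Order.max c (Order.max c1 c2)).
rewrite !Order.TotalTheory.gt_max => /andP [ca /andP [c1a c2a]] _.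
have pE : coded_type pair tag (guess a) = p.
  apply/seteqP; rewrite /coded_type -gX; split=> f /=; last first.
    by move=> pf; split; [exists f|exact: Order.POrderTheory.lt_trans (c1P f pf) c1a].
  by move=> [[g pg /pairI [_ /(code_inj pairI tagI) <-]]].
have dq : d `<=` dom (model_at a).
  by move=> x /c2P; apply: model_at_mono; exact: Order.POrderTheory.ltW.
have [_ _ realizing] := hS a.
have [||x nx [dx px]] := realizing.
- move=> [s _ [A [B [x [_ _ _ _ [keptE [y]]]]]]].
  by rewrite keptE /= -gX => -[u _ [[f _ /pairI [/tagI]]]].
- rewrite pE; split; first by exists d.
  apply: (elementary_infinitely_satisfiable _ _ dq pd inf); first exact: model_at_wf.
  exact: model_at_elementary.
rewrite pE in px; exists x => [xc|].
  by apply: nx; apply: model_at_mono xc; exact: Order.POrderTheory.ltW.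
have [sub satE] := stage_elementary a; split=> [|f pf]; first exact: sub.
pose v i := if i is Some y then if pselect (d y) then y else x else x.
have vE y : d y -> v (Some y) = y by rewrite /v; case: pselect.
have on_d : depends_on d f := pd f pf.
apply: (on_d final_model v) => //; apply: (satE _ f v _).1 => [[y|//]|].
  by rewrite /v; case: pselect => //= /dq; exact: (model_at_elementary_stage a).1.
by apply: on_d (px f pf) => // y dy; rewrite vE.
Qed.

Section ParameterNames.
Variable A : set N.
Hypothesis sA : small L A.

Let params (x : {x | A x}) : N := sval x.

(* The formulas q of interest depend on the variable 0 only; the other variables
   are discarded. *)
Definition name_params (q : form (nat + {x | A x})) : form (option K) :=
  fsubst q (fun i => match i with
    | inl 0 => Var None | inl _ => Zero | inr x => Var (Some (pval (params x))) end).

Lemma psat_name_params q (b : N) : psat final_model (name_params q) (extend id (pval b)) <->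
  holds q (sum_assign (scons b (fun=> zero)) params).
Proof.
have pval0 : pval (zero : N) = pzero final_model by exact: (pval_teval (of_void N) Zero).
rewrite psat_fsubst holds_psat; set v := fun i => peval _ _ _; set v' := fun i => pval _.
by rewrite (_ : v = v') //; apply: funext => -[[|n]|x].
Qed.

Lemma name_params_depends_on q : depends_on (@pval _ _ final_wf @` A) (name_params q).
Proof.
move=> P v v' v0 vE; rewrite !psat_fsubst.
set u := fun i => peval _ v _; set u' := fun i => peval _ v' _.
rewrite (_ : u = u') //; apply: funext => -[[|n]|x] //=.
by apply: vE; exists (params x) => //; exact: proj2_sig.
Qed.

Lemma card_leL_name_params : range name_params #<= [set: L].
Proof.
apply: card_le_trans (card_image_le _ _) _; apply: (card_leL_form hL hpow).
apply: (card_leL_sum hL hpow (card_leL_nat hL)).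
have /(card_leLP hL) [i iI] := small_succ_card_leL hK (small_image (f := @pval _ _ final_wf) sA).
apply/(card_leLP hL); exists (fun x => i (pval (params x))) => -[x Ax] [y Ay] _ _ /= /iI exy.
have /pval_inj {}exy : pval x = pval y by apply: exy; [exists x|exists y].
by case: _ / exy Ay => Ay; congr exist; exact: Prop_irrelevance.
Qed.

End ParameterNames.

(* If no element realized G, then every finite subset of G would be satisfied outside
   any given finite set, each of whose elements is excluded by some member of G. *)
Lemma final_saturated : set_saturated L N.
Proof.
move=> A sA G dG fin_sat; apply: contrapT => unrealized.
have inf l ys : elems l `<=` G -> exists2 b : N, ~ elems ys (pval b) & list_meet l b.
  move=> lG; have fin_ys : finite_set (@pval _ _ final_wf @^-1` elems ys).
    apply: finite_preimage (finite_elems ys) => x y _ _; exact: pval_inj.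
  have [ys' ysP] := finite_set_elems fin_ys.
  have /choice [omit omitP] (y : N) : exists X, G X /\ ~ X y.
    apply: contrapT => nX; apply: unrealized; exists y => X GX.
    by apply: contrapT => nXy; apply: nX; exists X.
  have [|b] := fin_sat (l ++ map omit ys').
    by rewrite elems_cat elems_map => X [/lG//|[y _ <-]]; have [] := omitP y.
  rewrite list_meet_cat => -[lb omit_b]; exists b => // /ysP bys.
  by apply: (omitP b).2; apply: omit_b; rewrite elems_map; exists b.
have /(choice_on Bot) [q qP] X : G X -> exists q : form (nat + {x | A x}),
    forall r, X (r 0) <-> holds q (sum_assign r (fun x : {x | A x} => sval x)).
  by move=> /dG [q qP]; exists q => r; exact: (qP tt r).
have qE X (b : N) : G X -> psat final_model (name_params (q X)) (extend id (pval b)) <-> X b.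
  by move=> GX; rewrite psat_name_params -(qP X GX).
have [|_ [X _ <-]||_ ys /elems_image [l lG ->]|x _ [dx px]] :=
  @final_realizes (@pval _ _ final_wf @` A) ((fun X => name_params (q X)) @` G)
    (pval (zero : N)) (small_image (f := @pval _ _ final_wf) sA).
- by move=> _ [x _ <-]; exact: pvalP.
- exact: name_params_depends_on.
- apply: card_le_trans (card_leL_name_params sA).
  by apply: subset_card_le => _ [X _ <-]; exists (q X).
- have [b nb lb] := inf l ys lG; exists (pval b) => //; split; first exact: pvalP.
  by move=> f; rewrite elems_map => -[X Xl <-]; apply/qE; [exact: lG|exact: lb].
apply: unrealized; exists (pSub final_wf dx) => X GX; apply/qE => //.
by rewrite pSubK; apply: px; exists X.
Qed.

Lemma final_not_card_leL : ~ (dom final_model #<= [set: L]).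
Proof.
move=> leN; have [c cN] := ex_model_at_bound leN (@subset_refl _ _).
have [//|//|||x nx [dx _]] := @final_realizes set0 set0 c (small_set0 hL (T := K)).
- exact/card_leL_finite/finite_set0.
- move=> l ys l0; have [b db nb] := limit_infinite hK PA0 (fun _ _ _ _ => I) allS ys.
  by exists b => //; split=> // f /l0.
by apply: nx; exact: cN.
Qed.

Lemma final_card : [set: N] #= [set: K].
Proof.
have dom_range : range (@pval _ _ final_wf) = dom final_model.
  apply/seteqP; split=> [_ [x _ <-]|x dx]; first exact: pvalP.
  by exists (pSub final_wf dx); rewrite ?pSubK.
rewrite -(card_eql (inj_card_eq (in2W (@pval_inj _ _ final_wf)))) dom_range.
apply/card_eqPle; split; first exact: subset_card_le.
by have [/final_not_card_leL|] := card_leL_or_ge_succ hK (dom final_model).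
Qed.

Lemma final_initial_segment_large (a : N) : ~ standard a ->
  ~ ([set x : N | less x a] #<= [set: L]).
Proof.
move=> na lea; pose U := @pval _ _ final_wf @` [set x : N | less x a].
have [|_ [x _ <-]|c cP] := @ex_model_at_bound U; first exact: card_le_trans (card_image_le _ _) lea.
  exact: pvalP.
pose below_a : form (option K) := Less (Var None) (Var (Some (pval a))).
have [|_ -> P v v' v0 vE||l ys la|x nx [dx xa]] :=
  @final_realizes [set pval a] [set below_a] c (small_set1 hL (x := pval a)).
- by move=> _ ->; exact: pvalP.
- by rewrite /= v0 vE.
- exact/card_leL_finite/finite_set1.
- have [n ny] := exists_numeral_notin ys final_PA; exists (pval (numeral N n)) => //.
  split=> [|f /la ->]; first exact: pvalP.
  by apply/(pval_less (numeral N n) a); exact: (numeral_lt_nonstandard final_PA n na).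
apply: nx; apply: cP; exists (pSub final_wf dx); rewrite ?pSubK //=.
by apply/pval_less; rewrite pSubK; exact: (xa below_a).
Qed.

Definition in_model (c : K) : set N := [set x | dom (model_at c) (pval x)].

Lemma in_model_mono c c' : c <= c' -> in_model c `<=` in_model c'.
Proof. by move=> cc' x; exact: model_at_mono. Qed.

Lemma in_model_card_leL c : in_model c #<= [set: L].
Proof.
apply: card_le_trans (model_at_card_leL c).
rewrite -(card_le_eql (inj_card_eq (in2W (@pval_inj _ _ final_wf)))).
by apply: subset_card_le => _ [x cx <-].
Qed.

Lemma in_model_bound (U : set N) : U #<= [set: L] -> exists c, U `<=` in_model c.
Proof.
move=> leU; have [||c cP] := @ex_model_at_bound (@pval _ _ final_wf @` U).
- exact: card_le_trans (card_image_le _ _) leU.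
- by move=> _ [x _ <-]; exact: pvalP.
by exists c => x Ux; apply: cP; exists x.
Qed.

Lemma in_model_closure (X Y : Type) (S : K -> set X) (R : K -> X -> Y -> Prop)
    (supp : Y -> set N) : (forall y, finite_set (supp y)) -> (forall c, S c #<= [set: L]) ->
  (forall c x, S c x -> exists y, R c x y) ->
  exists B : K -> K, forall c x, S c x -> exists2 y, supp y `<=` in_model (B c) & R c x y.
Proof.
move=> fin leS ex.
have /choice [rank rankP] y := in_model_bound (card_leL_finite hL (fin y)).
have [B BP] := succ_closure hL hpow hK rank leS ex.
exists B => c x /BP [y yB Ry]; exists y => // z /rankP.
by apply: in_model_mono; exact: Order.POrderTheory.ltW.
Qed.

Lemma small_in_model c (U : set N) : has_cofinality L c -> small L U -> U `<=` in_model c ->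
  exists2 k, k < c & U `<=` in_model k.
Proof.
move=> cof sU Uc; have /(choice_on c) [r rP] x : U x -> exists k, k < c /\ in_model k x.
  move=> /Uc [P [->|[b bc <-]] dx].
    have [b bc] := cofinality_below hL cof; exists b; split=> //.
    by exists P0 => //; exact: earlier0.
  have [k bk kc] := cofinality_limit hL cof bc; exists k; split=> //.
  by exists (model (h b)) => //; exact: earlier_stage.
have [|k kc kP] := small_below_bounded cof (small_image (f := r) sU).
  by move=> _ [x /rP [rxc _] <-].
by exists k => // x Ux; apply: in_model_mono (rP x Ux).2; apply: kP; exists x.
Qed.

Lemma model_at_elementary_model_at k c : k < c -> elementary (model_at k) (model_at c).
Proof.
move=> kc; apply: elementary_trans (model_at_elementary_stage k) _.
exact: (limit_elementary hK w0 (@below_down c) (@belowS c) (earlier_stage P0 h kc)).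
Qed.

Section Automorphism.
Variables (f g : N -> N) (a b : N).
Hypothesis fmono : forall x y, less x y <-> less (f x) (f y).
Hypothesis fK : cancel g f.
Hypothesis na : ~ standard a.
Hypothesis pow_le_b : forall n, pa_le (power a n) b.
Hypothesis fb : f b = a.

Lemma two_le_nonstandard : pa_le (add one one) a.
Proof.
by apply: pa_ltW; rewrite (two_numeral final_PA); exact: (numeral_lt_nonstandard final_PA 2 na).
Qed.

(* Since f is injective and [0, a) has more than |L| elements, one of the a blocks
   into which the set coded by y is cut avoids the preimage of the model at c. *)
Lemma ex_shrunk_off_model c m y : divisible_upto m b -> big a (coded m b y) ->
  exists s t y', shrunk a b m y (f @^-1` in_model c) s t y'.
Proof.
move=> mb bigy; have hN := final_PA.
have dy : def_over setT (fun r => coded m b y (r 0)) by definability.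
have [|U [V [VU bigUV]]] := big_blocks hN two_le_nonstandard (b := b) dy _ bigy.
  by move=> x [].
have [u [v [big_uv free]]] : exists u v,
    big a (fun x => coded m b y x /\ pa_le u x /\ pa_le x v) /\
    forall z, pa_le u z -> pa_le z v -> ~ in_model c (f z).
  apply: contrapT => met; apply: (final_initial_segment_large na).
  have /(choice_on zero) [r rP] t : less t a -> exists z,
      [/\ pa_le (U t) z, pa_le z (V t) & in_model c (f z)].
    move=> ta; apply: contrapT => off; apply: met; exists (U t), (V t).
    by split=> [|z Uz zV cz]; [exact: bigUV|apply: off; exists z].
  have r_mono s t : less s t -> less t a -> less (r s) (r t).
    move=> st ta; have [_ sV _] := rP s (pa_lt_trans hN st ta); have [Ut _ _] := rP t ta.
    exact: (pa_le_lt_trans hN sV (pa_lt_le_trans hN (VU s t st ta) Ut)).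
  have /(card_leLP hL) [i iI] := in_model_card_leL c.
  apply/(card_leLP hL); exists (i \o f \o r) => s t sa ta /= /iI frst.
  have {}frst : f (r s) = f (r t) by apply: frst; [have [] := rP s sa|have [] := rP t ta].
  apply: contrapT => /(pa_neq_lt hN) [/r_mono|/r_mono] lt.
    by have := lt ta; rewrite fmono frst; exact: pa_ltxx.
  by have := lt sa; rewrite fmono frst; exact: pa_ltxx.
pose block x := coded m b y x /\ pa_le u x /\ pa_le x v.
have dblock : def_over setT (fun r => block (r 0)) by rewrite /block; definability.
have [y' y'P] := ex_code hN dblock mb.
have y'E x : coded m b y' x <-> block x.
  by rewrite y'P; split=> [[]//|yx]; split=> //; have [[]] := yx.
exists u, v, y'; split=> // [|x /y'E []//|x /y'E []//].
by apply: big_sub big_uv => x /y'E.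
Qed.

Record closed_stage (m : N) (c : K) : Prop := ClosedStage {
  closed_cofinality : has_cofinality L c;
  closed_constants : [set a; b; m] `<=` in_model c;
  closed_automorphism : forall x, in_model c x -> in_model c (f x) /\ in_model c (g x);
  guesses_graph : forall x y, in_model c x ->
    guess c (pair (tag 1) (pair (pval x) y)) <-> y = pval (f x);
  closed_refinement : forall u v d d0, in_model c u -> in_model c v -> small L d ->
    d `<=` in_model c -> d0 `<=` d -> (exists y, refinement a b m u v d d0 y) ->
    exists2 y, in_model c y & refinement a b m u v d d0 y;
  closed_shrunk : forall k y, k < c -> in_model c y -> big a (coded m b y) ->
    exists s t y', [set s; t; y'] `<=` in_model c /\
      shrunk a b m y (f @^-1` in_model k) s t y'
}.

Lemma ex_refinement_bound m : exists B : K -> K, forall c u v d d0,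
  in_model c u -> in_model c v -> small L d -> d `<=` in_model c -> d0 `<=` d ->
  (exists y, refinement a b m u v d d0 y) ->
  exists2 y, in_model (B c) y & refinement a b m u v d d0 y.
Proof.
pose subsets c := [set A | small L A /\ A `<=` in_model c].
pose S c := [set i : (N * N) * (set N * set N) |
  ((in_model c `*` in_model c) `*` (subsets c `*` subsets c)) i /\
  exists y, refinement a b m i.1.1 i.1.2 i.2.1 i.2.2 y].
have [||c i []//|B BP] := @in_model_closure _ N S
  (fun _ i y => refinement a b m i.1.1 i.1.2 i.2.1 i.2.2 y) (fun y => [set y]).
- by move=> y; exact: finite_set1.
- move=> c; have lec := in_model_card_leL c.
  apply: (@card_le_trans _ _ _ ((in_model c `*` in_model c) `*` (subsets c `*` subsets c))).
    by apply: subset_card_le => i [].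
  by do 2?[apply: (card_leL_setX hL hpow)] => //; exact: card_leL_small_subsets.
exists B => c u v d d0 cu cv sd dc d0d ex.
have [|y By ry] := BP c ((u, v), (d, d0)); last by exists y => //; exact: By.
split=> //; split=> //; split=> //; split; first exact: small_sub sd.
exact: subset_trans dc.
Qed.

Lemma ex_shrunk_bound m : divisible_upto m b -> exists B : K -> K, forall c y,
  in_model c y -> big a (coded m b y) -> exists s t y',
    [set s; t; y'] `<=` in_model (B c) /\ shrunk a b m y (f @^-1` in_model c) s t y'.
Proof.
move=> mb; have [|c|c y [_ /(ex_shrunk_off_model c mb) [s [t [y' shr]]]]|B BP] :=
  @in_model_closure _ (N * N * N) (fun c => [set y | in_model c y /\ big a (coded m b y)])
    (fun c y p => shrunk a b m y (f @^-1` in_model c) p.1.1 p.1.2 p.2)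
    (fun p => [set p.1.1; p.1.2; p.2]).
- by move=> p; exact: finite_set3.
- by apply: card_le_trans (in_model_card_leL c); apply: subset_card_le => y [].
- by exists (s, t, y').
exists B => c y cy bigy; have [|[[s t] y'] By shr] := BP c y; first by [].
by exists s, t, y'.
Qed.

Lemma ex_closed_stage m : divisible_upto m b -> exists c, closed_stage m c.
Proof.
move=> mb; have lec := in_model_card_leL.
have /choice [Bf BfP] c : exists d, f @` in_model c `|` g @` in_model c `<=` in_model d.
  by apply/in_model_bound/(card_leL_setU hL hpow); exact: card_le_trans (card_image_le _ _) (lec c).
pose code_value x := pair (tag 1) (pair (pval x) (pval (f x))).
have /choice [Bg BgP] c := succ_bounded hL hpow hK code_value (lec c).
have [Br BrP] := ex_refinement_bound m; have [Bs BsP] := ex_shrunk_bound mb.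
have [c0 c0P] := in_model_bound (card_leL_finite hL (finite_set3 a b m)).
have [c [cof gX c0c closed]] := ex_guessing_stage (range code_value) [:: Bf; Bg; Br; Bs] c0.
have into k x B : elems [:: Bf; Bg; Br; Bs] B -> k < c -> in_model (B k) x -> in_model c x.
  by move=> /closed Bc /Bc /Order.POrderTheory.ltW /in_model_mono; apply.
have below_c U := @small_in_model c U cof.
have one_below x : in_model c x -> exists2 k, k < c & in_model k x.
  move=> cx; have [|_ ->//|k kc kx] := below_c [set x]; first exact: small_set1.
  by exists k => //; exact: kx.
exists c; split=> //.
- by move=> x /c0P; apply: in_model_mono; exact: Order.POrderTheory.ltW.
- move=> x /one_below [k kc kx].
  by split; (apply: (into k _ Bf) => //; first by left); apply: BfP; [left|right]; exists x.
- move=> x y /one_below [k kc kx]; rewrite -gX.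
  split=> [[[x' _ /pairI [_ /pairI [/pval_inj -> ->]]]]|->] //.
  split; first by exists x.
  by apply: Order.POrderTheory.lt_trans (BgP k x kx) (closed Bg _ k kc); right; left.
- move=> u v d d0 cu cv sd dc d0d ex.
  have [|x|k kc kU] := below_c (d `|` [set u; v]).
  + by apply: (small_setU hL hpow) => //; exact/(small_finite hL)/finite_set2.
  + by move=> [/dc//|[->|->]].
  have ku : in_model k u by apply: kU; right; left.
  have kv : in_model k v by apply: kU; right; right.
  have [|y By ry] := BrP k u v d d0 ku kv sd _ d0d ex; first by move=> x dx; apply: kU; left.
  by exists y => //; apply: (into k _ Br) => //; right; right; left.
move=> k y kc /one_below [j jc jy] bigy; pose i := Order.max k j.
have ic : i < c by rewrite Order.TotalTheory.gt_max kc.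
have [|s [t [y' [By [bigy' sub st free]]]]] := BsP i y _ bigy.
  by apply: in_model_mono jy; rewrite Order.TotalTheory.le_max Order.POrderTheory.lexx orbT.
exists s, t, y'; split=> [x /By|]; first by apply: (into i _ Bs) => //; right; right; right; left.
split=> // z sz zt kz; apply: (free z sz zt); apply: in_model_mono kz.
by rewrite Order.TotalTheory.le_max Order.POrderTheory.lexx.
Qed.

Section ClosedStage.
Variables (m : N) (c : K).
Hypothesis mb : divisible_upto m b.
Hypothesis closed_c : closed_stage m c.

Let Q : structure := structure_of (model_at_wf c).
Let e : Q -> N := emb final_wf (model_at_elementary c).

Let ex_restriction x : in_model c x -> exists x', e x' = x.
Proof. exact: emb_onto. Qed.

Let emb_in_model x : in_model c (e x).
Proof. by rewrite /in_model /mkset pval_emb; exact: pvalP. Qed.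

Variables (a' b' m' : Q) (f' : Q -> Q).
Hypothesis a'E : e a' = a.
Hypothesis b'E : e b' = b.
Hypothesis m'E : e m' = m.
Hypothesis f'E : forall x, e (f' x) = f (e x).

Lemma restriction_mono x y : less x y <-> less (f' x) (f' y).
Proof. by rewrite !(emb_less final_wf (model_at_elementary c)) -/e !f'E. Qed.

Lemma restriction_surj y : exists x, f' x = y.
Proof.
have [_ gy] := closed_automorphism closed_c (emb_in_model y).
have [x xE] := ex_restriction gy; exists x.
by apply: (@emb_inj _ _ _ _ final_wf (model_at_elementary c)); rewrite -/e f'E xE fK.
Qed.

Lemma model_at_ex_refinement u v d d0 : refinable L a' b' m' u v d d0 ->
  exists y, refinement a' b' m' u v d d0 y.
Proof.
move=> hyp; have [sd _ d0d _ _] := hyp.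
have := refinable_emb final_wf (model_at_elementary c) hyp; rewrite -/e a'E b'E m'E => hypN.
have ex := refinement_of_saturated hL hpow final_PA two_le_nonstandard mb final_saturated hypN.
have [|_ [x d0x <-]|y cy refines] := closed_refinement closed_c (emb_in_model u) (emb_in_model v)
  (small_image (f := e) sd) _ _ ex.
- by move=> _ [x _ <-].
- by exists x => //; exact: d0d.
have [y' y'E] := ex_restriction cy; exists y'.
apply: (refinement_emb (PQ := model_at_elementary c) final_PA).
by rewrite -/e a'E b'E m'E y'E.
Qed.

Lemma model_at_ex_shrunk d y : small L d -> big a' (coded m' b' y) ->
  exists s t y', shrunk a' b' m' y (f' @^-1` dcl d) s t y'.
Proof.
move=> sd; rewrite (emb_big final_wf (model_at_elementary c)) -/e a'E b'E m'E => bigy.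
have [|k kc kd] := small_in_model (closed_cofinality closed_c) (small_image (f := e) sd).
  by move=> _ [x _ <-].
have [s0 [t0 [y0 [inQ]]]] := closed_shrunk closed_c kc (emb_in_model y) bigy.
have [s <-] : exists s, e s = s0 by apply/ex_restriction/inQ; left; left.
have [t <-] : exists t, e t = t0 by apply/ex_restriction/inQ; left; right.
have [y' <-] : exists y', e y' = y0 by apply/ex_restriction/inQ; right.
move=> [bigy' sub st free]; exists s, t, y'; split.
- by rewrite (emb_big final_wf (model_at_elementary c)) -/e a'E b'E m'E.
- by rewrite (emb_coded_sub final_wf (model_at_elementary c)) -/e b'E m'E.
- move=> x; rewrite (emb_coded final_wf (model_at_elementary c)) -/e b'E m'E => /st.
  by rewrite -!(emb_le final_wf (model_at_elementary c)).
move=> z sz zt dz; apply: (free (e z)).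
- exact/(emb_le final_wf (model_at_elementary c)).
- exact/(emb_le final_wf (model_at_elementary c)).
rewrite /preimage /mkset -f'E /in_model /mkset pval_emb.
have kc_elem := model_at_elementary_model_at kc.
have [|z' z'E _] := dcl_emb (wP := model_at_wf k) (wQ := model_at_wf c) (PQ := kc_elem)
  (d := emb (model_at_wf c) kc_elem @^-1` d) (z := f' z).
  apply: dcl_sub dz => x dx.
  have [|x' x'E] := emb_onto (model_at_wf k) kc_elem (x := x).
    by rewrite -(pval_emb final_wf (model_at_elementary c)); apply: kd; exists x.
  by exists x' => //; rewrite /= x'E.
by rewrite -z'E pval_emb; exact: pvalP.
Qed.

Lemma coded_image_restriction (A : set Q) :
  coded_image pair tag (guess c) (@pval _ _ (model_at_wf c) @` A) =
  @pval _ _ (model_at_wf c) @` (f' @` A).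
Proof.
have graph x y : guess c (pair (tag 1) (pair (pval x) y)) <-> y = pval (f' x).
  rewrite -(pval_emb final_wf (model_at_elementary c) x) -/e (guesses_graph closed_c) //.
  by rewrite -f'E pval_emb.
apply/seteqP; split=> [y [_ [x Ax <-] /graph ->]|_ [_ [x Ax <-] <-]].
  by exists (f' x) => //; exists x.
by exists (pval x); [exists x|apply/graph].
Qed.

Lemma closed_stage_killable : killable L P0 guess pair tag c h.
Proof.
have two_le_a' : pa_le (add one one) a'.
  rewrite (emb_le final_wf (model_at_elementary c)) emb_two -/e a'E; exact: two_le_nonstandard.
have pow_le_b' n : pa_le (power a' n) b'.
  by rewrite (emb_le final_wf (model_at_elementary c)) emb_pow -/e a'E b'E.
have f'b' : f' b' = a'.
  by apply: (@emb_inj _ _ _ _ final_wf (model_at_elementary c)); rewrite -/e f'E b'E a'E.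
have [F [PF Fpt FAB Fcuts]] := ex_cut_filling_filter hL hpow (@model_at_PA c)
  (structure_card_leL hL hpow hK leP0 (@belowS c) (model_at_wf c))
  (kept_cuts_card_leL hK (model_at_wf c))
  (@kept_cuts_avoidable _ _ _ _ hL hpow hK _ _ PA0 _ _ _ _ _ (@belowS c) (model_at_wf c))
  two_le_a' pow_le_b' restriction_mono restriction_surj f'b'
  model_at_ex_refinement model_at_ex_shrunk.
have [P [x [ext dx _ real good]]] :=
  ex_stage_model hL hpow hK PA0 leP0 (@belowS c) PF Fcuts.
pose A := lower_cut F; pose B := upper_cut F; pose q := @pval _ _ (model_at_wf c).
exists (Stage P (q @` (f' @` A), q @` (f' @` B))).
  apply: ext => _; apply: good FAB => _ _ [s As <-] [t Bt <-].
  apply: (restriction_mono s t).1; exact: (lower_upper_lt (@model_at_PA c) PF Fpt).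
exists (q @` A), (q @` B), x; split=> //.
- by move=> _ [s _ <-]; exact: pvalP.
- by move=> _ [t _ <-]; exact: pvalP.
- split=> _ [s Fs <-].
    apply: (real unit (fun=> s) (Neg (Less (Var None) (Var (Some tt))))).
    by apply: filterS Fs => z /(pa_leNlt (@model_at_PA c)).
  apply: (real unit (fun=> s) (Neg (Less (Var (Some tt)) (Var None)))).
  by apply: filterS Fs => z /(pa_leNlt (@model_at_PA c)).
split; first by rewrite !coded_image_restriction.
have [_ [_ [[s As _] _ _]]] := FAB set0 (small_set0 hL (T := Q)).
by exists (q (f' s)), (f' s) => //; exists s.
Qed.

(* The new element x of step c fills the original cut, so that f x fills the cut
   that has to stay unfilled. *)
Lemma closed_stage_not_kills : ~ kills pair tag (model_at c) (h c) (guess c).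
Proof.
move=> [A [B [x [AQ BQ dx [Ax xB] [keptE act]]]]].
have [_ _ [w [_ avoid]]] := limit_good_cut hL hpow hK PA0 (fun _ _ _ _ => I) allS (I : setT c) act.
rewrite (Prop_irrelevance w final_wf) in avoid *.
have graph y z : dom (model_at c) y -> guess c (pair (tag 1) (pair y (pval (z : N)))) ->
    exists2 y', pval y' = y & z = f y'.
  move=> dy; pose y' := pSub final_wf ((model_at_elementary c).1 _ dy).
  have y'E : pval y' = y by exact: pSubK.
  rewrite -y'E => /(guesses_graph closed_c) zE; exists y' => //; apply/pval_inj/zE.
  by rewrite /in_model /mkset y'E.
have dxN := (stage_elementary c).1 _ dx; pose x' := pSub final_wf dxN.
have [u [v [/=]]] := avoid [set f x'] (small_set1 hL (x := f x')).
rewrite keptE /= => -[u0 Au0 /(graph _ _ (AQ _ Au0)) [u' u'E ->]].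
move=> [v0 Bv0 /(graph _ _ (BQ _ Bv0)) [v' v'E ->]] /(_ (f x')) out.
have [|] : outside (f u') (f v') (f x') by apply: out; exact: dcl_self.
  rewrite -fmono pval_less pSubK u'E -(elementary_less (stage_elementary c)) //.
    exact: Ax.
  exact: (model_at_elementary_stage c).1 _ (AQ _ Au0).
rewrite -fmono pval_less pSubK v'E -(elementary_less (stage_elementary c)) //.
  exact: xB.
exact: (model_at_elementary_stage c).1 _ (BQ _ Bv0).
Qed.

End ClosedStage.

Lemma automorphism_absurd : False.
Proof.
have [m mb] := ex_divisible_upto final_PA b.
have [c closed_c] := ex_closed_stage mb.
pose e := emb (wP := model_at_wf c) final_wf (model_at_elementary c).
have restrict x : in_model c x -> exists x', e x' = x by exact: emb_onto.
have [a' a'E] := restrict a (closed_constants closed_c (or_introl (or_introl erefl))).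
have [b' b'E] := restrict b (closed_constants closed_c (or_introl (or_intror erefl))).
have [m' m'E] := restrict m (closed_constants closed_c (or_intror erefl)).
have /choice [f' f'E] x : exists y, e y = f (e x).
  apply: restrict; apply: (closed_automorphism closed_c _).1.
  by rewrite /in_model /mkset pval_emb; exact: pvalP.
have [_ kills_c _] := hS c.
apply: (closed_stage_not_kills closed_c); apply: kills_c.
exact: (closed_stage_killable mb closed_c a'E b'E m'E f'E).
Qed.

End Automorphism.

Lemma final_automorphism_lt_power (f : N -> N) (a b : N) : order_automorphism f ->
  ~ standard a -> f b = a -> exists n, less b (power a n).
Proof.
move=> [[g _ fK] fmono] na fb; apply: contrapT => /forallNP bounded.
by apply: (automorphism_absurd fmono fK na _ fb) => n; apply/(pa_leNlt final_PA).
Qed.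

Lemma final_E5_sub_E4 (a b : N) : E5 a b -> E4 a b.
Proof.
move=> [na nb [f autf fa]]; have [n an] := final_automorphism_lt_power autf nb fa.
have [[g fK gK] fmono] := autf.
have autg : order_automorphism g.
  by split=> [|x y]; [exists f|rewrite (fmono (g x)) !gK].
have [k bk] : exists k, less b (power a k).
  by apply: (final_automorphism_lt_power autg na); rewrite -fa fK.
exact: E4_of_lt_power final_PA na nb an bk.
Qed.

Lemma final_elementary : elementary P0 final_model.
Proof. exact: (limit_elementary hK w0 (fun _ _ _ _ => I) allS (earlier0 P0 setT h)). Qed.

End FinalModel.

(* The ultrapower by a principal ultrafilter of the functions definable without
   parameters. *)
Lemma ex_small_model (dL : Order.disp_t) (L : orderType dL) (dK : Order.disp_t)
    (K : orderType dK) (M : structure) : is_infinite_cardinal L ->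
  [set: short_seq L] #= [set: L] -> is_succ_cardinal L K -> model_of_PA M ->
  exists (P : prestructure K) (w : wf_pre P), [/\ model_of_PA (structure_of w),
    dom P #<= [set: L] & Th M `<=` Th (structure_of w)].
Proof.
move=> hL hpow hK hM.
have led := card_leL_definable_map hL hpow (card_leL_finite hL (@finite_set0 M)).
have [name _ nameP] : exists2 name : (M -> M) -> K, forall y, name (of_void _ y) = of_void K y &
    forall h h', definable_map set0 h -> definable_map set0 h' ->
      (name h = name h' <-> principal_filter zero [set t | h t = h' t]).
  apply: (name_classes hL hpow hK led) => //; try by case.
  - by rewrite (_ : range _ = set0) ?card_ge0 //; apply/seteqP; split=> // _ [[]].
  - by move=> h h'; rewrite !principal_filterP => /esym.
  - by move=> h h' h''; rewrite !principal_filterP => /= ->.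
have valid := ultrapower_valid hM (principal_filter_ultra zero) (nameP := nameP).
exists (ultrapower set0 (principal_filter zero) name), (ultrapower_wf nameP); split.
- by move=> p ax; apply: valid => v; exact: hM.
- exact: card_le_trans (card_image_le _ _) led.
- by move=> p Mp; apply: valid => v; rewrite (_ : v = of_void M) //; apply: funext => -[].
Qed.

Theorem theorem3p10
  (dL : Order.disp_t) (L : orderType dL)
  (dK : Order.disp_t) (K : orderType dK)
  (hL : is_infinite_cardinal L)
  (hpow : ([set: short_seq L] #= [set: L])%card)
  (hK : is_succ_cardinal L K)
  (hdiamond : diamond [set a : K | has_cofinality L a]%classic)
  (M : structure) (hM : model_of_PA M) :
  exists N : structure,
    [/\ (Th M `<=` Th N)%classic,
        saturated L N,
        ([set: N] #= [set: K])%card &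
        forall a b : N, E5 a b -> E4 a b].
Proof.
have [P0 [w0 [PA0 leP0 ThP0]]] := ex_small_model hL hpow hK hM.
have [guess [_ guessP]] := hdiamond.
have [pair pairI] := pairing_succ hL hpow hK.
have [tag tagI] : exists tag : nat -> K, injective tag.
  by have [n nI] := nat_injL hL; have [i iI] := injLK hK; exists (i \o n); exact: inj_comp.
have [h hS] := ex_chain hL hpow hK PA0 leP0 guess pair tag.
exists (structure_of (final_wf hK w0 hS)); split.
- by move=> p /ThP0; apply: elementary_Th; exact: (final_elementary hK w0 hS).
- by apply: saturated_of_sets; exact: (final_saturated hL hpow pairI tagI guessP).
- exact: (final_card hL hpow hK PA0 pairI tagI guessP hS).
- exact: (final_E5_sub_E4 hL hpow PA0 leP0 pairI tagI guessP).
Qed.
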